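(* Let $f$ be a GSP over $T\in\{\mathbb Z,\mathbb R\}$ with spectral measure $\rho$ such that $m_0=\rho(T^* )=1$ and $m_\delta<\infty$ for some $\delta>0$. Assume that $\rho_{ac}\ne0$ and that $\sigma_N^2\le bN^{-\gamma}$ for all $N>0$ and some $b,\gamma>0$. Then there exist $N_0,C>0$ such that for all $N>N_0$: $$\log P_f(N)\le\begin{cases}-CN^{\gamma}\log N, & \gamma<1,\\ -CN, & \gamma=1,\\ -CN\log N, & \gamma>1.\end{cases}$$ Here $N_0$ and $C$ depend on $b,\gamma,m_{-\gamma+\varepsilon},m_{-2k},\nu,E$, where $\varepsilon>0$ is arbitrary, $E$ is a set (bounded, of positive Lebesgue measure) and $\nu>0$ a number such that $d\rho_{ac}\ge\nu\,dx$ on $E$, and $\gamma=2k+s$ with $k\in\mathbb N\cup\{0\}$ and $0\le s<2$. The dependence of $C$ on $E$ is linear in the Lebesgue measure $|E|$.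
   Context: Let $T\in\{\mathbb Z,\mathbb R\}$; put $T^*=\mathbb R$ if $T=\mathbb R$ and $T^*=[-\pi,\pi]$ if $T=\mathbb Z$. A GSP (Gaussian stationary process) over $T$ is a random function $f:T\to\mathbb R$ whose finite-dimensional marginals are centered multivariate Gaussian and whose distribution is invariant under translations by elements of $T$; throughout, $f$ is assumed almost surely continuous with continuous covariance kernel $r(t)=\mathbb E[f(0)f(t)]$. Its spectral measure is the finite, symmetric, non-negative measure $\rho$ on $T^*$ such that $r(t)=\int_{T^*}e^{-i\lambda t}\,d\rho(\lambda)$ for $t\in T$; $\rho_{ac}$ denotes its absolutely continuous component, and $\rho_{ac}\neq0$ means that this component is not trivial. The persistence probability is $P_f(N)=\mathbb P\big(f(t)>0\ \ \forall t\in(0,N]\cap T\big)$. For $\delta\in\mathbb R$ put $m_\delta=m_\delta(\rho)=\int_{T^*}|\lambda|^\delta\,d\rho(\lambda)$, and for $N>0$ put $\sigma_N^2=\rho([0,\tfrac1N])$. *)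

(* Defs.v *)
From HB Require Import structures.
From mathcomp Require Import all_boot all_order all_algebra.
From mathcomp Require Import all_classical all_reals all_analysis.

Set Implicit Arguments.
Unset Strict Implicit.
Unset Printing Implicit Defensive.

Import Order.TTheory GRing.Theory Num.Theory.
Import numFieldNormedType.Exports.
Local Open Scope classical_set_scope.
Local Open Scope ring_scope.

Inductive time := TimeZ | TimeR.

(* Both index groups are viewed as subsets of R.  A process over T is a family
   indexed by R of which only the members with index in [times R T] are ever
   used or constrained below. *)
Definition times (R : realType) (T : time) : set R :=
  match T with
  | TimeZ => range (fun n : int => n%:~R)
  | TimeR => setT
  end.

Arguments times R T : clear implicits.

(* The frequency domain T^*. *)
Definition freqs (R : realType) (T : time) : set R :=
  match T with
  | TimeZ => `[- pi, pi]
  | TimeR => setT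
  end.

Arguments freqs R T : clear implicits.

(* The product sigma-algebra on paths, generated by the evaluations at the
   points of T. *)
Definition path_measurable (R : realType) (T : time) : set (set (R -> R)) :=
  <<s [set G | exists2 t, times R T t &
         exists2 B : set R, measurable B & G = [set g | B (g t)]] >>.

(* The point mass at 0 is the degenerate Gaussian; it has to be listed
   separately since [normal_prob 0 0] is not [\d_0] in the library. *)
Definition centered_gaussian_law (R : realType) (mu : set R -> \bar R) : Prop :=
  (exists2 sg : R, 0 < sg &
     forall B, measurable B -> mu B = normal_prob 0 sg B)
  \/ (forall B, measurable B -> mu B = \d_(0 : R) B).

Section process.
Context (R : realType) (T : time) (d : measure_display)
  (Omega : measurableType d) (P : probability Omega R)
  (X : R -> {RV P >-> R}).

(* A random vector is centered multivariate Gaussian when all linear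
   combinations of its coordinates are centered (possibly degenerate)
   Gaussian. *)
Definition gaussian_marginals : Prop :=
  forall (n : nat) (t : 'I_n -> R) (a : 'I_n -> R),
    (forall i, times R T (t i)) ->
    centered_gaussian_law
      (fun B => P [set w | B (\sum_(i < n) a i * X (t i) w)]).

Definition stationary : Prop :=
  forall (h : R) (A : set (R -> R)), times R T h -> path_measurable T A ->
    P [set w | A (fun t => X (t + h) w)] = P [set w | A (fun t => X t w)].

Definition cov_kernel (t : R) : R := fine 'E_P[X 0 \* X t].

Record is_GSP : Prop := {
  GSP_gaussian : gaussian_marginals ;
  GSP_stationary : stationary ;
  GSP_continuous :
    {ae P, forall w, {within times R T, continuous (fun t => X t w)}} ;
  GSP_cov_continuous : {within times R T, continuous cov_kernel}
}.

(* A measure on T^* is a measure on R carried by T^*.  The complex identity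
   r(t) = \int e^{-i l t} d rho(l) is split into real and imaginary parts. *)
Record is_spectral_measure
    (rho : {finite_measure set (measurableTypeR R) -> \bar R}) : Prop := {
  spectral_carried : rho (~` freqs R T) = 0%E ;
  spectral_symmetric :
    forall A : set R, measurable A -> rho [set - l | l in A] = rho A ;
  spectral_re : forall t, times R T t ->
    (cov_kernel t)%:E = (\int[rho]_(l in freqs R T) (cos (l * t))%:E)%E ;
  spectral_im : forall t, times R T t ->
    (\int[rho]_(l in freqs R T) (- sin (l * t))%:E)%E = 0%E
}.

(* For T = R the event need not belong to the sigma-algebra of Omega, but by
   almost sure continuity it does up to a null set; the outer measure [mu_ext P]
   therefore computes its probability under the completion of P, and it agrees
   with P on measurable events. *)
Definition persistence (N : R) : \bar R :=
  mu_ext P [set w | forall t, times R T t -> 0 < t <= N -> 0 < X t w].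

End process.

(* |l|^delta, with the value +oo at l = 0 when delta < 0 (the library's
   [powR] is 0 there). *)
Definition abs_power (R : realType) (delta l : R) : \bar R :=
  if (l == 0) && (delta < 0) then +oo%E else (`|l| `^ delta)%:E.

Definition moment (R : realType) (T : time)
    (rho : {finite_measure set (measurableTypeR R) -> \bar R}) (delta : R) :
    \bar R :=
  (\int[rho]_(l in freqs R T) abs_power delta l)%E.

(* rho_ac is the absolutely continuous part in the (unique) Lebesgue
   decomposition of rho with respect to Lebesgue measure. *)
Definition is_ac_component (R : realType)
    (rho : {finite_measure set (measurableTypeR R) -> \bar R})
    (rho_ac : {measure set (measurableTypeR R) -> \bar R}) : Prop :=
  (forall A, measurable A -> lebesgue_measure A = 0%E -> rho_ac A = 0%E) /\
  exists rho_s : {measure set (measurableTypeR R) -> \bar R},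
    (exists S, [/\ measurable S, lebesgue_measure S = 0%E &
                   rho_s (~` S) = 0%E]) /\
    (forall A, measurable A -> rho A = (rho_ac A + rho_s A)%E).

(* nu > 0 and d rho_ac >= nu dx on the bounded set E of positive measure. *)
Definition ac_lower_bound (R : realType)
    (rho_ac : {measure set (measurableTypeR R) -> \bar R})
    (E : set (measurableTypeR R)) (nu : R) : Prop :=
  [/\ measurable E, bounded_set (E : set R), (0 < lebesgue_measure E)%E,
      0 < nu &
      forall A, measurable A -> A `<=` E ->
        (nu%:E * lebesgue_measure A <= rho_ac A)%E].

Definition persistence_rate (R : realType) (gamma N : R) : R :=
  if gamma < 1 then N `^ gamma * ln N
  else if gamma == 1 then N
  else N * ln N.

(* Main.v *)
Require Import Defs.
From HB Require Import structures.
From mathcomp Require Import all_boot all_order all_algebra.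
From mathcomp Require Import all_classical all_reals all_analysis.
From mathcomp Require Import measurable_realfun.
From mathcomp Require Import ring lra.

Set Implicit Arguments.
Unset Strict Implicit.
Unset Printing Implicit Defensive.

Import Order.TTheory GRing.Theory Num.Theory.
Import numFieldNormedType.Exports.
Local Open Scope classical_set_scope.
Local Open Scope ring_scope.

(* On a set E of positive measure the spectrum dominates nu dx, and by Bessel's
   inequality one can select m ~ N |E| coarse grid times at which the process
   keeps conditional variance at least nu |E| / 2 given the earlier ones.  On
   the other hand sigma_N^2 <= b N^(-gamma) makes the average of the process
   over many shifts of these times have variance O(N^(-gamma)).  If the process
   is positive on (0, N], then either this average exceeds a level lv, which has
   probability at most exp(-c lv^2 N^gamma), or at least half of the shifts see
   a positive path of mean at most 2 lv.  The latter event is bounded by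
   E prod_j g(X(t_j)) for a test function g that majorizes
   y |-> exp(beta (1 - y / (2 lv))) on positive reals and whose averages over a
   nondegenerate Gaussian of arbitrary mean are at most s < 1; successive
   conditioning gives the bound s^m.  The rate comes from the choice of lv:
   constant for gamma = 1, N^(-(gamma - 1)/4) for gamma > 1, and of order
   sqrt (ln N) for gamma < 1. *)

(** * Centered Gaussian laws *)

(** Conditioning is never done on sigma-algebras. Gaussian vectors enter through characteristic
    functions only, and this dictates the test functions: a constant plus a combination of Gaussian
    bumps. A bump times a cosine is a Gaussian mixture of cosines of linear combinations, and
    averaging a bump over Gaussian noise gives an explicit wider bump. Two time steps are needed.
    The coarse step [h0] puts [E], up to a null set, inside one period [[-pi/h0, pi/h0]], where the
    grid exponentials are orthogonal. The fine step [h] of the shifts makes the spectral mass beyond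
    the aliasing frequency [pi/h] of order N^(-gamma); it may depend on N and on the measure,
    because the number of shifts cancels in Markov's inequality. Linearity of C in |E|: the number m
    of selected times is proportional to |E|, and for gamma <= 1 so is lv^2, hence the Gaussian
    exponent. For gamma > 1 the Gaussian exponent, and for gamma < 1 the product exponent, wins by a
    power of N, so that any other dependence on |E| moves into N0. *)

Section gaussian_integrals.
Context {R : realType}.
Local Notation mu := (@lebesgue_measure R).

Lemma integral_normal_prob (m s : R) (f : R -> R) :
  (normal_prob m s).-integrable setT (EFin \o f) ->
  (\int[normal_prob m s]_x (f x)%:E =
   \int[mu]_x ((f x)%:E * (normal_pdf m s x)%:E))%E.
Proof.
move=> fint; have mf := measurable_int _ fint.
rewrite -(Radon_Nikodym_change_of_variables (normal_prob_dominates m s))//=.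
apply: ae_eq_integral => //.
- apply: emeasurable_funM => //; apply: (measurable_int mu).
  by apply: Radon_Nikodym_integrable; exact: normal_prob_dominates.
- apply: emeasurable_funM => //=.
  by apply/measurable_EFinP; exact: measurable_normal_pdf.
- apply: ae_eqe_mul2l => /=.
  rewrite Radon_NikodymE//=; first exact: normal_prob_dominates.
  move=> dom; case: cid => /= h [h1 h2 h3].
  apply: integral_ae_eq => //=.
  + by apply/measurable_EFinP; exact: measurable_normal_pdf.
  + by move=> E _ mE; rewrite -h3.
Qed.

(** Integration by parts on the whole line: the fundamental theorem on symmetric intervals, then
    dominated convergence. It yields the Stein identities below. *)
Lemma integral_derive_eq0 (F f : R -> R) :
  (forall x : R, is_derive x 1 F (f x)) -> continuous f ->
  mu.-integrable setT (EFin \o f) ->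
  F x @[x --> +oo%R] --> 0 -> F (- x) @[x --> +oo%R] --> 0 ->
  (\int[mu]_x (f x)%:E = 0)%E.
Proof.
move=> dF cf intf Fy FNy.
have mf := measurable_int _ intf.
(* [n.+1] keeps the interval nondegenerate at n = 0, since the fundamental theorem is applied with
   strictly ordered endpoints. *)
pose I (n : nat) : set R := `[- (n.+1%:R : R), n.+1%:R]%classic.
pose g n := (EFin \o f) \_ (I n).
have mI n : measurable (I n) by exact: measurable_itv.
have dom : [/\ mu.-integrable setT (EFin \o f),
    [sequence (\int[mu]_x `|g n x - (f x)%:E|)%E]_n @ \oo --> 0%E &
    [sequence (\int[mu]_x g n x)%E]_n @ \oo --> (\int[mu]_x (f x)%:E)%E].
  apply: (@dominated_convergence _ _ _ mu _ _ g _ (fun x => `|(f x)%:E|)%E) => //.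
  - move=> n; apply/(measurable_restrict _ (mI n)) => //.
    exact: measurable_funS mf.
  - apply: aeW => x _; apply: cvg_near_cst; near=> n.
    rewrite /g patchE mem_set//= /I/= in_itv/= -ler_norml.
    near: n; exists (Num.truncn `|x|) => // n /= xn.
    apply/ltW/(lt_le_trans (truncnS_gt _)); rewrite ler_nat; exact: leq_trans xn _.
  - exact: integrable_abse.
  - apply: aeW => x n _; rewrite /g patchE; case: ifP => // _; rewrite ?abse0//.
have [_ _ gcvg] := dom.
have gE n : (\int[mu]_x g n x = (F n.+1%:R - F (- n.+1%:R))%:E)%E.
  rewrite /g -integral_mkcond (@continuous_FTC2 _ f F)//.
  - by rewrite -subr_gt0 opprK -natrD ltr0n.
  - exact: continuous_subspaceT.
  - split.
    + by move=> x _; have [] := dF x.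
    + apply: cvg_at_right_filter; apply: differentiable_continuous.
      by apply/derivable1_diffP; have [] := dF (- n.+1%:R).
    + apply: cvg_at_left_filter; apply: differentiable_continuous.
      by apply/derivable1_diffP; have [] := dF (n.+1%:R).
  - by move=> x _; rewrite derive1E; have [_ ->] := dF x.
have cn : (n.+1%:R : R) @[n --> \oo] --> +oo%R.
  by rewrite (cvg_shiftS (fun n => n%:R : R)); exact: cvgr_idn.
have g0 : (fun n => \int[mu]_x g n x)%E @ \oo --> 0%E.
  under eq_fun do rewrite gE.
  apply: cvg_EFin; first exact: nearW.
  rewrite -[X in _ --> X](subr0 (0:R)); apply: cvgB.
  - exact: (cvg_comp _ _ cn Fy).
  - exact: (cvg_comp _ _ cn FNy).
exact: (cvg_unique _ gcvg g0).
Unshelve. all: by end_near. Qed.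

Lemma cvgy_le_divr (F : R -> R) (C : R) :
  (forall x, 0 < x -> `|F x| <= C / x) -> F x @[x --> +oo%R] --> 0.
Proof.
move=> FC; apply/cvgrPdist_le => e e0; near=> x.
have x0 : 0 < x by near: x; exact: nbhs_pinfty_gt.
rewrite sub0r normrN (le_trans (FC _ x0))// ler_pdivrMr//.
rewrite mulrC -ler_pdivrMr//; near: x; exact: nbhs_pinfty_ge.
Unshelve. all: by end_near. Qed.

Section centered_normal.
Variable s : R.
Hypothesis s0 : 0 < s.
Let p := normal_pdf 0 s.

Let pE x : p x = normal_peak s * expR (- x ^+ 2 / (s ^+ 2 *+ 2)).
Proof. by rewrite /p normal_pdfE ?gt_eqF// /normal_fun subr0. Qed.

Let p_ge0 x : 0 <= p x. Proof. exact: normal_pdf_ge0. Qed.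

Let mp : measurable_fun setT p. Proof. exact: measurable_normal_pdf. Qed.

Let is_derive_p (x : R) : is_derive x 1 p (- (x / s ^+ 2) * p x).
Proof.
have -> : p = fun x => normal_peak s * expR (- x ^+ 2 / (s ^+ 2 *+ 2)).
  by apply/funext => y; exact: pE.
apply: is_derive_eq; rewrite /GRing.scale/=.
have : s != 0 by rewrite gt_eqF.
by move=> ?; field.
Qed.

(** With u = x^2 / (4 s^2) the density is a multiple of exp(-2u). One factor exp(-u) absorbs x^2
    through u exp(-u) <= 1; the other is, up to a constant, the density of standard deviation
    sqrt(2) s. Integrability of the second moment and decay at infinity both follow. *)
Let sqr_p_le x : x ^+ 2 * p x <=
  4 * s ^+ 2 * (normal_peak s / normal_peak (Num.sqrt 2 * s)) *
  normal_pdf 0 (Num.sqrt 2 * s) x.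
Proof.
have r0 : 0 < Num.sqrt 2 * s by rewrite mulr_gt0// sqrtr_gt0.
rewrite normal_pdfE ?gt_eqF// /normal_fun subr0 pE.
have k0 : 0 < normal_peak (Num.sqrt 2 * s) by rewrite normal_peak_gt0 ?gt_eqF.
have -> : 4 * s ^+ 2 * (normal_peak s / normal_peak (Num.sqrt 2 * s)) *
  (normal_peak (Num.sqrt 2 * s) * expR (- x ^+ 2 / ((Num.sqrt 2 * s) ^+ 2 *+ 2)))
  = normal_peak s * (4 * s ^+ 2 * expR (- x ^+ 2 / ((Num.sqrt 2 * s) ^+ 2 *+ 2))).
  by field; rewrite gt_eqF.
rewrite mulrCA ler_wpM2l ?normal_peak_ge0//.
rewrite exprMn sqr_sqrtr//.
set u := x ^+ 2 / (4 * s ^+ 2).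
have -> : - x ^+ 2 / (2 * s ^+ 2 *+ 2) = - u.
  by rewrite /u; field; rewrite gt_eqF.
have -> : - x ^+ 2 / (s ^+ 2 *+ 2) = - u - u.
  by rewrite /u; field; rewrite gt_eqF.
rewrite expRD mulrA ler_wpM2r ?expR_ge0//.
have -> : x ^+ 2 = 4 * s ^+ 2 * u by rewrite /u; field; rewrite gt_eqF.
have u1 : u * expR (- u) <= 1.
  rewrite expRN ler_pdivrMr ?expR_gt0// mul1r.
  by rewrite (le_trans _ (expR_ge1Dx _))// lerDr.
have k4 : 0 <= 4 * s ^+ 2 by rewrite mulr_ge0// sqr_ge0.
by have := ler_wpM2l k4 u1; rewrite mulr1 mulrA.
Qed.

Lemma integrable_sqr_normal_pdf :
  mu.-integrable setT (fun x => (x ^+ 2 * normal_pdf 0 s x)%:E).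
Proof.
set C := 4 * s ^+ 2 * (normal_peak s / normal_peak (Num.sqrt 2 * s)).
apply: (@le_integrable _ _ _ mu _ measurableT _
  (fun x => (C%:E * (normal_pdf 0 (Num.sqrt 2 * s) x)%:E)%E)) => //.
- by apply/measurable_EFinP; apply: measurable_funM => //; exact: exprn_measurable.
- move=> x _; rewrite -EFinM !abse_EFin lee_fin (le_trans _ (ler_norm _))//.
  rewrite ger0_norm; first exact: sqr_p_le.
  exact: mulr_ge0 (sqr_ge0 _) (p_ge0 _).
- by apply: integrableZl => //; exact: integrable_normal_pdf.
Qed.

Lemma integrable_mulr_normal_pdf :
  mu.-integrable setT (fun x => (x * normal_pdf 0 s x)%:E).
Proof.
apply: (@le_integrable _ _ _ mu _ measurableT _
  (fun x => ((normal_pdf 0 s x)%:E + (x ^+ 2 * normal_pdf 0 s x)%:E)%E)) => //.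
- by apply/measurable_EFinP; exact: measurable_funM.
- move=> x _; rewrite -EFinD !abse_EFin lee_fin (le_trans _ (ler_norm _))//.
  rewrite normrM (ger0_norm (p_ge0 x)) -[X in _ <= X + _]mul1r -mulrDl.
  rewrite ler_wpM2r// -(real_normK (num_real x)).
  by rewrite -subr_ge0; have := sqr_ge0 (`|x| - 1); have := normr_ge0 x; nra.
- apply: integrableD => //; first exact: integrable_normal_pdf.
  exact: integrable_sqr_normal_pdf.
Qed.

Let p_cvg : exists C : R, forall x, 0 < x -> p x <= C / x /\ x * p x <= C / x.
Proof.
set k := 4 * s ^+ 2 * (normal_peak s / normal_peak (Num.sqrt 2 * s)) *
  normal_peak (Num.sqrt 2 * s).
have r0 : Num.sqrt 2 * s != 0 by rewrite gt_eqF// mulr_gt0// sqrtr_gt0.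
have k0 : 0 <= k by rewrite /k !mulr_ge0 ?invr_ge0 ?normal_peak_ge0 ?(ltW s0).
have xk x : x ^+ 2 * p x <= k.
  apply: le_trans (sqr_p_le x) _; rewrite ler_wpM2l ?normal_pdf_ub//.
  by rewrite !mulr_ge0 ?invr_ge0 ?normal_peak_ge0 ?(ltW s0).
have pk x : p x <= normal_peak s by rewrite normal_pdf_ub ?gt_eqF.
exists (k + normal_peak s) => x x0; rewrite !ler_pdivlMr//.
have := xk x; have := pk x; have := p_ge0 x; have := normal_peak_ge0 s.
split; last by nra.
by have := sqr_ge0 (x - 1); nra.
Qed.

Lemma integrable_bdM_normal_pdf (f : R -> R) (M : R) :
  measurable_fun setT f -> (forall x, `|f x| <= M) ->
  mu.-integrable setT (fun x => (f x * normal_pdf 0 s x)%:E).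
Proof.
move=> mf fM.
apply: (@le_integrable _ _ _ mu _ measurableT _
  (fun x => (M%:E * (normal_pdf 0 s x)%:E)%E)) => //.
- by apply/measurable_EFinP; exact: measurable_funM.
- move=> x _; rewrite -EFinM !abse_EFin lee_fin (le_trans _ (ler_norm _))//.
  by rewrite normrM (ger0_norm (p_ge0 x)) ler_wpM2r// fM.
- by apply: integrableZl => //; exact: integrable_normal_pdf.
Qed.

Let measurable_cosM (c b : R) : measurable_fun setT (fun x => cos (b * x + c)).
Proof.
apply: continuous_measurable_fun => x; apply: continuous_comp.
  apply: continuousD; last exact: cvg_cst.
  by apply: continuousM => //; exact: cvg_cst.
exact: continuous_cos.
Qed.

Let measurable_sinM (c b : R) : measurable_fun setT (fun x => sin (b * x + c)).
Proof.
apply: continuous_measurable_fun => x; apply: continuous_comp.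
  apply: continuousD; last exact: cvg_cst.
  by apply: continuousM => //; exact: cvg_cst.
exact: continuous_sin.
Qed.

Let integrable_xsin (c b : R) :
  mu.-integrable setT (fun x => (x * sin (b * x + c) * p x)%:E).
Proof.
apply: (@le_integrable _ _ _ mu _ measurableT _
    (fun x => (x * normal_pdf 0 s x)%:E)) => //.
- apply/measurable_EFinP; apply: measurable_funM => //.
  by apply: measurable_funM => //; exact: measurable_sinM.
- move=> x _; rewrite !abse_EFin lee_fin !normrM ler_wpM2r//.
  by rewrite ler_piMr// sin_max.
- exact: integrable_mulr_normal_pdf.
Qed.

(** Stein's identity E[x f(x)] = s^2 E[f'(x)] for f(x) = sin(bx + c), obtained because the
    derivative of f p integrates to 0. *)
Let stein_sin (c b : R) :
  \int[mu]_x (x * sin (b * x + c) * p x) =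
  s ^+ 2 * b * \int[mu]_x (cos (b * x + c) * p x).
Proof.
have s2 : s != 0 by rewrite gt_eqF.
pose F x := sin (b * x + c) * p x.
pose f x := b * (cos (b * x + c) * p x) - (s ^+ 2)^-1 * (x * sin (b * x + c) * p x).
have i1 : mu.-integrable setT (fun x => (cos (b * x + c) * p x)%:E).
  by apply: (@integrable_bdM_normal_pdf _ 1) => // x; exact: cos_max.
have dF (x : R) : is_derive x 1 F (f x).
  have d1 : is_derive x 1 (fun x : R => sin (b * x + c)) (b * cos (b * x + c)).
    by apply: is_derive_eq; rewrite /GRing.scale/=; ring.
  apply: (is_derive_eq (is_deriveM d1 (is_derive_p x))).
  by rewrite /f /GRing.scale/=; field.
have [C pC] := p_cvg.
have Fb x : 0 < x -> `|F x| <= C / x.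
  move=> x0; rewrite /F normrM (ger0_norm (p_ge0 x)).
  by apply: le_trans (pC x x0).1; rewrite ler_piMl// sin_max.
have int0 : (\int[mu]_x (f x)%:E = 0)%E.
  apply: (@integral_derive_eq0 F) => //.
  - have cp : continuous p by apply: continuous_normal_pdf.
    have cc : continuous (fun x : R => cos (b * x + c)).
      move=> x; apply: continuous_comp; last exact: continuous_cos.
      apply: continuousD; last exact: cvg_cst.
      by apply: continuousM => //; exact: cvg_cst.
    have cs : continuous (fun x : R => sin (b * x + c)).
      move=> x; apply: continuous_comp; last exact: continuous_sin.
      apply: continuousD; last exact: cvg_cst.
      by apply: continuousM => //; exact: cvg_cst.
    have c1 : continuous (fun x : R => b * (cos (b * x + c) * p x)).
      move=> x; apply: cvgM; first exact: cvg_cst.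
      by apply: cvgM; [exact: cc|exact: cp].
    have c2 : continuous (fun x : R => (s ^+ 2)^-1 * (x * sin (b * x + c) * p x)).
      move=> x; apply: cvgM; first exact: cvg_cst.
      apply: cvgM; last exact: cp.
      by apply: cvgM; [exact: cvg_id|exact: cs].
    by move=> x; exact: continuousB (c1 x) (c2 x).
  - exact: (integrableB measurableT (integrableZl measurableT b i1)
      (integrableZl measurableT (s ^+ 2)^-1 (integrable_xsin c b))).
  - exact: cvgy_le_divr Fb.
  - apply: (@cvgy_le_divr _ C) => x x0.
    rewrite /F normrM (ger0_norm (p_ge0 _)) pE sqrrN -pE.
    by apply: le_trans (pC x x0).1; rewrite ler_piMl// sin_max.
have : \int[mu]_x (f x) = 0 by rewrite /Rintegral int0.
rewrite /f RintegralB//; last 2 first.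
- exact: (integrableZl measurableT b i1).
- exact: (integrableZl measurableT _ (integrable_xsin c b)).
rewrite RintegralZl// RintegralZl//; last exact: integrable_xsin.
move/eqP; rewrite subr_eq0 => /eqP e.
by rewrite -mulrA e mulrA mulfV ?mul1r// expf_neq0.
Qed.

(** As a function of b the integral solves phi' = - s^2 b phi, by differentiation under the integral
    and Stein's identity; hence phi times exp(s^2 b^2 / 2) is constant, with value cos a at 0. The
    phase a covers real and imaginary parts of the characteristic function at once. *)
Lemma integral_cos_normal_pdf (a b : R) :
  \int[mu]_x (cos (b * x + a) * normal_pdf 0 s x) = expR (- (s ^+ 2 * b ^+ 2 / 2)) * cos a.
Proof.
pose phi b := \int[mu]_x (cos (b * x + a) * p x).
have dphi (c : R) : is_derive c 1 phi (- (s ^+ 2 * c * phi c)).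
  pose G (x : R) := `|x * p x|.
  have dfx (x y : R) : is_derive x 1 (fun x => cos (x * y + a) * p y)
      (- (y * sin (x * y + a) * p y)).
    by apply: is_derive_eq; rewrite /GRing.scale/=; ring.
  have pE2 (x y : R) : partial1of2 (fun c x => cos (c * x + a) * p x) x y =
      - (y * sin (x * y + a) * p y).
    by rewrite partial1of2E; have [_ ->] := dfx x y.
  have key := @derivable_under_integral R _ _ mu
    (fun c x => cos (c * x + a) * p x) setT measurableT c (c - 1) (c + 1).
  have key2 := @differentiation_under_integral R _ _ mu
    (fun c x => cos (c * x + a) * p x) setT measurableT c (c - 1) (c + 1).
  have hI : `]c - 1, c + 1[%classic c by rewrite /= in_itv/=; lra.
  have h1 x : `]c - 1, c + 1[%classic x ->
      mu.-integrable setT (EFin \o (fun y => cos (x * y + a) * p y)).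
    move=> _; apply: (@integrable_bdM_normal_pdf _ 1) => // y.
    exact: cos_max.
  have h2 (x y : R) : `]c - 1, c + 1[%classic x -> setT y ->
      derivable (fun x : R => cos (x * y + a) * p y) x 1.
    by move=> _ _; have [] := dfx x y.
  have h3 y : 0 <= G y by exact: normr_ge0.
  have h4 : mu.-integrable setT (EFin \o G).
    by apply: integrable_norm; exact: integrable_mulr_normal_pdf.
  have h5 (x y : R) : `]c - 1, c + 1[%classic x -> setT y ->
      `|partial1of2 (fun c x => cos (c * x + a) * p x) x y| <= G y.
    move=> _ _; rewrite pE2 normrN /G !normrM.
    by rewrite ler_wpM2r// ler_piMr// sin_max.
  apply: DeriveDef; first exact: (key hI h1 h2 G h3 h4 h5).
  rewrite -derive1E (key2 hI h1 h2 G h3 h4 h5).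
  under eq_Rintegral do rewrite pE2 -mulN1r.
  by rewrite RintegralZl//; [rewrite stein_sin mulN1r|exact: integrable_xsin].
pose psi b := phi b * expR (s ^+ 2 * b ^+ 2 / 2).
have dpsi (c : R) : is_derive c 1 psi 0.
  rewrite /psi; apply: is_derive_eq; rewrite /GRing.scale/=.
  by field.
have psi1 : psi b = cos a.
  rewrite (is_derive_0_is_cst _ 0 dpsi) /psi expr0n/= mulr0 mul0r expR0 mulr1.
  rewrite /phi; under eq_Rintegral do rewrite mul0r add0r.
  rewrite RintegralZl//; last exact: integrable_normal_pdf.
  by rewrite /Rintegral integral_normal_pdf mulr1.
have e0 : expR (s ^+ 2 * b ^+ 2 / 2) != 0 by rewrite gt_eqF// expR_gt0.
by apply: (mulIf e0); rewrite -psi1 expRN /psi mulrC mulKf// mulrC.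
Qed.

Lemma integral_sqr_normal_pdf :
  \int[mu]_x (x ^+ 2 * normal_pdf 0 s x) = s ^+ 2.
Proof.
have s2 : s != 0 by rewrite gt_eqF.
pose F x := x * p x.
pose f x := p x - (s ^+ 2)^-1 * (x ^+ 2 * p x).
have ip : mu.-integrable setT (fun x => (p x)%:E) by exact: integrable_normal_pdf.
have dF (x : R) : is_derive x 1 F (f x).
  apply: (is_derive_eq (is_deriveM (is_derive_id x 1) (is_derive_p x))).
  by rewrite /f /GRing.scale/=; field.
have [C pC] := p_cvg.
have FNx x : F (- x) = - F x by rewrite /F mulNr !pE sqrrN.
have Fb x : 0 < x -> `|F x| <= C / x.
  move=> x0; rewrite /F ger0_norm; first exact: (pC x x0).2.
  by rewrite mulr_ge0// ltW.
have int0 : (\int[mu]_x (f x)%:E = 0)%E.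
  apply: (@integral_derive_eq0 F) => //.
  - have cp : continuous p by apply: continuous_normal_pdf.
    move=> x; apply: continuousB; first exact: cp.
    apply: continuousM; first exact: cvg_cst.
    by apply: continuousM; [exact: exprn_continuous|exact: cp].
  - exact: (integrableB measurableT ip
      (integrableZl measurableT (s ^+ 2)^-1 integrable_sqr_normal_pdf)).
  - exact: cvgy_le_divr Fb.
  - apply: (@cvgy_le_divr _ C) => x x0.
    by rewrite FNx normrN; exact: Fb.
have : \int[mu]_x (f x) = 0 by rewrite /Rintegral int0.
rewrite /f RintegralB//; last first.
  exact: (integrableZl measurableT _ integrable_sqr_normal_pdf).
rewrite RintegralZl//; last exact: integrable_sqr_normal_pdf.
rewrite {1}/Rintegral integral_normal_pdf/= => /eqP.
by rewrite subr_eq0 => /eqP e; rewrite -[RHS]mulr1 e mulrA mulfV ?mul1r// expf_neq0.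
Qed.

End centered_normal.

Lemma ge0_integral_normal_prob (m s : R) (f : R -> \bar R) :
  (forall x, (0 <= f x)%E) -> measurable_fun setT f ->
  (\int[normal_prob m s]_x f x = \int[mu]_x (f x * (normal_pdf m s x)%:E))%E.
Proof.
move=> f0 mf; have dom := normal_prob_dominates m s.
rewrite -(Radon_Nikodym_SigmaFinite.change_of_variables dom)//=.
have intf := Radon_Nikodym_SigmaFinite.f_integrable dom.
apply: ae_eq_integral => //.
- by apply: emeasurable_funM => //; exact: measurable_int intf.
- apply: emeasurable_funM => //=.
  by apply/measurable_EFinP; exact: measurable_normal_pdf.
- apply: ae_eqe_mul2l => /=; apply: integral_ae_eq => //=.
  + by apply/measurable_EFinP; exact: measurable_normal_pdf.
  + by move=> E _ mE; rewrite -Radon_Nikodym_SigmaFinite.f_integral.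
Qed.

(** For y > x >= 0 one has y^2 >= x^2 + (y - x)^2, so the density at y is at most exp(-x^2 / (2
    s^2)) times the normal density centred at x, whose total mass is 1. *)
Lemma normal_prob_gt (s x : R) : 0 < s -> 0 <= x ->
  (normal_prob 0 s [set y | (x < y)%R] <= (expR (- (x ^+ 2 / (2 * s ^+ 2))))%:E)%E.
Proof.
move=> s0 x0; have sN : s != 0 by rewrite gt_eqF.
rewrite /normal_prob.
have mS : measurable [set y : R | (x < y)%R].
  by rewrite -set_itvoy; exact: measurable_itv.
set e := expR _.
apply: (@le_trans _ _ (\int[mu]_(y in [set y | (x < y)%R])
    (e%:E * (normal_pdf x s y)%:E))%E).
  apply: ge0_le_integral => //.
  - by move=> y _; rewrite lee_fin normal_pdf_ge0.
  - by apply/measurable_EFinP/measurable_funTS; exact: measurable_normal_pdf.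
  - apply: emeasurable_funM => //.
    by apply/measurable_EFinP/measurable_funTS; exact: measurable_normal_pdf.
  - move=> y /= xy; rewrite lee_fin !normal_pdfE// mulrCA.
    rewrite ler_wpM2l ?normal_peak_ge0// /normal_fun /e -expRD ler_expR subr0.
    rewrite -subr_ge0.
    have -> : - (x ^+ 2 / (2 * s ^+ 2)) + - (y - x) ^+ 2 / (s ^+ 2 *+ 2) -
        - y ^+ 2 / (s ^+ 2 *+ 2) = x * (y - x) / s ^+ 2 by field.
    by rewrite divr_ge0 ?sqr_ge0// mulr_ge0// subr_ge0 ltW.
apply: (@le_trans _ _ (\int[mu]_y (e%:E * (normal_pdf x s y)%:E))%E).
  apply: ge0_subset_integral => //.
  - apply: emeasurable_funM => //.
    by apply/measurable_EFinP; exact: measurable_normal_pdf.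
  - by move=> y _; rewrite mule_ge0// lee_fin ?expR_ge0 ?normal_pdf_ge0.
rewrite integralZl//; last exact: integrable_normal_pdf.
by rewrite integral_normal_pdf mule1.
Qed.

End gaussian_integrals.

(** Condenses the law into its variance v. The tail is stated for every positive V >= v, so that the
    point mass, v = 0, needs no separate treatment later. *)
Lemma centered_gaussian_lawP {d} {Omega : measurableType d} {R : realType}
    (P : probability Omega R) (Y : Omega -> R) :
  measurable_fun setT Y ->
  centered_gaussian_law (fun B => P [set w | B (Y w)]) ->
  exists v : R, [/\ 0 <= v,
    forall c, \int[P]_w cos (Y w + c) = expR (- (v / 2)) * cos c,
    P.-integrable setT (fun w => (Y w ^+ 2)%:E),
    \int[P]_w (Y w ^+ 2) = v &
    forall x V, 0 < x -> 0 < V -> v <= V ->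
      (P [set w | (x < Y w)%R] <= (expR (- (x ^+ 2 / (2 * V))))%:E)%E].
Proof.
move=> mY law.
pose Z : Omega -> measurableTypeR R := Y.
have mZ : measurable_fun setT Z by exact: mY.
have mcos (c : R) : measurable_fun setT (fun x : measurableTypeR R => cos (x + c)).
  apply: continuous_measurable_fun => x; apply: continuous_comp.
    by apply: continuousD => //; exact: cvg_cst.
  exact: continuous_cos.
have msqr : measurable_fun setT (fun x : measurableTypeR R => (x ^+ 2)%:E).
  by apply/measurable_EFinP; exact: exprn_measurable.
have mgt (x : R) : measurable [set y : R | (x < y)%R].
  by rewrite -set_itvoy; exact: measurable_itv.
have icos (c : R) : P.-integrable setT (EFin \o (fun w => cos (Y w + c))).
  apply: measurable_bounded_integrable => //.
  - by rewrite (le_lt_trans (probability_le1 _ _))// ltry.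
  - exact: (measurableT_comp (mcos c)).
  - exists 1; split; first exact: num_real.
    by move=> M M1 w _ /=; rewrite (le_trans (cos_max _))// ltW.
have Esqr : (\int[P]_w (Y w ^+ 2)%:E =
    \int[pushforward P Z]_x (x ^+ 2)%:E)%E.
  rewrite ge0_integral_pushforward//.
  by move=> x _; rewrite lee_fin sqr_ge0.
have isqr v : (\int[P]_w (Y w ^+ 2)%:E = v%:E)%E ->
    P.-integrable setT (fun w => (Y w ^+ 2)%:E).
  move=> e; apply/integrableP; split.
    by apply/measurable_EFinP; exact: measurable_funX.
  under eq_integral do rewrite gee0_abs ?lee_fin ?sqr_ge0//.
  by rewrite e ltry.
have Ecos c : (\int[P]_w (cos (Y w + c))%:E =
    \int[pushforward P Z]_x (cos (x + c))%:E)%E.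
  rewrite integral_pushforward//; last exact: icos.
  exact/measurable_EFinP.
case: law => [[s s0 law]|law].
- have Esq : (\int[P]_w (Y w ^+ 2)%:E = (s ^+ 2)%:E)%E.
    transitivity (\int[normal_prob 0 s]_x (x ^+ 2)%:E)%E.
      by rewrite Esqr; apply: eq_measure_integral => A mA _; exact: law.
    rewrite ge0_integral_normal_prob//; last first.
      by move=> x; rewrite lee_fin sqr_ge0.
    rewrite -(integral_sqr_normal_pdf s0) /Rintegral fineK//.
    exact: integrable_fin_num (integrable_sqr_normal_pdf s0).
  exists (s ^+ 2); split => //.
  + exact: sqr_ge0.
  + move=> c; rewrite /Rintegral Ecos.
    transitivity (fine (\int[normal_prob 0 s]_x (cos (x + c))%:E)%E).
      by congr fine; apply: eq_measure_integral => A mA _; exact: law.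
    rewrite integral_normal_prob; last first.
      apply: measurable_bounded_integrable => //.
      - by rewrite (le_lt_trans (probability_le1 _ _))// ltry.
      - exists 1; split; first exact: num_real.
        by move=> M M1 w _ /=; rewrite (le_trans (cos_max _))// ltW.
    have := integral_cos_normal_pdf s0 c 1.
    rewrite /Rintegral expr1n mulr1 => <-.
    by congr fine; apply: eq_integral => x _; rewrite mul1r.
  + exact: isqr Esq.
  + by rewrite /Rintegral Esq.
  + move=> x V x0 V0 vV; rewrite (law [set y | (x < y)%R])//.
    apply: (le_trans (normal_prob_gt s0 (ltW x0))).
    rewrite lee_fin ler_expR lerN2 ler_pdivrMr ?mulr_gt0// mulrAC.
    rewrite ler_pdivlMr ?mulr_gt0 ?exprn_gt0//.
    by rewrite ler_wpM2l ?sqr_ge0// ler_wpM2l.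
- have dint (f : R -> R) : measurable_fun setT (f : measurableTypeR R -> R) ->
      (\int[pushforward P Z]_x (f x)%:E = (f 0)%:E)%E.
    move=> mf; transitivity (\int[@dirac _ (measurableTypeR R) (0 : R)%R R]_x (f x)%:E)%E.
      by apply: eq_measure_integral => A mA _; exact: law.
    by rewrite integral_dirac//; [rewrite diracT mul1e|exact/measurable_EFinP].
  have Esq : (\int[P]_w (Y w ^+ 2)%:E = 0%:E)%E.
    by rewrite Esqr dint ?expr0n//; exact: exprn_measurable.
  exists 0; split => //.
  + by move=> c; rewrite /Rintegral Ecos dint// add0r mul0r oppr0 expR0 mul1r.
  + exact: isqr Esq.
  + by rewrite /Rintegral Esq.
  + move=> x V x0 V0 _; rewrite (law [set y | (x < y)%R])//.
    rewrite diracE memNset/=; last by apply/negP; rewrite -leNgt ltW.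
    by rewrite lee_fin expR_ge0.
Qed.

(** * Bounded measurable functions, finite sums and Fubini *)

Section bounded_measurable.
Context {d} {T : measurableType d} {R : realType}.

(** All integrands of the conditioning argument are of this kind: the class is stable under sums and
    products and integrable for finite measures, so exchanging integrals costs nothing. *)
Definition bdm (f : T -> R) :=
  measurable_fun setT f /\ exists M, forall x, `|f x| <= M.

Lemma bdm_cst (c : R) : bdm (cst c).
Proof. by split => //; exists `|c|. Qed.

Lemma bdmD f g : bdm f -> bdm g -> bdm (fun x => f x + g x).
Proof.
move=> [mf [M fM]] [mg [K gK]]; split; first exact: measurable_funD.
by exists (M + K) => x; rewrite (le_trans (ler_normD _ _))// lerD.
Qed.

Lemma bdmM f g : bdm f -> bdm g -> bdm (fun x => f x * g x).
Proof.
move=> [mf [M fM]] [mg [K gK]]; split; first exact: measurable_funM.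
by exists (M * K) => x; rewrite normrM ler_pM.
Qed.

Lemma bdm_cos (f : T -> R) : measurable_fun setT f -> bdm (fun x => cos (f x)).
Proof.
move=> mf; split; last by exists 1 => x; exact: cos_max.
apply: (measurableT_comp (continuous_measurable_fun _) mf).
exact: continuous_cos.
Qed.

Lemma bdm_sin (f : T -> R) : measurable_fun setT f -> bdm (fun x => sin (f x)).
Proof.
move=> mf; split; last by exists 1 => x; exact: sin_max.
apply: (measurableT_comp (continuous_measurable_fun _) mf).
exact: continuous_sin.
Qed.

Lemma bdm_expRN (f : T -> R) : measurable_fun setT f -> (forall x, 0 <= f x) ->
  bdm (fun x => expR (- f x)).
Proof.
move=> mf f0; split.
  by apply: measurableT_comp => //; exact: measurable_funN.
by exists 1 => x; rewrite ger0_norm ?expR_ge0// expR_le1 oppr_le0.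
Qed.

Lemma bdm_sum (I : Type) (s : seq I) (F : I -> T -> R) :
  (forall i, bdm (F i)) -> bdm (fun x => \sum_(i <- s) F i x).
Proof.
move=> bF; elim: s => [|i s ih].
  by under eq_fun do rewrite big_nil; exact: bdm_cst.
by under eq_fun do rewrite big_cons; exact: bdmD.
Qed.

Lemma bdm_integrable (m : {measure set T -> \bar R}) (D : set T) (f : T -> R) :
  measurable D -> (m D < +oo)%E -> bdm f -> m.-integrable D (EFin \o f).
Proof.
move=> mD fD [mf [M fM]]; apply: measurable_bounded_integrable => //.
  exact: measurable_funTS.
exists M; split; first exact: num_real.
by move=> K MK x _ /=; rewrite (le_trans (fM x))// ltW.
Qed.

Lemma bdm_integrableT (P : probability T R) (f : T -> R) :
  bdm f -> P.-integrable setT (EFin \o f).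
Proof.
move=> bf; apply: bdm_integrable => //.
by rewrite (le_lt_trans (probability_le1 _ _))// ltry.
Qed.

End bounded_measurable.

Lemma Rintegral_sum {d} {U : measurableType d} {R : realType} (I : Type)
    (m : {measure set U -> \bar R}) (s : seq I) (F : I -> U -> R) :
  (forall i, m.-integrable setT (EFin \o F i)) ->
  m.-integrable setT (EFin \o (fun x => \sum_(i <- s) F i x)) /\
  \int[m]_x (\sum_(i <- s) F i x) = \sum_(i <- s) \int[m]_x F i x.
Proof.
move=> iF; elim: s => [|i s [ih1 ih2]].
  rewrite big_nil; split.
    rewrite (_ : _ \o _ = cst 0%E); first exact: integrable0.
    by apply/funext => x; rewrite /= big_nil.
  rewrite /Rintegral; under eq_integral do rewrite big_nil.
  by rewrite integral0.
have e : (EFin \o (fun x => \sum_(j <- i :: s) F j x)) =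
    (fun x => ((F i x)%:E + (\sum_(j <- s) F j x)%:E)%E).
  by apply/funext => x; rewrite /= big_cons EFinD.
split; first by rewrite e; exact: (integrableD measurableT (iF i) ih1).
under eq_Rintegral do rewrite big_cons.
by rewrite RintegralD// big_cons ih2.
Qed.

Lemma Rintegral_prob_cst {d} {T : measurableType d} {R : realType}
    (P : probability T R) (c : R) : \int[P]_x c = c.
Proof.
rewrite Rintegral_cst// [X in fine X](_ : _ = 1%E) ?mulr1//.
exact: probability_setT.
Qed.

Lemma norm_Rintegral_le {d} {T : measurableType d} {R : realType}
    (P : probability T R) (f : T -> R) (M : R) :
  bdm f -> (forall x, `|f x| <= M) -> `|\int[P]_x f x| <= M.
Proof.
move=> bf fM; have intf := bdm_integrableT P bf.
apply: (le_trans (le_normr_Rintegral measurableT intf)).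
apply: (@le_trans _ _ (\int[P]_x M)); last first.
  by rewrite Rintegral_prob_cst.
apply: le_Rintegral => //; first exact: integrable_norm.
exact: bdm_integrableT (bdm_cst M).
Qed.

Lemma Rintegral_Fubini {d d'} {T : measurableType d} {U : measurableType d'}
    {R : realType} (P : probability T R) (N : probability U R)
    (F : T * U -> R) : bdm F ->
  bdm (fun u => \int[P]_t F (t, u)) /\
  \int[P]_t \int[N]_u F (t, u) = \int[N]_u \int[P]_t F (t, u).
Proof.
move=> bF; have [mF [M FM]] := bF.
have intF : (P \x N)%E.-integrable setT (EFin \o F).
  apply: bdm_integrable => //.
  suff : ((P \x N)%E setT < +oo)%E by [].
  rewrite -setXTT product_measure1E//.
  rewrite [X in (X * _)%E](_ : _ = 1%E); last exact: probability_setT.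
  by rewrite mul1e (le_lt_trans (probability_le1 _ _))// ltry.
have b1 t : bdm (fun u => F (t, u)).
  by split; [exact: measurableT_comp|exists M].
have b2 u : bdm (fun t => F (t, u)).
  by split; [exact: measurableT_comp|exists M].
have f1 t : (\int[N]_u (F (t, u))%:E = (\int[N]_u F (t, u))%:E)%E.
  by rewrite /Rintegral fineK//; apply: integrable_fin_num => //;
    exact: bdm_integrableT.
have f2 u : (\int[P]_t (F (t, u))%:E = (\int[P]_t F (t, u))%:E)%E.
  by rewrite /Rintegral fineK//; apply: integrable_fin_num => //;
    exact: bdm_integrableT.
split.
  split; last by exists M => u; exact: norm_Rintegral_le.
  apply/measurable_EFinP; have := measurable_fubini_G intF.
  by apply: eq_measurable_fun => u _; rewrite /= -f2.
have := Fubini intF.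
under eq_integral do rewrite /= f1.
under [X in _ = X -> _]eq_integral do rewrite /= f2.
by move=> e; rewrite /Rintegral e.
Qed.

(** * Products of bumps of Gaussian vectors *)

Section bump.
Context {R : realType}.
Implicit Types x e y : R.

Definition bump x e y : R := expR (- ((y - x) ^+ 2 / (2 * e ^+ 2))).

Lemma bump_ge0 x e y : 0 <= bump x e y. Proof. exact: expR_ge0. Qed.

Lemma bump_le1 x e y : bump x e y <= 1.
Proof. by rewrite expR_le1 oppr_le0 divr_ge0 ?sqr_ge0// mulr_ge0// sqr_ge0. Qed.

Lemma bdm_bump {d} {T : measurableType d} x e (f : T -> R) :
  measurable_fun setT f -> bdm (fun t => bump x e (f t)).
Proof.
move=> mf; apply: bdm_expRN; last first.
  by move=> t; rewrite divr_ge0 ?sqr_ge0// mulr_ge0// sqr_ge0.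
apply: measurable_funM => //; apply: measurable_funX.
exact: measurable_funB.
Qed.

(* The list [cs] of triples (a_i, x_i, e_i) encodes
   y |-> a0 + sum_i a_i bump x_i e_i y. *)
Fixpoint bumps (a0 : R) (cs : seq (R * R * R)) (y : R) : R :=
  match cs with
  | [::] => a0
  | (a, x, e) :: cs' => a * bump x e y + bumps a0 cs' y
  end.

(* Expectation of [bumps a0 cs (y + xi)] for xi centered Gaussian of
   variance w. *)
Fixpoint bumps_avg (a0 : R) (cs : seq (R * R * R)) (w y : R) : R :=
  match cs with
  | [::] => a0
  | (a, x, e) :: cs' =>
      a * (e / Num.sqrt (e ^+ 2 + w) * bump x (Num.sqrt (e ^+ 2 + w)) y)
      + bumps_avg a0 cs' w y
  end.

Lemma bdm_bumps {d} {T : measurableType d} a0 cs (f : T -> R) :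
  measurable_fun setT f -> bdm (fun t => bumps a0 cs (f t)).
Proof.
move=> mf; elim: cs => [|[[a x] e] cs ih] /=; first exact: bdm_cst.
by apply: bdmD => //; apply: bdmM; [exact: bdm_cst|exact: bdm_bump].
Qed.

Lemma bdm_bumps_avg {d} {T : measurableType d} a0 cs w (f : T -> R) :
  measurable_fun setT f -> bdm (fun t => bumps_avg a0 cs w (f t)).
Proof.
move=> mf; elim: cs => [|[[a x] e] cs ih] /=; first exact: bdm_cst.
apply: bdmD => //; do 2 (apply: bdmM; first exact: bdm_cst).
exact: bdm_bump.
Qed.

Local Notation N := (normal_prob (0 : R) 1).

Lemma integral_N_bdm (f : R -> R) : bdm (f : measurableTypeR R -> R) ->
  \int[N]_u f u = \int[lebesgue_measure]_u (f u * normal_pdf 0 1 u).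
Proof.
move=> bf; rewrite /Rintegral integral_normal_prob//; exact: bdm_integrableT.
Qed.

(** The weight exp(-u^2 t / 2) turns the standard density into s times the density of standard
    deviation s = (1 + t)^(-1/2), whose characteristic function is known. The value t = 0 represents
    a bump, t > 0 its average over noise. *)
Lemma integral_expR_cos (t b c : R) : 0 <= t ->
  \int[N]_u (expR (- (u ^+ 2 * t / 2)) * cos (c + u * b)) =
  (Num.sqrt (1 + t))^-1 * expR (- (b ^+ 2 / (2 * (1 + t)))) * cos c.
Proof.
move=> t0; have t1 : 0 < 1 + t by lra.
set s := (Num.sqrt (1 + t))^-1.
have s0 : 0 < s by rewrite invr_gt0 sqrtr_gt0.
have sE : s ^+ 2 = (1 + t)^-1 by rewrite /s exprVn sqr_sqrtr// ltW.
have mid : measurable_fun setT (fun u : measurableTypeR R => u : R) by exact: measurable_id.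
have bcos : bdm (fun u : measurableTypeR R => cos (c + u * b)).
  apply: bdm_cos; apply: measurable_funD => //; exact: measurable_funM.
rewrite integral_N_bdm; last first.
  apply: bdmM => //; apply: bdm_expRN; last first.
    by move=> u; rewrite divr_ge0// mulr_ge0// sqr_ge0.
  by do 2 apply: measurable_funM => //; exact: measurable_funX.
transitivity (\int[lebesgue_measure]_u (s * (cos (b * u + c) * normal_pdf 0 s u))).
  apply: eq_Rintegral => u _.
  have pk : normal_peak (1 : R) = s * normal_peak s.
    have pkE (r : R) : 0 < r -> normal_peak r = r^-1 / Num.sqrt (pi *+ 2).
      move=> r0; rewrite /normal_peak -mulrnAr sqrtrM ?sqr_ge0// sqrtr_sqr.
      by rewrite gtr0_norm// invfM mulrC.
    by rewrite !pkE// invr1 mulrA divff ?gt_eqF.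
  rewrite !normal_pdfE ?gt_eqF// /normal_fun pk addrC (mulrC b).
  rewrite !subr0 sE.
  have -> : - u ^+ 2 / ((1 + t)^-1 *+ 2) = - (u ^+ 2 * t / 2) + - u ^+ 2 / (1 ^+ 2 *+ 2).
    by field; rewrite gt_eqF.
  by rewrite expRD; ring.
rewrite RintegralZl//; last first.
  apply: (@integrable_bdM_normal_pdf R s (fun u => cos (b * u + c)) 1).
    by apply: (bdm_cos _).1; apply: measurable_funD => //; exact: measurable_funM.
  by move=> u; exact: cos_max.
rewrite integral_cos_normal_pdf// sE mulrA; congr (_ * expR _ * _).
by field; rewrite gt_eqF.
Qed.

(** A Gaussian is its own Fourier transform. Keeping the factor cos c lets bumps be peeled off one
    after another, each only changing the argument of the cosine. *)
Lemma bump_fourier x e y c : e != 0 ->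
  bump x e y * cos c = \int[N]_u cos (c + u * ((y - x) / e)).
Proof.
move=> e0; have := integral_expR_cos ((y - x) / e) c (lexx 0).
under eq_Rintegral do rewrite mulr0 mul0r oppr0 expR0 mul1r.
move=> ->; rewrite addr0 sqrtr1 invr1 mul1r; congr (expR _ * _).
by field.
Qed.

(** Noise of variance w damps the frequency u / e by exp(-(u/e)^2 w / 2), which is the previous
    integral with t = w / e^2. *)
Lemma bump_avg_fourier x e w y : 0 < e -> 0 <= w ->
  e / Num.sqrt (e ^+ 2 + w) * bump x (Num.sqrt (e ^+ 2 + w)) y =
  \int[N]_u (expR (- ((u / e) ^+ 2 * w / 2)) * cos (u * ((y - x) / e))).
Proof.
move=> e0 w0; have eN : e != 0 by rewrite gt_eqF.
have t0 : 0 <= w / e ^+ 2 by rewrite divr_ge0// sqr_ge0.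
have ew : 0 < e ^+ 2 + w by rewrite ltr_pwDl// exprn_gt0.
have := integral_expR_cos ((y - x) / e) 0 t0.
rewrite cos0 mulr1 => h.
transitivity ((Num.sqrt (1 + w / e ^+ 2))^-1 *
  expR (- (((y - x) / e) ^+ 2 / (2 * (1 + w / e ^+ 2))))).
  have -> : 1 + w / e ^+ 2 = (e ^+ 2 + w) / e ^+ 2 by field.
  rewrite sqrtrM ?ltW// sqrtrV ?sqr_ge0// sqrtr_sqr (gtr0_norm e0).
  rewrite /bump sqr_sqrtr ?(ltW ew)//; congr (_ * expR _).
    by rewrite invfM invrK mulrC.
  by field; rewrite eN gt_eqF.
rewrite -h; apply: eq_Rintegral => u _; rewrite add0r; congr (expR _ * _).
by field.
Qed.

End bump.

(** * Successive conditioning in an abstract Gaussian space *)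

Section gaussian_space.
Context {d} {Omega : measurableType d} {R : realType} (P : probability Omega R).
Context (V : lmodType R) (W : V -> Omega -> R) (q : V -> V -> R).
Hypothesis mW : forall a, measurable_fun setT (W a).
Hypothesis WD : forall a b w, W (a + b) w = W a w + W b w.
Hypothesis WZ : forall c a w, W (c *: a) w = c * W a w.
Hypothesis qC : forall a b, q a b = q b a.
Hypothesis qD : forall a b c, q (a + b) c = q a c + q b c.
Hypothesis qZ : forall k a c, q (k *: a) c = k * q a c.
Hypothesis Wcos : forall a c,
  \int[P]_w cos (W a w + c) = expR (- (q a a / 2)) * cos c.

Local Notation N := (normal_prob (0 : R) 1).

(** Spans are given by coefficients along a list, since [q] may be degenerate and the vectors
    dependent; no basis is available and every induction follows the list. *)
Fixpoint inspan (l : seq V) (v : V) : Prop :=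
  match l with
  | [::] => v = 0
  | y :: l' => exists c : R, inspan l' (v - c *: y)
  end.

Fixpoint orth (l : seq V) (v : V) : Prop :=
  match l with
  | [::] => True
  | y :: l' => q v y = 0 /\ orth l' v
  end.

Lemma orthD l u v : orth l u -> orth l v -> orth l (u + v).
Proof.
elim: l => //= y l ih [uy ul] [vy vl]; split; last exact: ih.
by rewrite qD uy vy addr0.
Qed.

Lemma orthZ l k v : orth l v -> orth l (k *: v).
Proof.
by elim: l => //= y l ih [vy vl]; split; [rewrite qZ vy mulr0|exact: ih].
Qed.

Let qDr a b c : q a (b + c) = q a b + q a c.
Proof. by rewrite qC qD !(qC a). Qed.

Let qZr k a c : q a (k *: c) = k * q a c.
Proof. by rewrite qC qZ (qC a). Qed.

Lemma orth_inspan l u v : orth l v -> inspan l u -> q v u = 0.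
Proof.
elim: l u => /= [u _ ->|y l ih u [vy vl] [c /ih]].
  by rewrite -(scale0r (0 : V)) qZr mul0r.
move=> /(_ vl); rewrite -scaleNr qDr qZr vy mulr0 addr0.
by [].
Qed.

Lemma inspanD l u v : inspan l u -> inspan l v -> inspan l (u + v).
Proof.
elim: l u v => /= [u v -> ->|y l ih u v [a ua] [b vb]]; first by rewrite addr0.
exists (a + b); rewrite scalerDl opprD addrACA; exact: ih.
Qed.

Lemma inspanZ l k v : inspan l v -> inspan l (k *: v).
Proof.
elim: l v => /= [v ->|y l ih v [a va]]; first by rewrite scaler0.
by exists (k * a); rewrite -scalerA -scalerBr; exact: ih.
Qed.

(* [l] lists vectors with the most recent one first; each has conditional
   variance in [lo, hi] given the ones that come after it in the list. *)
Fixpoint nondegenerate (lo hi : R) (l : seq V) : Prop :=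
  match l with
  | [::] => True
  | y :: l' => nondegenerate lo hi l' /\
      exists mu, [/\ inspan l' mu, orth l' (y - mu) &
                     lo <= q (y - mu) (y - mu) <= hi]
  end.

Variables (a0 : R) (cs : seq (R * R * R)).
Hypothesis cs_gt0 : forall t, t \in cs -> 0 < t.2.

Let Q l w := \prod_(y <- l) bumps a0 cs (W y w).

Let bdmQ l : bdm (Q l).
Proof.
rewrite /Q; elim: l => [|y l ih].
  by under eq_fun do rewrite big_nil; exact: bdm_cst.
by under eq_fun do rewrite big_cons; apply: bdmM => //; exact: bdm_bumps.
Qed.

Let bdm_Qcos l A c : bdm (fun w => Q l w * cos (W A w + c)).
Proof.
by apply: bdmM => //; apply: bdm_cos; exact: measurable_funD.
Qed.

(** Common form of the two Fourier expansions in use: weight [k = 1] for a bump at y, exponential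
    [k] for its average. The frequency u / e is absorbed by linearity into the vector A + (u / e) y.
    The first component supplies integrability in u. *)
Let fourier_swap (k : R -> R) l (y A : V) (c e x : R) :
  bdm (k : measurableTypeR R -> R) ->
  bdm (fun u : measurableTypeR R =>
    k u * \int[P]_w (Q l w * cos (W (A + (u / e) *: y) w + (c - u / e * x)))) /\
  \int[P]_w (Q l w * \int[N]_u (k u * cos (W A w + c + u * ((W y w - x) / e)))) =
  \int[N]_u (k u *
    \int[P]_w (Q l w * cos (W (A + (u / e) *: y) w + (c - u / e * x)))).
Proof.
move=> bk.
pose G (t : Omega * measurableTypeR R) :=
  k t.2 * (Q l t.1 * cos (W (A + (t.2 / e) *: y) t.1 + (c - t.2 / e * x))).
have GE w u : k u * (Q l w * cos (W (A + (u / e) *: y) w + (c - u / e * x))) =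
    Q l w * (k u * cos (W A w + c + u * ((W y w - x) / e))).
  rewrite WD WZ mulrCA; congr (_ * (_ * cos _)).
  by rewrite mulrBl mulrBr !mulrA; lra.
have mid : measurable_fun setT (fun u : measurableTypeR R => u : R).
  exact: measurable_id.
have bG : bdm G.
  have -> : G = fun t => Q l t.1 *
      (k t.2 * cos (W A t.1 + c + t.2 * ((W y t.1 - x) / e))).
    by apply/funext => t; exact: GE.
  apply: bdmM.
    have [m [M QM]] := bdmQ l; split; last by exists M => t; exact: QM.
    exact: measurableT_comp.
  apply: bdmM.
    have [m [M QM]] := bk; split; last by exists M => t; exact: QM.
    exact: (measurableT_comp m).
  apply: bdm_cos; apply: measurable_funD.
    by apply: measurable_funD => //; exact: (measurableT_comp (mW A)).
  apply: measurable_funM; first exact: measurable_snd.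
  apply: measurable_funM => //; apply: measurable_funB => //.
  exact: (measurableT_comp (mW y)).
have [bI e1] := Rintegral_Fubini P (N : probability (measurableTypeR R) R) bG.
have IE u : \int[P]_w G (w, u) = k u *
    \int[P]_w (Q l w * cos (W (A + (u / e) *: y) w + (c - u / e * x))).
  by rewrite /G/= RintegralZl//; exact: bdm_integrableT.
split.
  by move: bI; congr bdm; apply/funext => u; exact: IE.
transitivity (\int[P]_w \int[N]_u G (w, u)).
  apply: eq_Rintegral => w _; rewrite -RintegralZl//; last first.
    apply: bdm_integrableT; apply: bdmM => //; apply: bdm_cos.
    by apply: measurable_funD => //; exact: measurable_funM.
  by apply: eq_Rintegral => u _; rewrite /G/= GE.
by rewrite e1; apply: eq_Rintegral => u _; exact: IE.
Qed.

(* The law of total variance in Fourier form: adding [xi] orthogonal to [l]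
   multiplies the characteristic function by that of [xi]. *)
Let char_orth lo hi l : nondegenerate lo hi l ->
  forall A xi c, inspan l A -> orth l xi ->
  \int[P]_w (Q l w * cos (W (A + xi) w + c)) =
  expR (- (q xi xi / 2)) * \int[P]_w (Q l w * cos (W A w + c)).
Proof.
elim: l => [_ A xi c /= -> _|y l ih /= [gl [mu [spmu omu _]]]].
  rewrite add0r /Q; under eq_Rintegral do rewrite big_nil mul1r.
  rewrite Wcos; congr (_ * _).
  under eq_Rintegral do rewrite big_nil mul1r -(scale0r (0 : V)) WZ mul0r add0r.
  by rewrite Rintegral_prob_cst.
pose zeta := y - mu.
have yE : y = mu + zeta by rewrite /zeta addrC subrK.
(* A vector of the span of [y :: l] is B + k zeta with B in the span of [l]. Both k zeta and xi are
   orthogonal to [l] and to each other, so the hypothesis for [l] applies to xi + k zeta and to k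
   zeta, and the variances add. *)
have step A xi c : (exists c, inspan l (A - c *: y)) -> q xi y = 0 -> orth l xi ->
    \int[P]_w (Q l w * cos (W (A + xi) w + c)) =
    expR (- (q xi xi / 2)) * \int[P]_w (Q l w * cos (W A w + c)).
  move=> [k sA] xiy oxi.
  pose B := A - k *: y + k *: mu.
  have sB : inspan l B by apply: inspanD => //; exact: inspanZ.
  have AE : A = B + k *: zeta.
    by rewrite /B -addrA -scalerDr /zeta [mu + _]addrC !subrK.
  have xz : q zeta xi = 0.
    by rewrite qC; have := xiy; rewrite yE qDr (orth_inspan oxi spmu) add0r.
  have ok : orth l (k *: zeta) by exact: orthZ.
  rewrite AE -addrA (ih gl B (k *: zeta + xi))//; last exact: orthD.
  rewrite (ih gl B (k *: zeta))// mulrA -expRD; congr (expR _ * _).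
  rewrite qD !qDr !qZ !qZr (qC xi) xz.
  by rewrite !mulr0 addr0 add0r; lra.
move=> A xi c sA [xiy oxi].
have QE w : Q (y :: l) w = Q l w * bumps a0 cs (W y w).
  by rewrite /Q big_cons mulrC.
under eq_Rintegral do rewrite QE.
under [in RHS]eq_Rintegral do rewrite QE.
(* Only the factor at y is expanded: each of its bumps becomes a mixture of cosines that moves A to
   A + (u / e) y, still in the span, where [step] applies. *)
elim: cs cs_gt0 => [_|[[a x] e] cs' ihc csgt] /=.
  have E B : \int[P]_w (Q l w * a0 * cos (W B w + c)) =
      a0 * \int[P]_w (Q l w * cos (W B w + c)).
    rewrite -RintegralZl//; last exact: bdm_integrableT.
    by apply: eq_Rintegral => w _; ring.
  by rewrite !E step// mulrCA.
have e0 : e != 0 by rewrite gt_eqF// (csgt (a, x, e))// mem_head.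
have bcos B : bdm (fun w => cos (W B w + c)).
  by apply: bdm_cos; exact: measurable_funD.
have b1 B : bdm (fun w => Q l w * (bump x e (W y w) * cos (W B w + c))).
  by apply: bdmM => //; apply: bdmM => //; exact: bdm_bump.
have b2 B : bdm (fun w => Q l w * bumps a0 cs' (W y w) * cos (W B w + c)).
  by apply: bdmM => //; apply: bdmM => //; exact: bdm_bumps.
have E B : \int[P]_w (Q l w * (a * bump x e (W y w) + bumps a0 cs' (W y w)) *
      cos (W B w + c)) =
    a * \int[P]_w (Q l w * (bump x e (W y w) * cos (W B w + c))) +
    \int[P]_w (Q l w * bumps a0 cs' (W y w) * cos (W B w + c)).
  rewrite -RintegralZl//; last exact: bdm_integrableT.
  rewrite -RintegralD//; last 2 first.
  - by apply: bdm_integrableT; apply: bdmM => //; exact: bdm_cst.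
  - exact: bdm_integrableT.
  by apply: eq_Rintegral => w _; ring.
have F B : \int[P]_w (Q l w * (bump x e (W y w) * cos (W B w + c))) =
    \int[N]_u (1 * \int[P]_w (Q l w *
      cos (W (B + (u / e) *: y) w + (c - u / e * x)))).
  rewrite -(fourier_swap l y B c e x (bdm_cst 1)).2.
  apply: eq_Rintegral => w _; congr (_ * _); rewrite bump_fourier//.
  by apply: eq_Rintegral => u _; rewrite mul1r.
rewrite !E mulrDr ihc; last first.
  by move=> t tcs; apply: csgt; rewrite inE tcs orbT.
congr (_ + _); rewrite mulrCA; congr (_ * _).
rewrite !F -RintegralZl//; last first.
  apply: bdm_integrableT; exact: (fourier_swap l y A c e x (bdm_cst 1)).1.
apply: eq_Rintegral => u _; rewrite !mul1r addrAC step//.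
by have [k sk] := sA; exists (k + u / e); rewrite scalerDl opprD addrACA subrr addr0.
Qed.

(** Under the law, y is its projection mu plus independent noise y - mu; integrating the noise out
    replaces the factor at y by its average evaluated at mu. Both sides are compared frequency by
    frequency. *)
Let integral_step lo hi y l mu :
  nondegenerate lo hi l -> inspan l mu -> orth l (y - mu) ->
  0 <= q (y - mu) (y - mu) ->
  \int[P]_w Q (y :: l) w =
  \int[P]_w (Q l w * bumps_avg a0 cs (q (y - mu) (y - mu)) (W mu w)).
Proof.
move=> gl smu omu q0; set w2 := q _ _.
have QE w : Q (y :: l) w = Q l w * bumps a0 cs (W y w).
  by rewrite /Q big_cons mulrC.
under eq_Rintegral do rewrite QE.
elim: cs cs_gt0 => [_|[[a x] e] cs' ihc csgt] //=.
have e0 : 0 < e by rewrite (csgt (a, x, e))// mem_head.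
have b1 : bdm (fun w => Q l w * bump x e (W y w)).
  by apply: bdmM => //; exact: bdm_bump.
have b2 : bdm (fun w => Q l w * bumps a0 cs' (W y w)).
  by apply: bdmM => //; exact: bdm_bumps.
have b3 : bdm (fun w => Q l w * (e / Num.sqrt (e ^+ 2 + w2) *
    bump x (Num.sqrt (e ^+ 2 + w2)) (W mu w))).
  apply: bdmM => //; apply: bdmM; first exact: bdm_cst.
  exact: bdm_bump.
have b4 : bdm (fun w => Q l w * bumps_avg a0 cs' w2 (W mu w)).
  by apply: bdmM => //; exact: bdm_bumps_avg.
have EL : \int[P]_w (Q l w * (a * bump x e (W y w) + bumps a0 cs' (W y w))) =
    a * \int[P]_w (Q l w * bump x e (W y w)) +
    \int[P]_w (Q l w * bumps a0 cs' (W y w)).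
  rewrite -RintegralZl//; last exact: bdm_integrableT.
  rewrite -RintegralD//; last 2 first.
  - by apply: bdm_integrableT; apply: bdmM => //; exact: bdm_cst.
  - exact: bdm_integrableT.
  by apply: eq_Rintegral => w _; ring.
have ER : \int[P]_w (Q l w * (a * (e / Num.sqrt (e ^+ 2 + w2) *
      bump x (Num.sqrt (e ^+ 2 + w2)) (W mu w)) +
      bumps_avg a0 cs' w2 (W mu w))) =
    a * \int[P]_w (Q l w * (e / Num.sqrt (e ^+ 2 + w2) *
      bump x (Num.sqrt (e ^+ 2 + w2)) (W mu w))) +
    \int[P]_w (Q l w * bumps_avg a0 cs' w2 (W mu w)).
  rewrite -RintegralZl//; last exact: bdm_integrableT.
  rewrite -RintegralD//; last 2 first.
  - by apply: bdm_integrableT; apply: bdmM => //; exact: bdm_cst.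
  - exact: bdm_integrableT.
  by apply: eq_Rintegral => w _; ring.
rewrite EL ER ihc; last first.
  by move=> t tcs; apply: csgt; rewrite inE tcs orbT.
congr (_ * _ + _).
have W0 w : W 0 w = 0 by rewrite -(scale0r (0 : V)) WZ mul0r.
transitivity (\int[N]_u (1 * \int[P]_w (Q l w *
    cos (W (0 + (u / e) *: y) w + (0 - u / e * x))))).
  rewrite -(fourier_swap l y 0 0 e x (bdm_cst 1)).2.
  apply: eq_Rintegral => w _; congr (_ * _).
  transitivity (bump x e (W y w) * cos 0); first by rewrite cos0 mulr1.
  rewrite bump_fourier ?gt_eqF//.
  by apply: eq_Rintegral => u _; rewrite W0 addr0 mul1r.
(* The characteristic function of the noise y - mu at frequency u / e; [char_orth] produces exactly
   this factor. *)
pose k (u : R) := expR (- ((u / e) ^+ 2 * w2 / 2)).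
have bk : bdm (k : measurableTypeR R -> R).
  apply: bdm_expRN; last by move=> u; rewrite divr_ge0// mulr_ge0// sqr_ge0.
  apply: measurable_funM => //; apply: measurable_funM => //.
  by apply: measurable_funX; exact: measurable_funM.
transitivity (\int[N]_u (k u * \int[P]_w (Q l w *
    cos (W (0 + (u / e) *: mu) w + (0 - u / e * x))))); last first.
  rewrite -(fourier_swap l mu 0 0 e x bk).2.
  apply: eq_Rintegral => w _; congr (_ * _).
  rewrite bump_avg_fourier//.
  by apply: eq_Rintegral => u _; rewrite W0 addr0 add0r.
apply: eq_Rintegral => u _; rewrite mul1r !add0r.
have -> : (u / e) *: y = (u / e) *: mu + (u / e) *: (y - mu).
  by rewrite -scalerDr addrC subrK.
rewrite (char_orth gl); [|exact: inspanZ|exact: orthZ].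
by congr (expR (- (_ / 2)) * _); rewrite qZ qZr mulrA -expr2.
Qed.

Lemma expectation_prod_bumps_le (lo hi s : R) (l : seq V) : 0 <= lo -> 0 <= s ->
  nondegenerate lo hi l -> (forall y, 0 <= bumps a0 cs y) ->
  (forall w y, lo <= w <= hi -> bumps_avg a0 cs w y <= s) ->
  \int[P]_w (\prod_(y <- l) bumps a0 cs (W y w)) <= s ^+ size l.
Proof.
move=> lo0 s0 + g0 gs.
have Q0 l' w : 0 <= Q l' w by apply: prodr_ge0 => y _.
elim: l => [_|y l ih [gl [mu [smu omu /andP[lq qh]]]]].
  by under eq_Rintegral do rewrite big_nil; rewrite Rintegral_prob_cst.
under eq_Rintegral do rewrite -/(Q (y :: l) _).
rewrite (integral_step gl smu omu (le_trans lo0 lq)).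
apply: (@le_trans _ _ (s * \int[P]_w Q l w)); last first.
  by rewrite /= exprS ler_wpM2l// ih.
rewrite -RintegralZl//; last exact: bdm_integrableT.
apply: le_Rintegral => //.
- apply: bdm_integrableT; apply: bdmM => //; exact: bdm_bumps_avg.
- by apply: bdm_integrableT; apply: bdmM => //; exact: bdm_cst.
- by move=> w _; rewrite mulrC ler_wpM2r// gs// lq.
Qed.

End gaussian_space.

(** * Greedy choice of nearly independent times *)

Section projection.
Context {R : realType} (V : lmodType R) (q : V -> V -> R).
Hypothesis qC : forall a b, q a b = q b a.
Hypothesis qD : forall a b c, q (a + b) c = q a c + q b c.
Hypothesis qZ : forall k a c, q (k *: a) c = k * q a c.
Hypothesis q_ge0 : forall a, 0 <= q a a.

Let qDr a b c : q a (b + c) = q a b + q a c.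
Proof. by rewrite qC qD !(qC a). Qed.

Let qZr k a c : q a (k *: c) = k * q a c.
Proof. by rewrite qC qZ (qC a). Qed.

Let qN a c : q (- a) c = - q a c.
Proof. by rewrite -scaleN1r qZ mulN1r. Qed.

Let qNr a c : q a (- c) = - q a c.
Proof. by rewrite qC qN qC. Qed.

Lemma form_CauchySchwarz a b : q a b ^+ 2 <= q a a * q b b.
Proof.
have h t : 0 <= q a a + 2 * t * q a b + t ^+ 2 * q b b.
  have := q_ge0 (a + t *: b); rewrite qD !qDr !qZ !qZr (qC b a).
  by congr (0 <= _); ring.
have [b0|bn] := eqVneq (q b b) 0.
  (* If q b b = 0 the quadratic in t is affine, and the t chosen next makes it equal to -1. *)
  rewrite b0 mulr0; have [->|abn] := eqVneq (q a b) 0; first by rewrite expr0n.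
  have := h (- (q a a + 1) / (2 * q a b)); rewrite b0 mulr0 addr0.
  have -> : 2 * (- (q a a + 1) / (2 * q a b)) * q a b = - (q a a + 1) by field.
  by move=> ?; exfalso; lra.
have bp : 0 < q b b by rewrite lt_neqAle eq_sym bn q_ge0.
have := h (- q a b / q b b).
have -> : q a a + 2 * (- q a b / q b b) * q a b + (- q a b / q b b) ^+ 2 * q b b =
  (q a a * q b b - q a b ^+ 2) / q b b by field.
by rewrite ler_pdivlMr// mul0r subr_ge0.
Qed.

Lemma inspan0 (l : seq V) : inspan l 0.
Proof. by elim: l => //= y l ih; exists 0; rewrite scale0r subr0. Qed.

Lemma orth_dist_min l v p u : inspan l p -> orth q l (v - p) -> inspan l u ->
  q (v - p) (v - p) <= q (v - u) (v - u).
Proof.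
move=> sp op su.
have s1 : inspan l (p - u).
  by apply: inspanD => //; rewrite -scaleN1r; exact: inspanZ.
have o1 := orth_inspan qC qD qZ op s1.
have -> : v - u = (v - p) + (p - u) by rewrite addrA subrK.
rewrite [leRHS]qD !(qDr _ (v - p)) o1 (qC (p - u)) o1.
by rewrite addr0 add0r lerDl.
Qed.

(** Gram-Schmidt with bookkeeping. A new residual direction r lowers the squared distance of e i by
    q(e i, r)^2 / q(r, r), and Bessel's inequality bounds the total loss over i by B. Hence each
    listed vector costs at most B. *)
Lemma projection_exists (l : seq V) : exists p : V -> V, [/\
  forall v, inspan l (p v), forall v, orth q l (v - p v) &
  forall (I : finType) (e : I -> V) B, 0 <= B ->
    (forall u, \sum_i q (e i) u ^+ 2 <= B * q u u) ->
    \sum_i q (e i) (e i) - (size l)%:R * B <=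
    \sum_i q (e i - p (e i)) (e i - p (e i))].
Proof.
elim: l => [|u l [p [sp op bp]]].
  exists (fun=> 0); split => // I e B _ _; rewrite mul0r subr0.
  by under [leRHS]eq_bigr do rewrite subr0.
have [r rE] : exists r, r = u - p u by exists (u - p u).
have rl : orth q l r by rewrite rE; exact: op.
have spN v : inspan l (- p v) by rewrite -scaleN1r; exact: inspanZ.
have uE : u = r + p u by rewrite rE subrK.
have rp v : q r (p v) = 0 by exact: (orth_inspan qC qD qZ rl (sp v)).
have vpp v w : q (v - p v) (p w) = 0 by exact: (orth_inspan qC qD qZ (op v) (sp w)).
(* A null residual is orthogonal to every v - p v by Cauchy-Schwarz, so the old projection still
   serves. *)
have [r0|rn] := eqVneq (q r r) 0.
  exists p; split.
  - by move=> v; exists 0; rewrite scale0r subr0.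
  - move=> v; split => //; rewrite uE qDr vpp addr0.
    have := form_CauchySchwarz (v - p v) r; rewrite r0 mulr0 => h.
    by apply/eqP; rewrite -sqrf_eq0 eq_le h sqr_ge0.
  - move=> I e B B0 eB; apply: le_trans (bp I e B B0 eB).
    by rewrite lerD2l lerN2 ler_wpM2r// ler_nat.
have rpos : 0 < q r r by rewrite lt_neqAle eq_sym rn q_ge0.
pose c v := q v r / q r r.
have vr v : q (v - p v) r = q v r by rewrite qD qN (qC (p v)) rp subr0.
exists (fun v => p v + c v *: r); split.
- move=> v; exists (c v).
  have -> : p v + c v *: r - c v *: u = p v + c v *: (- p u).
    by rewrite -addrA -scalerBr rE addrAC subrr add0r.
  by apply: inspanD => //; exact: inspanZ.
- move=> v; rewrite opprD addrA.
  split; last by apply: orthD => //; rewrite -scaleNr; exact: orthZ.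
  rewrite [X in q _ X]uE qDr !qD !qN !qZ rp mulr0 subr0 -!qN -!qD vpp addr0.
  rewrite -qZ -qN -qD; rewrite qD vr qN qZ /c divfK// subrr.
  by [].
- move=> I e B B0 eB.
  have nE v : q (v - (p v + c v *: r)) (v - (p v + c v *: r)) =
      q (v - p v) (v - p v) - q v r ^+ 2 / q r r.
    rewrite opprD addrA; move: (v - p v) (vr v) => x xr.
    rewrite qD !qDr !qN !qNr !qZ !qZr (qC r x) xr /c.
    by field.
  under [leRHS]eq_bigr do rewrite nE.
  rewrite sumrB -mulr_suml; have := bp I e B B0 eB.
  have : (\sum_i q (e i) r ^+ 2) / q r r <= B by rewrite ler_pdivrMr.
  by rewrite /= -natr1; lra.
Qed.

End projection.

Section greedy.
Context {R : realType} (V : lmodType R) (qE qr : V -> V -> R).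
Hypothesis qEC : forall a b, qE a b = qE b a.
Hypothesis qED : forall a b c, qE (a + b) c = qE a c + qE b c.
Hypothesis qEZ : forall k a c, qE (k *: a) c = k * qE a c.
Hypothesis qE_ge0 : forall a, 0 <= qE a a.
Hypothesis qrC : forall a b, qr a b = qr b a.
Hypothesis qrD : forall a b c, qr (a + b) c = qr a c + qr b c.
Hypothesis qrZ : forall k a c, qr (k *: a) c = k * qr a c.
Hypothesis qr_ge0 : forall a, 0 <= qr a a.
Variables (I : finType) (e : I -> V) (nu eps B hi : R).
Hypothesis nu_ge0 : 0 <= nu.
Hypothesis nu_le : forall a, nu * qE a a <= qr a a.
Hypothesis e_eps : forall i, qE (e i) (e i) = eps.
Hypothesis e_hi : forall i, qr (e i) (e i) <= hi.
Hypothesis B_ge0 : 0 <= B.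
Hypothesis bessel : forall u, \sum_i qE (e i) u ^+ 2 <= B * qE u u.
Hypothesis I_gt0 : (0 < #|I|)%N.

(* The squared qE-distances from the e i to the span of m vectors sum up to at
   least #|I| * eps - m * B, so some e i remains far from that span. *)
Lemma greedy_selection (m : nat) : m%:R * B <= #|I|%:R * eps / 2 ->
  exists l : seq I, size l = m /\
    nondegenerate qr (nu * (eps / 2)) hi (map e l).
Proof.
elim: m => [_|m ih mB]; first by exists [::].
have mB' : m%:R * B <= #|I|%:R * eps / 2.
  by apply: le_trans mB; rewrite ler_wpM2r// ler_nat.
have [l [sl gl]] := ih mB'.
have [p [sp op bp]] := projection_exists qEC qED qEZ qE_ge0 (map e l).
(* [p] guides the choice through [qE], [pr] gives the conditional mean for [qr]. As [p] minimises
   the [qE]-distance, qr(v - pr v) >= nu qE(v - pr v) >= nu qE(v - p v), where each form is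
   evaluated on the diagonal. *)
have [pr [spr opr _]] := projection_exists qrC qrD qrZ qr_ge0 (map e l).
have [i hi_] : exists i, eps / 2 <= qE (e i - p (e i)) (e i - p (e i)).
  apply: contrapT => /forallNP h.
  have := bp I e B B_ge0 bessel; rewrite size_map sl.
  under eq_bigr do rewrite e_eps.
  rewrite sumr_const -mulr_natl => h2.
  have : \sum_i qE (e i - p (e i)) (e i - p (e i)) < \sum_(i : I) eps / 2.
    have [i0 _] : exists i0 : I, i0 \in I by apply/existsP; move: I_gt0; rewrite lt0n => /pred0Pn[x _]; apply/existsP; exists x.
    apply: ltr_sum => [|i _]; first by apply/hasP; exists i0; rewrite ?mem_index_enum.
    by rewrite ltNge; apply/negP/h.
  rewrite sumr_const -mulr_natl.
  by move=> h3; lra.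
exists (i :: l); split; first by rewrite /= sl.
split => //; exists (pr (e i)); split => //.
apply/andP; split.
  apply: le_trans (nu_le _); rewrite ler_wpM2l//; apply: (le_trans hi_).
  exact: (orth_dist_min qEC qED qEZ qE_ge0 (sp _) (op _) (spr _)).
apply: le_trans (e_hi i); rewrite -[X in _ <= qr X X]subr0.
by apply: (orth_dist_min qrC qrD qrZ qr_ge0 (spr _) (opr _)); exact: inspan0.
Qed.

End greedy.

(** * Trigonometric sums *)

Section trigonometric_sums.
Context {R : realType}.
Implicit Types (s t : seq R) (x y h : R).

(** The squared modulus of the exponential sum of e^(i x u) over the list. *)
Definition trig_power s x : R :=
  (\sum_(u <- s) cos (x * u)) ^+ 2 + (\sum_(u <- s) sin (x * u)) ^+ 2.

(** Repetitions are kept, so that exponential sums and sizes multiply exactly. *)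
Definition sumset s t : seq R := [seq u + v | u <- s, v <- t].

Lemma trig_power_ge0 s x : 0 <= trig_power s x.
Proof. by rewrite addr_ge0// sqr_ge0. Qed.

Lemma size_sumset s t : size (sumset s t) = (size s * size t)%N.
Proof. exact: size_allpairs. Qed.

Lemma trig_power_sumset s t x :
  trig_power (sumset s t) x = trig_power s x * trig_power t x.
Proof.
rewrite /trig_power /sumset !big_allpairs_dep/=.
pose cs := \sum_(u <- s) cos (x * u); pose ss := \sum_(u <- s) sin (x * u).
pose ct := \sum_(u <- t) cos (x * u); pose st := \sum_(u <- t) sin (x * u).
have -> : \sum_(u <- s) \sum_(v <- t) cos (x * (u + v)) = cs * ct - ss * st.
  rewrite /cs /ss !mulr_suml -sumrB; apply: eq_bigr => u _.
  rewrite /ct /st !mulr_sumr -sumrB; apply: eq_bigr => v _.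
  by rewrite mulrDr cosD.
have -> : \sum_(u <- s) \sum_(v <- t) sin (x * (u + v)) = ss * ct + cs * st.
  rewrite /cs /ss !mulr_suml -big_split; apply: eq_bigr => u _.
  rewrite /ct /st !mulr_sumr -big_split; apply: eq_bigr => v _.
  by rewrite mulrDr sinD.
by rewrite -/cs -/ss -/ct -/st; ring.
Qed.

Lemma trig_powerE s x :
  trig_power s x = \sum_(u <- s) \sum_(v <- s) cos (x * (u - v)).
Proof.
rewrite /trig_power !expr2 !mulr_suml -big_split; apply: eq_bigr => u _ /=.
rewrite !mulr_sumr -big_split; apply: eq_bigr => v _ /=.
by rewrite mulrBr cosB.
Qed.

Lemma trig_power_le s x : trig_power s x <= (size s)%:R ^+ 2.
Proof.
rewrite trig_powerE expr2 -natrM.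
apply: (@le_trans _ _ (\sum_(u <- s) \sum_(v <- s) 1)).
  by apply: ler_sum => u _; apply: ler_sum => v _; exact: cos_le1.
by rewrite !big_const_seq !count_predT !iter_addr_0 -mulrnA.
Qed.

Definition progression h (L : nat) : seq R := [seq i%:R * h | i <- index_iota 0 L].

(* Summing the Dirichlet kernel by telescoping. *)
Lemma sin_trig_power_progression h L x :
  sin (x * h / 2) ^+ 2 * trig_power (progression h L) x <= 1.
Proof.
set y := x * h / 2.
pose A : R := (2 * L%:R - 1) * y.
have xu i : x * (i%:R * h) = 2 * i%:R * y by rewrite /y; field.
have hc K : 2 * (sin y * \sum_(u <- progression h K) cos (x * u)) =
    sin ((2 * K%:R - 1) * y) + sin y.
  rewrite big_map; under eq_bigr do rewrite xu.
  elim: K => [|K ih]; first by rewrite big_nil !mulr0 sub0r mulN1r sinN addNr.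
  rewrite big_nat_recr//= (mulrDr (sin y)) (mulrDr 2) ih -[K.+1%:R]natr1.
  have -> : (2 * (K%:R + 1) - 1) * y = 2 * K%:R * y + y by ring.
  have -> : (2 * K%:R - 1) * y = 2 * K%:R * y - y by ring.
  by rewrite sinB sinD; ring.
have hs K : 2 * (sin y * \sum_(u <- progression h K) sin (x * u)) =
    cos y - cos ((2 * K%:R - 1) * y).
  rewrite big_map; under eq_bigr do rewrite xu.
  elim: K => [|K ih]; first by rewrite big_nil !mulr0 sub0r mulN1r cosN subrr.
  rewrite big_nat_recr//= (mulrDr (sin y)) (mulrDr 2) ih -[K.+1%:R]natr1.
  have -> : (2 * (K%:R + 1) - 1) * y = 2 * K%:R * y + y by ring.
  have -> : (2 * K%:R - 1) * y = 2 * K%:R * y - y by ring.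
  by rewrite cosB cosD; ring.
have -> : sin y ^+ 2 * trig_power (progression h L) x =
    ((sin A + sin y) ^+ 2 + (cos y - cos A) ^+ 2) / 4.
  by rewrite /A -hc -hs /trig_power; field.
have -> : (sin A + sin y) ^+ 2 + (cos y - cos A) ^+ 2 = 2 - 2 * cos (A + y).
  have := cos2Dsin2 A; have := cos2Dsin2 y; rewrite cosD => e1 e2.
  transitivity ((cos y ^+ 2 + sin y ^+ 2) + (cos A ^+ 2 + sin A ^+ 2) +
    2 * (sin A * sin y - cos A * cos y)); first by ring.
  by rewrite e1 e2; ring.
by have := cos_geN1 (A + y); lra.
Qed.

(** From sin x = 2 sin(x/2) cos(x/2), the mean value bound sin(x/2) >= (x/2) cos(x/2), and
    cos(x/2)^2 = (1 + cos x)/2 >= 1/2. *)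
Lemma sin_ge_half x : 0 <= x <= pi / 2 -> x / 2 <= sin x.
Proof.
move=> /andP[x0 x1]; have pi0 := pi_gt0 R.
have [->|xn] := eqVneq x 0; first by rewrite mul0r sin0.
have xp : 0 < x / 2 by rewrite divr_gt0// lt_neqAle eq_sym xn.
have c4 : cos (x / 2) ^+ 2 >= 2^-1.
  have -> : cos (x / 2) ^+ 2 = (cos x + 1) / 2.
    have {2}-> : x = x / 2 *+ 2 by rewrite -mulr_natr divfK.
    by rewrite cos_mulr2n -mulr_natr; field.
  have : 0 <= cos x by apply: cos_ge0_pihalf; rewrite x1 andbT; lra.
  by lra.
have c0 : 0 <= cos (x / 2) by apply: cos_ge0_pihalf; apply/andP; split; lra.
have [c cx] := @MVT _ (@sin R) (@cos R) 0 (x / 2) xp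
  (fun y _ => is_derive_sin y) (continuous_subspaceT (@continuous_sin R)).
rewrite sin0 !subr0 => sE.
have cc : cos (x / 2) <= cos c.
  move: cx; rewrite in_itv/= => /andP[c1 c2].
  rewrite leNgt ltr_cos ?in_itv/=; last 2 first.
  - by apply/andP; split; lra.
  - by apply/andP; split; lra.
  by rewrite -leNgt ltW.
have -> : sin x = 2 * (sin (x / 2) * cos (x / 2)).
  have {1}-> : x = x / 2 *+ 2 by rewrite -mulr_natr divfK.
  by rewrite sin_mulr2n -mulr_natr mulrC [cos _ * _]mulrC.
rewrite sE.
have : cos (x / 2) * cos (x / 2) <= cos c * cos (x / 2) by rewrite ler_wpM2r.
rewrite -expr2 => h1.
have : 2^-1 * (x / 2) <= cos c * cos (x / 2) * (x / 2).
  by rewrite ler_wpM2r ?(ltW xp)// (le_trans c4 h1).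
by lra.
Qed.

Lemma sqr_sin_ge x : `|x| <= pi / 2 -> x ^+ 2 / 4 <= sin x ^+ 2.
Proof.
move=> xp.
have -> : sin x ^+ 2 = sin `|x| ^+ 2 by have [x0|x0] := ler0P x; rewrite ?sinN ?sqrrN.
have h := @sin_ge_half `|x|; rewrite normr_ge0 xp in h.
have -> : x ^+ 2 / 4 = (`|x| / 2) ^+ 2 by rewrite exprMn real_normK ?num_real//; field.
by rewrite ler_sqr ?nnegrE ?h// ?divr_ge0// (le_trans _ (h _)) ?divr_ge0.
Qed.

Lemma trig_power_progression h L x : `|x| * h <= pi -> 0 <= h ->
  (`|x| * h / 4) ^+ 2 * trig_power (progression h L) x <= 1.
Proof.
move=> xh h0; apply: le_trans (sin_trig_power_progression h L x).
rewrite ler_wpM2r ?trig_power_ge0//.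
have -> : (`|x| * h / 4) ^+ 2 = (x * h / 2) ^+ 2 / 4.
  by rewrite !exprMn real_normK ?num_real//; field.
apply: sqr_sin_ge; rewrite normrM normrM (ger0_norm h0) normfV.
by rewrite (ger0_norm (ler0n _ 2)) ler_wpM2r// invr_ge0.
Qed.

(* A p-fold sum of progressions: averaging over it damps a frequency x like
   (h L |x|)^(-2p), which for 2p > gamma leaves only the contribution of the
   spectrum near 0. *)
Fixpoint shifts h (L p : nat) : seq R :=
  if p is p'.+1 then sumset (progression h L) (shifts h L p') else [:: h].

Lemma size_shifts h L p : size (shifts h L p) = (L ^ p)%N.
Proof.
elim: p => //= p ih; rewrite size_sumset ih expnS; congr (_ * _)%N.
by rewrite size_map size_iota subn0.
Qed.

(** The seed [h] of [shifts] keeps all times strictly positive, as the persistence event concerns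
    (0, N]; each of the p progressions adds at most (L - 1) h. *)
Lemma shifts_bounds h L p u : 0 < h -> u \in shifts h L p ->
  0 < u <= h * (1 + (p * L.-1)%:R).
Proof.
move=> h0; elim: p u => [u|p ih u] /=.
  by rewrite inE => /eqP->; rewrite mul0n addr0 mulr1 h0 lexx.
move=> /allpairsP[[v w] /= [/mapP[i] + -> /ih /andP[w0 w1] ->]].
rewrite mem_index_iota => /andP[_ iL]; apply/andP; split.
  by rewrite ltr_wpDl// mulr_ge0// ltW.
rewrite mulSn natrD addrCA mulrDr [h * (1 + _)]mulrC -[X in _ <= _ + X]mulrC.
rewrite lerD// 1?mulrC//.
by rewrite ler_wpM2l ?(ltW h0)// ler_nat -ltnS (ltn_predK iL).
Qed.

Lemma trig_power_shifts h L p x :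
  trig_power (shifts h L p) x = trig_power (progression h L) x ^+ p.
Proof.
elim: p => [|p ih] /=.
  by rewrite /trig_power !big_seq1 expr0 cos2Dsin2.
by rewrite trig_power_sumset ih exprS.
Qed.

End trigonometric_sums.

(** * Trigonometric polynomials and their quadratic forms *)

Section trigonometric_forms.
Context {R : realType} (M : nat) (tm : 'I_M -> R).
Implicit Types (a b c : 'rV[R]_M) (x : R).

Definition cos_poly a x : R := \sum_j a 0 j * cos (x * tm j).
Definition sin_poly a x : R := \sum_j a 0 j * sin (x * tm j).

(** The real part of p_a(x) times the conjugate of p_b(x), where p_a is the exponential polynomial
    with coefficients a and frequencies [tm]. *)
Definition trig_prod a b x : R :=
  cos_poly a x * cos_poly b x + sin_poly a x * sin_poly b x.

Lemma cos_polyD a b x : cos_poly (a + b) x = cos_poly a x + cos_poly b x.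
Proof.
by rewrite /cos_poly -big_split; apply: eq_bigr => j _; rewrite mxE mulrDl.
Qed.

Lemma sin_polyD a b x : sin_poly (a + b) x = sin_poly a x + sin_poly b x.
Proof.
by rewrite /sin_poly -big_split; apply: eq_bigr => j _; rewrite mxE mulrDl.
Qed.

Lemma cos_polyZ k a x : cos_poly (k *: a) x = k * cos_poly a x.
Proof.
by rewrite /cos_poly mulr_sumr; apply: eq_bigr => j _; rewrite mxE mulrA.
Qed.

Lemma sin_polyZ k a x : sin_poly (k *: a) x = k * sin_poly a x.
Proof.
by rewrite /sin_poly mulr_sumr; apply: eq_bigr => j _; rewrite mxE mulrA.
Qed.

Lemma trig_prodE a b x :
  trig_prod a b x = \sum_i \sum_j a 0 i * b 0 j * cos (x * (tm i - tm j)).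
Proof.
rewrite /trig_prod /cos_poly /sin_poly !mulr_suml -big_split.
apply: eq_bigr => i _ /=; rewrite !mulr_sumr -big_split; apply: eq_bigr => j _ /=.
by rewrite mulrBr cosB; ring.
Qed.

Lemma trig_prod_ge0 a x : 0 <= trig_prod a a x.
Proof. by rewrite /trig_prod -!expr2 addr_ge0// sqr_ge0. Qed.

Lemma trig_prod_delta i x : trig_prod (delta_mx 0 i) (delta_mx 0 i) x = 1.
Proof.
have sel (F : 'I_M -> R) : \sum_j (delta_mx 0 i : 'rV[R]_M) 0 j * F j = F i.
  rewrite (bigD1 i)//= mxE !eqxx mul1r big1 ?addr0// => j ji.
  by rewrite mxE (negPf ji) andbF mul0r.
by rewrite /trig_prod /cos_poly /sin_poly !sel -!expr2 cos2Dsin2.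
Qed.

Let mid : measurable_fun setT (fun x : measurableTypeR R => x : R).
Proof. exact: measurable_id. Qed.

Lemma bdm_trig_prod a b : bdm (trig_prod a b : measurableTypeR R -> R).
Proof.
apply: bdmD; apply: bdmM; apply: bdm_sum => j; apply: bdmM; try exact: bdm_cst.
- by apply: bdm_cos; exact: measurable_funM.
- by apply: bdm_cos; exact: measurable_funM.
- by apply: bdm_sin; exact: measurable_funM.
- by apply: bdm_sin; exact: measurable_funM.
Qed.

Section form.
Variables (m : {measure set (measurableTypeR R) -> \bar R}) (D : set (measurableTypeR R)).
Hypotheses (mD : measurable D) (mDoo : (m D < +oo)%E).

(** Used twice: for the spectral measure it is the covariance of linear combinations of the process,
    for Lebesgue measure on a part of E it is the form in which times are selected. *)
Definition trig_form a b : R := \int[m]_(x in D) trig_prod a b x.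

Let int_prod a b : m.-integrable D (EFin \o trig_prod a b).
Proof. by apply: bdm_integrable => //; exact: bdm_trig_prod. Qed.

Lemma trig_formC a b : trig_form a b = trig_form b a.
Proof.
apply: eq_Rintegral => x _; rewrite /trig_prod.
by rewrite mulrC [sin_poly a x * _]mulrC.
Qed.

Lemma trig_formD a b c : trig_form (a + b) c = trig_form a c + trig_form b c.
Proof.
rewrite /trig_form -RintegralD//; apply: eq_Rintegral => x _.
by rewrite /trig_prod cos_polyD sin_polyD; ring.
Qed.

Lemma trig_formZ k a c : trig_form (k *: a) c = k * trig_form a c.
Proof.
rewrite /trig_form -RintegralZl//; apply: eq_Rintegral => x _.
by rewrite /trig_prod cos_polyZ sin_polyZ; ring.
Qed.

Lemma trig_form_ge0 a : 0 <= trig_form a a.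
Proof. by apply: Rintegral_ge0 => x _; exact: trig_prod_ge0. Qed.

Lemma trig_form_delta i :
  trig_form (delta_mx 0 i) (delta_mx 0 i) = fine (m D).
Proof.
rewrite /trig_form; under eq_Rintegral do rewrite trig_prod_delta.
by rewrite Rintegral_cst// mul1r.
Qed.

Lemma trig_form_sum a b : trig_form a b = \sum_i a 0 i * trig_form (delta_mx 0 i) b.
Proof.
have h (s : seq 'I_M) : trig_form (\sum_(i <- s) a 0 i *: delta_mx 0 i) b =
    \sum_(i <- s) a 0 i * trig_form (delta_mx 0 i) b.
  elim: s => [|i s ih]; last by rewrite !big_cons trig_formD trig_formZ ih.
  by rewrite !big_nil -(scale0r (0 : 'rV[R]_M)) trig_formZ mul0r.
by rewrite -h -row_sum_delta.
Qed.

(* By duality from the boundedness of the form. *)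
Lemma trig_form_bessel B : 0 <= B ->
  (forall a, trig_form a a <= B * \sum_i a 0 i ^+ 2) ->
  forall u, \sum_i trig_form (delta_mx 0 i) u ^+ 2 <= B * trig_form u u.
Proof.
move=> B0 hB u.
pose a : 'rV[R]_M := \row_i trig_form (delta_mx 0 i) u.
set T := \sum_i _.
have aT : \sum_i a 0 i ^+ 2 = T by apply: eq_bigr => i _; rewrite mxE.
have auT : trig_form a u = T.
  by rewrite trig_form_sum; apply: eq_bigr => i _; rewrite mxE expr2.
have T0 : 0 <= T by apply: sumr_ge0 => i _; exact: sqr_ge0.
have [->|Tn] := eqVneq T 0; first by rewrite mulr_ge0// trig_form_ge0.
have Tp : 0 < T by rewrite lt_neqAle eq_sym Tn.
have := form_CauchySchwarz trig_formC trig_formD trig_formZ trig_form_ge0 a u.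
rewrite auT => h; rewrite -(ler_pM2l Tp) -expr2; apply: (le_trans h).
rewrite mulrA [T * B]mulrC -aT.
by rewrite ler_wpM2r ?trig_form_ge0.
Qed.

End form.

End trigonometric_forms.

(** * Orthogonality of exponentials on a grid *)

Section grid.
Context {R : realType} (M : nat) (h : R).
Hypothesis h0 : 0 < h.
Let tm (j : 'I_M) : R := j%:R * h.
Let A := pi / h.
Local Notation mu := (@lebesgue_measure R).

Lemma sin_natpi (n : nat) : sin (n%:R * pi) = 0 :> R.
Proof.
elim: n => [|n ih]; first by rewrite mul0r sin0.
by rewrite -natr1 mulrDl mul1r sinDpi ih oppr0.
Qed.

(** Parseval's identity over the full period of the grid exponentials. The period length 2 A becomes
    the Bessel constant of the selection. *)
Lemma trig_form_period (a : 'rV[R]_M) :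
  trig_form tm mu `[- A, A]%classic a a = 2 * A * \sum_i a 0 i ^+ 2.
Proof.
have A0 : 0 < A by rewrite divr_gt0// pi_gt0.
have mI : measurable (`[- A, A]%classic : set (measurableTypeR R)).
  exact: measurable_itv.
have muI : mu `[- A, A]%classic = (2 * A)%:E.
  rewrite lebesgue_measure_itv/= lte_fin ifT ?gtrN// -EFinD.
  by rewrite opprK; congr EFin; ring.
have cosE (i j : 'I_M) : \int[mu]_(x in `[- A, A]) cos (x * (tm i - tm j)) =
    (i == j)%:R * (2 * A).
  have [->|ij] := eqVneq i j.
    under eq_Rintegral do rewrite subrr mulr0 cos0.
    rewrite Rintegral_cst// !mul1r -[RHS]/(fine (2 * A)%:E) -muI.
    by [].
  set c := tm i - tm j.
  have c0 : c != 0.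
    rewrite /c /tm -mulrBl; apply: mulf_neq0; last by rewrite gt_eqF.
    rewrite subr_eq0 eqr_nat.
    by apply: contra ij => /eqP e; apply/eqP/val_inj.
  have sc : sin (A * c) = 0.
    rewrite /c /A /tm -mulrBl.
    have -> : pi / h * ((i%:R - j%:R) * h) = (i%:R - j%:R) * pi.
      by field; rewrite gt_eqF.
    case: (leqP i j) => lij.
      rewrite -opprB mulNr sinN -natrB// sin_natpi oppr0//.
    by rewrite -natrB ?sin_natpi// ltnW.
  rewrite mul0r /Rintegral.
  pose F (x : R) := sin (x * c) / c.
  have dF (x : R) : is_derive x 1 F (cos (x * c)).
    by rewrite /F; apply: is_derive_eq; rewrite /GRing.scale/=; field.
  have cF (x : R) : {for x, continuous F}.
    apply: differentiable_continuous; apply/derivable1_diffP.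
    by have [] := dF x.
  rewrite (@continuous_FTC2 _ _ F)//.
  - by rewrite /F mulNr sinN sc oppr0 mul0r -EFinB subrr.
  - by rewrite gtrN.
  - apply: continuous_subspaceT => x; apply: continuous_comp.
      by apply: continuousM => //; exact: cvg_cst.
    exact: continuous_cos.
  - split; first by move=> x _; have [] := dF x.
    + by apply: cvg_at_right_filter; exact: cF.
    + by apply: cvg_at_left_filter; exact: cF.
  - by move=> x _; rewrite derive1E; have [_ ->] := dF x.
have bc (i j : 'I_M) : bdm (fun x : measurableTypeR R => cos (x * (tm i - tm j))).
  by apply: bdm_cos; apply: measurable_funM => //; exact: measurable_id.
pose J := `[- A, A]%classic.
have muIoo : (mu J < +oo)%E by rewrite muI ltry.
have ic (i j : 'I_M) : mu.-integrable `[- A, A]%classic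
    (EFin \o (fun x => cos (x * (tm i - tm j)))).
  exact: (bdm_integrable mI muIoo (bc i j)).
have dbl (I : Type) (s : seq I) (F : I -> R -> R) :
    (forall i, bdm (F i : measurableTypeR R -> R)) ->
    \int[mu]_(x in `[- A, A]) (\sum_(i <- s) F i x) =
    \sum_(i <- s) \int[mu]_(x in `[- A, A]) F i x.
  move=> bF; elim: s => [|i s ih].
    under eq_Rintegral do rewrite big_nil.
    by rewrite big_nil Rintegral_cst// mul0r.
  under eq_Rintegral do rewrite big_cons.
  rewrite big_cons RintegralD// ?ih//.
  - exact: (bdm_integrable mI muIoo (bF i)).
  - exact: (bdm_integrable mI muIoo (bdm_sum s bF)).
rewrite /trig_form; under eq_Rintegral do rewrite trig_prodE.
rewrite dbl; last first.
  move=> i; apply: bdm_sum => j; apply: bdmM => //; exact: bdm_cst.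
rewrite mulr_sumr; apply: eq_bigr => i _.
rewrite dbl; last by move=> j; apply: bdmM => //; exact: bdm_cst.
rewrite (bigD1 i)//= big1 ?addr0 => [|j ji].
  by rewrite RintegralZl// cosE eqxx mul1r -expr2 mulrC.
by rewrite RintegralZl// cosE eq_sym (negPf ji) mul0r mulr0.
Qed.

Lemma trig_form_subset_le (E : set (measurableTypeR R)) (a : 'rV[R]_M) :
  measurable E -> E `<=` `[- A, A]%classic ->
  trig_form tm mu E a a <= 2 * A * \sum_i a 0 i ^+ 2.
Proof.
move=> mE EA; rewrite -trig_form_period /trig_form.
have mI : measurable (`[- A, A]%classic : set (measurableTypeR R)).
  exact: measurable_itv.
pose J := `[- A, A]%classic.
have muIoo : (mu J < +oo)%E.
  by rewrite lebesgue_measure_itv/=; case: ifP => _; rewrite ltry.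
have iI := bdm_integrable mI muIoo (bdm_trig_prod tm a a).
have iE : mu.-integrable E (EFin \o trig_prod tm a a) by exact: integrableS iI.
rewrite /Rintegral fine_le//; [exact: integrable_fin_num..|].
apply: ge0_subset_integral => //.
- exact: measurable_int iI.
- by move=> x _; rewrite lee_fin trig_prod_ge0.
Qed.

End grid.

(** * Spectral representation *)

Section process.
Context {R : realType} {T : time} {d : measure_display} {Omega : measurableType d}
  {P : probability Omega R} {X : R -> {RV P >-> R}}
  {rho : {finite_measure set (measurableTypeR R) -> \bar R}}.
Hypothesis gsp : is_GSP T X.
Hypothesis spec : is_spectral_measure T X rho.

Lemma times0 : times R T 0.
Proof. by case: T => //=; exists 0. Qed.

Lemma timesB (s t : R) : times R T s -> times R T t -> times R T (s - t).
Proof.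
by case: T => //= -[i _ <-] [j _ <-]; exists (i - j) => //; rewrite intrB.
Qed.

Lemma timesD (s t : R) : times R T s -> times R T t -> times R T (s + t).
Proof.
by case: T => //= -[i _ <-] [j _ <-]; exists (i + j) => //; rewrite intrD.
Qed.

Lemma timesMn (n : nat) (t : R) : times R T t -> times R T (n%:R * t).
Proof.
move=> tt; elim: n => [|n ih]; first by rewrite mul0r; exact: times0.
by rewrite -natr1 mulrDl mul1r; exact: timesD.
Qed.

Lemma path_measurable_prod (s t : R) (B : set R) :
  times R T s -> times R T t -> measurable B ->
  path_measurable T [set g : R -> R | B (g s * g t)].
Proof.
move=> ts tt mB; rewrite /path_measurable; set G := (X in <<s X >>).
have mev u : times R T u ->
    measurable_fun setT (fun g : g_sigma_algebraType G => (g : R -> R) u).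
  move=> tu _ C mC; rewrite setTI; apply: sub_sigma_algebra.
  by exists u => //; exists C.
have := measurable_funM (mev s ts) (mev t tt).
by move=> /(_ measurableT B mB); rewrite setTI.
Qed.

Lemma freqs_measurable : measurable (freqs R T : set (measurableTypeR R)).
Proof. by case: T => //=; exact: measurable_itv. Qed.

Lemma Rintegral_freqs (f : R -> R) : bdm (f : measurableTypeR R -> R) ->
  (\int[rho]_(x in freqs R T) (f x)%:E = \int[rho]_x (f x)%:E)%E.
Proof.
move=> bf; have mF := freqs_measurable.
rewrite [RHS](@negligible_integral _ _ _ rho setT (~` freqs R T)) //.
- by rewrite setTD setCK.
- exact: measurableC.
- by apply: bdm_integrable => //; rewrite ltey_eq fin_num_measure.
- exact: spectral_carried spec.
Qed.

Lemma bdm_cosM (t : R) : bdm (fun x : measurableTypeR R => cos (x * t)).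
Proof. by apply: bdm_cos; apply: measurable_funM => //; exact: measurable_id. Qed.

Lemma rho_lty (D : set (measurableTypeR R)) : measurable D -> (rho D < +oo)%E.
Proof. by move=> mD; rewrite ltey_eq fin_num_measure. Qed.

Lemma integrable_sqr_process t : times R T t ->
  P.-integrable setT (fun w => (X t w ^+ 2)%:E).
Proof.
move=> tt.
have := GSP_gaussian gsp (n := 1) (t := fun=> t) (fun=> 1) (fun=> tt).
under eq_fun do under eq_set do rewrite big_ord1 mul1r.
by move=> /(centered_gaussian_lawP (measurable_funPT (X t)))[v []].
Qed.

Lemma integrable_mul_process s t : times R T s -> times R T t ->
  P.-integrable setT (fun w => (X s w * X t w)%:E).
Proof.
move=> ts tt.
apply: (@le_integrable _ _ _ P _ measurableT _
    (fun w => ((X s w ^+ 2)%:E + (X t w ^+ 2)%:E)%E)) => //.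
- by apply/measurable_EFinP; exact: measurable_funM.
- move=> w _; rewrite -EFinD !abse_EFin lee_fin (le_trans _ (ler_norm _))//.
  rewrite -(real_normK (num_real (X s w))) -(real_normK (num_real (X t w))).
  rewrite normrM; have := sqr_ge0 (`|X s w| - `|X t w|).
  by have := normr_ge0 (X s w); have := normr_ge0 (X t w); nra.
- by apply: integrableD => //; exact: integrable_sqr_process.
Qed.

(** Stationarity for the path functional g(0) g(s - t), translated by t, shows that the two products
    have the same law; the covariance kernel is then read off the spectral measure. *)
Lemma expectation_mul_process s t : times R T s -> times R T t ->
  \int[P]_w (X s w * X t w) = \int[rho]_x cos (x * (s - t)).
Proof.
move=> ts tt; have tst := timesB ts tt.
have spre := spectral_re spec tst.
rewrite /Rintegral -(Rintegral_freqs (bdm_cosM (s - t))) -spre/=.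
rewrite /cov_kernel unlock; congr fine.
pose Y1 : Omega -> measurableTypeR R := fun w => X s w * X t w.
pose Y2 : Omega -> measurableTypeR R := fun w => X 0 w * X (s - t) w.
have m1 : measurable_fun setT Y1 by exact: measurable_funM.
have m2 : measurable_fun setT Y2 by exact: measurable_funM.
have mE : measurable_fun setT (EFin : measurableTypeR R -> \bar R).
  exact: EFin_measurable.
transitivity (\int[pushforward P Y1]_x x%:E)%E.
  rewrite integral_pushforward//.
  exact: (integrable_mul_process ts tt).
transitivity (\int[pushforward P Y2]_x x%:E)%E; last first.
  rewrite integral_pushforward//.
  exact: (integrable_mul_process times0 tst).
apply: eq_measure_integral => B mB _.
rewrite /= /pushforward.
have pm := path_measurable_prod times0 tst mB.
have := GSP_stationary gsp tt pm.
rewrite /Y1 /Y2 /preimage/= add0r subrK => e.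
by rewrite -e; congr (P _); apply/seteqP; split => w /=; rewrite mulrC.
Qed.

Section linear_combination.
Context (M : nat) (tm : 'I_M -> R).
Hypothesis ttm : forall i, times R T (tm i).

Definition combination (a : 'rV[R]_M) (w : Omega) : R :=
  \sum_j a 0 j * X (tm j) w.

Local Notation q := (trig_form tm rho setT).

Lemma measurable_combination a : measurable_fun setT (combination a).
Proof. by apply: measurable_sum => j; exact: measurable_funM. Qed.

Lemma combinationD a b w : combination (a + b) w = combination a w + combination b w.
Proof.
by rewrite /combination -big_split; apply: eq_bigr => j _; rewrite mxE mulrDl.
Qed.

Lemma combinationZ k a w : combination (k *: a) w = k * combination a w.
Proof.
by rewrite /combination mulr_sumr; apply: eq_bigr => j _; rewrite mxE mulrA.
Qed.

Lemma second_moment_combination a : \int[P]_w (combination a w ^+ 2) = q a a.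
Proof.
have ip i j : P.-integrable setT (EFin \o (fun w => a 0 i * a 0 j * (X (tm i) w * X (tm j) w))).
  have := integrable_mul_process (ttm i) (ttm j).
  by move/(integrableZl measurableT (a 0 i * a 0 j)); exact.
have ic i j : rho.-integrable setT
    (EFin \o (fun x => a 0 i * a 0 j * cos (x * (tm i - tm j)))).
  apply: bdm_integrable => //; first exact: rho_lty.
  by apply: bdmM; [exact: bdm_cst|exact: bdm_cosM].
rewrite /trig_form; under [in RHS]eq_Rintegral do rewrite trig_prodE.
have e w : combination a w ^+ 2 =
    \sum_i \sum_j a 0 i * a 0 j * (X (tm i) w * X (tm j) w).
  rewrite /combination expr2 mulr_suml; apply: eq_bigr => i _.
  by rewrite mulr_sumr; apply: eq_bigr => j _; ring.
under eq_Rintegral do rewrite e.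
have s1 i := Rintegral_sum (index_enum 'I_M) (ip i).
have s2 i := Rintegral_sum (index_enum 'I_M) (ic i).
rewrite (Rintegral_sum (index_enum 'I_M) (fun i => (s1 i).1)).2.
rewrite (Rintegral_sum (index_enum 'I_M) (fun i => (s2 i).1)).2.
apply: eq_bigr => i _; rewrite (s1 i).2 (s2 i).2; apply: eq_bigr => j _.
rewrite RintegralZl//; last exact: integrable_mul_process.
rewrite expectation_mul_process// RintegralZl//.
by apply: bdm_integrable => //; [exact: rho_lty|exact: bdm_cosM].
Qed.

(** The Gaussian law only provides some variance; its second moment identifies it with the spectral
    form, which is what the abstract conditioning needs. *)
Lemma combination_gaussian a :
  (forall c, \int[P]_w cos (combination a w + c) = expR (- (q a a / 2)) * cos c) /\
  (forall x V, 0 < x -> 0 < V -> q a a <= V ->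
    (P [set w | (x < combination a w)%R] <= (expR (- (x ^+ 2 / (2 * V))))%:E)%E).
Proof.
have := GSP_gaussian gsp (fun j => a 0 j) ttm.
move=> /(centered_gaussian_lawP (measurable_combination a)).
by move=> [v [_ vc _ vE vt]]; rewrite -second_moment_combination vE; split.
Qed.

End linear_combination.

Hypothesis mass1 : moment T rho 0 = 1%E.

Lemma rho_setT : rho setT = 1%E.
Proof.
rewrite -mass1 /moment.
have b1 : bdm (cst 1 : measurableTypeR R -> R) by exact: bdm_cst.
have e := Rintegral_freqs b1.
transitivity (\int[rho]_x (cst 1 x : R)%:E)%E.
  by rewrite (eq_integral (cst 1%E))// integral_cst// mul1e.
(* [powR] gives 0^0 = 1, so the origin counts with its mass. *)
by rewrite -e; apply: eq_integral => x _; rewrite /abs_power ltxx andbF powRr0.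
Qed.

(** * Variance of averages from the spectral mass near 0 *)

Section variance.
Variables (b gamma : R).
Hypothesis b_gt0 : 0 < b.
Hypothesis gamma_gt0 : 0 < gamma.
Hypothesis small_rho : forall N : R, 0 < N ->
  (rho `[0%R, (N^-1)%R]%classic <= (b * N `^ (- gamma))%:E)%E.

Lemma rho_near0 (x : R) : 0 < x ->
  fine (rho [set y | (`|y| <= x)%R]) <= 2 * b * x `^ gamma.
Proof.
move=> x0.
have mpos : measurable (`[0, x]%classic : set (measurableTypeR R)).
  exact: measurable_itv.
have mneg : measurable ([set - l | l in `[0, x]%classic] : set (measurableTypeR R)).
  rewrite (_ : [set _ | _ in _] = `[- x, 0]%classic); first exact: measurable_itv.
  apply/seteqP; split => y /=; rewrite in_itv/=.
    by move=> [z]; rewrite in_itv/= => /andP[z0 z1] <-; rewrite lerN2 z1 oppr_le0.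
  move=> /andP[y0 y1]; exists (- y); rewrite ?opprK// in_itv/=.
  by rewrite oppr_ge0 y1 lerNl.
have mabs : measurable ([set y | `|y| <= x] : set (measurableTypeR R)).
  rewrite (_ : [set _ | _] = `[- x, x]%classic); first exact: measurable_itv.
  by apply/seteqP; split => y /=; rewrite in_itv/= ler_norml.
pose I := `[0, x]%classic.
have h : (rho [set y | (`|y| <= x)%R] <= rho I + rho I)%E.
  rewrite -{2}(spectral_symmetric spec mpos).
  apply: (@le_trans _ _ (rho (I `|` [set (- l)%R | l in I]))).
    apply: le_measure; rewrite ?inE//; first exact: measurableU.
    move=> y /=; rewrite ler_norml => /andP[y1 y2].
    have [y0|y0] := leP 0 y; first by left; rewrite /I/= in_itv/= y0.
    right; exists (- y); rewrite ?opprK// /I/= in_itv/=.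
    by rewrite oppr_ge0 (ltW y0) lerNl.
  exact: measureU2.
have hx : (rho I <= (b * x `^ gamma)%:E)%E.
  have := small_rho (N := x^-1); rewrite invr_gt0 invrK => /(_ x0).
  by rewrite -(powR_inv1 (ltW x0)) -powRrM mulN1r opprK.
rewrite -lee_fin fineK ?fin_num_measure//; apply: (le_trans h).
have -> : 2 * b * x `^ gamma = b * x `^ gamma + b * x `^ gamma by ring.
by rewrite EFinD; exact: leeD.
Qed.

Let mabs (x : R) : measurable ([set y | `|y| <= x] : set (measurableTypeR R)).
Proof.
rewrite (_ : [set _ | _] = `[- x, x]%classic); first exact: measurable_itv.
by apply/seteqP; split => y /=; rewrite in_itv/= ler_norml.
Qed.

(* Dyadic decomposition: [f] decays like [(A |x|)^(-2p)] on [|x| <= B]. *)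
Lemma integral_decay_le (p : nat) (A B : R) (f : R -> R) :
  0 < A -> gamma + 1 <= (2 * p)%:R ->
  bdm (f : measurableTypeR R -> R) -> (forall x, 0 <= f x <= 1) ->
  (forall x, `|x| <= B -> (A * `|x|) ^+ (2 * p) * f x <= 1) ->
  \int[rho]_x f x <= 5 * 4 ^+ p * b * A `^ (- gamma) +
    fine (rho [set x | (B < `|x|)%R]).
Proof.
move=> A0 gp bf f01 fdec.
have p4 : 1 <= 4 ^+ p :> R by rewrite exprn_ege1// ler1n.
(* If i >= 1 is the first index with |x| <= 2^i / A, then |x| > 2^(i-1) / A and the decay gives f x
   <= 4^(-p(i-1)), the i-th coefficient; in the innermost ball f x <= 1 suffices. *)
pose S I (x : R) : R :=
  \sum_(i < I) 4 ^+ p / 4 ^+ (p * i) * \1_[set y | `|y| <= 2 ^+ i / A] x.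
have ptw I x : `|x| <= B -> f x <= S I x + 4 ^+ p / 4 ^+ (p * I).
  move=> xB; have /andP[f0 f1] := f01 x.
  elim: I => [|I ih].
    by rewrite /S big_ord0 add0r muln0 expr0 divr1 (le_trans f1).
  have S0 : 0 <= S I x.
    by apply: sumr_ge0 => i _; rewrite mulr_ge0// divr_ge0// exprn_ge0.
  have q0 : 0 <= 4 ^+ p / 4 ^+ (p * I.+1) :> R by rewrite divr_ge0// exprn_ge0.
  rewrite /S big_ord_recr/= -/(S I x) indicE.
  have [xI|xI] := leP `|x| (2 ^+ I / A).
    rewrite mem_set//= mulr1.
    by apply: (le_trans ih); rewrite lerDl.
  rewrite memNset/=; last by apply/negP; rewrite -ltNge.
  rewrite mulr0 addr0 (le_trans _ (_ : 4 ^+ p / 4 ^+ (p * I.+1) <= _))//; last first.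
    by rewrite lerDr.
  have e4 : 4 = 2 ^+ 2 :> R by rewrite -natrX.
  rewrite mulnS exprD invfM mulrA divff ?gt_eqF ?exprn_gt0// mul1r.
  have u2 : (2 ^+ I) ^+ (2 * p) <= (A * `|x|) ^+ (2 * p).
    rewrite lerXn2r// ?nnegrE ?exprn_ge0 ?mulr_ge0// ?(ltW A0)//.
    by rewrite mulrC -ler_pdivrMr// ltW.
  rewrite -[leRHS]mul1r ler_pdivlMr ?exprn_gt0//.
  apply: le_trans (fdec _ xB); rewrite mulrC ler_wpM2r//.
  apply: le_trans u2; rewrite e4 -!exprM.
  by rewrite (_ : (2 * (p * I))%N = (I * (2 * p))%N)// mulnA mulnC.
have mB : measurable ([set x | (B < `|x|)%R] : set (measurableTypeR R)).
  rewrite (_ : [set _ | _] = ~` [set x | `|x| <= B]); first exact: measurableC.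
  by apply/seteqP; split => x /=; [move=> ?; apply/negP; rewrite -ltNge|move/negP; rewrite -ltNge].
have rhofin (D : set (measurableTypeR R)) : measurable D -> rho D \is a fin_num.
  by move=> mD; rewrite fin_num_measure.
have bind (D : set (measurableTypeR R)) : measurable D -> bdm (\1_D : _ -> R).
  move=> mD; split; first exact: measurable_indic.
  by exists 1 => x; rewrite indicE; case: (_ \in _); rewrite ?normr1 ?normr0.
have int_ind (D : set (measurableTypeR R)) : measurable D ->
    \int[rho]_x (\1_D x) = fine (rho D).
  by move=> mD; rewrite /Rintegral integral_indic// setIT.
have irho g : bdm (g : measurableTypeR R -> R) -> rho.-integrable setT (EFin \o g).
  by move=> bg; apply: bdm_integrable => //; exact: rho_lty.
have IS I : \int[rho]_x (S I x) <=
    \sum_(i < I) 4 ^+ p * 2 * b * A `^ (- gamma) / 2 ^+ i /\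
    bdm (S I : measurableTypeR R -> R).
  elim: I => [|I [ih bS]].
    rewrite big_ord0 /S; split.
      under eq_Rintegral do rewrite big_ord0.
      by rewrite Rintegral_cst// mul0r.
    by under eq_fun do rewrite big_ord0; exact: bdm_cst.
  have SE : S I.+1 = fun x => S I x +
      4 ^+ p / 4 ^+ (p * I) * \1_[set y | `|y| <= 2 ^+ I / A] x.
    by apply/funext => x; rewrite /S big_ord_recr.
  have b2 := bind _ (mabs (2 ^+ I / A)).
  have b3 : bdm (fun x : measurableTypeR R =>
      4 ^+ p / 4 ^+ (p * I) * (\1_[set y | `|y| <= 2 ^+ I / A] x : R)).
    by apply: bdmM => //; exact: bdm_cst.
  rewrite SE; split; last exact: bdmD.
  rewrite RintegralD//; [|exact: irho..].
  rewrite RintegralZl//; last exact: irho.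
  rewrite big_ord_recr/= lerD// int_ind//.
  have x0 : 0 < 2 ^+ I / A by rewrite divr_gt0// exprn_gt0.
  apply: le_trans (ler_wpM2l _ (rho_near0 x0)) _.
    by rewrite divr_ge0// exprn_ge0.
  have -> : (2 ^+ I / A) `^ gamma = (2 ^+ I) `^ gamma * A `^ (- gamma).
    rewrite powRM ?exprn_ge0 ?invr_ge0 ?(ltW A0)//.
    by rewrite -powR_inv1 ?(ltW A0)// -powRrM mulN1r.
  (* Here gamma + 1 <= 2 p makes the dyadic contributions at most geometric with ratio 1/2. *)
  have g2 : (2 ^+ I) `^ gamma / 4 ^+ (p * I) <= (2 ^+ I)^-1.
    rewrite ler_pdivrMr ?exprn_gt0// ler_pdivlMl ?exprn_gt0//.
    rewrite -{1}[2 ^+ I]powRr1 ?exprn_ge0// -powRD; last first.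
      by apply/implyP => _; rewrite expf_neq0.
    apply: (@le_trans _ _ ((2 ^+ I) `^ (2 * p)%:R)).
      by rewrite ler_powR ?exprn_ege1 ?ler1n// addrC.
    rewrite powR_mulrn ?exprn_ge0//.
    have e4 : 4 = 2 ^+ 2 :> R by rewrite -natrX.
    rewrite e4 -!exprM.
    by rewrite (_ : (2 * (p * I))%N = (I * (2 * p))%N)// mulnA mulnC.
  have cst0 : 0 <= 4 ^+ p * 2 * b * A `^ (- gamma).
    by rewrite !mulr_ge0// ?exprn_ge0 ?powR_ge0 ?(ltW b_gt0).
  have := ler_wpM2l cst0 g2.
  by apply: le_trans; rewrite le_eqVlt; apply/orP; left; apply/eqP; ring.
have geo I : \sum_(i < I) (2 ^+ i)^-1 <= 2 :> R.
  have : \sum_(i < I) (2 ^+ i)^-1 = 2 - 2 / 2 ^+ I :> R.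
    elim: I => [|I ih]; first by rewrite big_ord0 expr0 divr1 subrr.
    rewrite big_ord_recr/= ih exprS; field.
    by rewrite expf_neq0.
  by move=> ->; rewrite gerBl divr_ge0// exprn_ge0.
have cE (c : R) : \int[rho]_x c = c.
  rewrite Rintegral_cst// [X in fine X](_ : _ = 1%E) ?mulr1//; exact: rho_setT.
have bound I : \int[rho]_x f x <= 4 ^+ p * 4 * b * A `^ (- gamma) +
    4 ^+ p / 4 ^+ (p * I) + fine (rho [set x | (B < `|x|)%R]).
  have [hS bS] := IS I.
  have bc : bdm (fun x : measurableTypeR R => S I x + 4 ^+ p / 4 ^+ (p * I)).
    by apply: bdmD => //; exact: bdm_cst.
  apply: (@le_trans _ _ (\int[rho]_x (S I x + 4 ^+ p / 4 ^+ (p * I) +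
      \1_[set x | (B < `|x|)%R] x))).
    apply: le_Rintegral => //; first exact: irho.
      by apply: irho; apply: bdmD => //; exact: bind.
    move=> x _; rewrite indicE; have [xB|xB] := leP `|x| B.
      rewrite memNset/= ?addr0; first exact: ptw.
      by apply/negP; rewrite -leNgt.
    rewrite mem_set//=; have /andP[_ f1] := f01 x; apply: (le_trans f1).
    rewrite lerDr addr_ge0 ?divr_ge0 ?exprn_ge0//.
    by apply: sumr_ge0 => i _; rewrite mulr_ge0// divr_ge0// exprn_ge0.
  rewrite RintegralD//; [|exact: irho|by apply: irho; exact: bind].
  rewrite RintegralD//; [|exact: irho|by apply: irho; exact: bdm_cst].
  rewrite int_ind// cE !lerD// (le_trans hS)//.
  rewrite -mulr_sumr; apply: (@le_trans _ _ (4 ^+ p * 2 * b * A `^ (- gamma) * 2)).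
    by rewrite ler_wpM2l// !mulr_ge0// ?exprn_ge0 ?powR_ge0 ?(ltW b_gt0).
  by rewrite le_eqVlt; apply/orP; left; apply/eqP; ring.
have p0 : (0 < p)%N.
  case: p gp {p4 S ptw IS bound fdec} => // gp; exfalso.
  by move: gp gamma_gt0; rewrite muln0 => g1 g2; lra.
have bA : 0 < b * A `^ (- gamma) by rewrite mulr_gt0// powR_gt0.
(* The dyadic sum contributes the constant 4 4^p; stopping at this I makes the remainder at most one
   more 4^p, whence the 5 of the statement. *)
have [I hI] : exists I : nat, (4 ^+ (p * I))^-1 <= b * A `^ (- gamma).
  exists (Num.truncn (b * A `^ (- gamma))^-1).+1.
  rewrite -[leRHS]invrK lef_pV2 ?posrE ?invr_gt0 ?exprn_gt0//.
  apply: (le_trans (ltW (truncnS_gt _))).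
  set n := _.+1; rewrite -natrX ler_nat.
  apply: (@leq_trans (4 ^ n)); first by rewrite ltnW// ltn_expl.
  by rewrite leq_exp2l// leq_pmull.
apply: (le_trans (bound I)); rewrite lerD2r.
have : 4 ^+ p / 4 ^+ (p * I) <= 4 ^+ p * (b * A `^ (- gamma)).
  by rewrite ler_wpM2l// exprn_ge0.
by lra.
Qed.

End variance.

End process.

(** * Comparison with Lebesgue measure, and the two time steps *)

Section lower_spectral_bound.
Context {R : realType} {rho : {finite_measure set (measurableTypeR R) -> \bar R}}
  {rho_ac : {measure set (measurableTypeR R) -> \bar R}}
  {E : set (measurableTypeR R)} {nu : R}.
Hypothesis ac : is_ac_component rho rho_ac.
Hypothesis acE : ac_lower_bound rho_ac E nu.
Local Notation mu := (@lebesgue_measure R).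

Lemma lebesgue_le_spectral (A : set (measurableTypeR R)) :
  measurable A -> A `<=` E -> (nu%:E * mu A <= rho A)%E.
Proof.
move=> mA AE; have [_ _ _ _ /(_ A mA AE) h] := acE.
have [_ [rho_s [_ ->]]] := ac => //.
by rewrite (le_trans h)// leeDl.
Qed.

(** Lebesgue measure restricted to F and scaled by nu is a measure dominated by rho on every
    measurable set, so the integrals of nonnegative functions compare. *)
Lemma ac_integral_le (F : set (measurableTypeR R)) (f : R -> R) :
  measurable F -> F `<=` E -> (mu F < +oo)%E ->
  bdm (f : measurableTypeR R -> R) -> (forall x, 0 <= f x) ->
  nu * \int[mu]_(x in F) f x <= \int[rho]_x f x.
Proof.
move=> mF FE Foo bf f0; have [_ _ _ nu0 _] := acE.
have mf : measurable_fun setT (fun x : measurableTypeR R => (f x)%:E).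
  by apply/measurable_EFinP; exact: bf.1.
have f0' x : (0 <= (f x)%:E)%E by rewrite lee_fin.
pose m1 : {measure set (measurableTypeR R) -> \bar R} :=
  mscale (NngNum (ltW nu0)) (mrestr mu mF).
have m1le (A : set (measurableTypeR R)) : measurable A -> (m1 A <= rho A)%E.
  move=> mA; have mAF := measurableI _ _ mA mF.
  rewrite /m1 /mscale/= /mrestr.
  apply: (le_trans (lebesgue_le_spectral mAF _)).
    by move=> x [_ /FE].
  by apply: le_measure; rewrite ?inE//; exact: subIsetl.
have h := ge0_le_measure_integral m1le measurableT f0' mf.
have e1 : (\int[m1]_x (f x)%:E = nu%:E * \int[mu]_(x in F) (f x)%:E)%E.
  rewrite /m1 ge0_integral_mscale//=; congr (_ * _)%E.
  rewrite -(@setUv _ F) ge0_integral_setU//; last 3 first.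
  - exact: measurableC.
  - by rewrite setUv.
  - exact/disj_setPCl.
  rewrite [X in (_ + X)%E](_ : _ = 0%E) ?adde0.
    by apply: eq_measure_integral => A mA AF; rewrite /= /mrestr setIidl.
  apply: null_set_integral.
  - exact: measurableC.
  - exact: measurable_funTS.
  - by rewrite /= /mrestr setICl measure0.
have iF : mu.-integrable F (EFin \o f) by exact: bdm_integrable.
have ir : rho.-integrable setT (EFin \o f).
  by apply: bdm_integrable => //; rewrite ltey_eq fin_num_measure.
rewrite -lee_fin EFinM /Rintegral !fineK; [|exact: integrable_fin_num..].
by rewrite -e1.
Qed.

Lemma spectral_set_lty : (mu E < +oo)%E.
Proof.
have [mE bE _ _ _] := acE.
have [K [_ /(_ (`|K| + 1)) hK]] := bE.
have {}hK : E `<=` `[- (`|K| + 1), `|K| + 1]%classic.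
  move=> x Ex; rewrite /= in_itv/= -ler_norml; apply: hK => //.
  by rewrite (le_lt_trans (ler_norm _))// ltrDl.
pose J : set (measurableTypeR R) := `[- (`|K| + 1), `|K| + 1]%classic.
have mJ : measurable J by exact: measurable_itv.
apply: (@le_lt_trans _ _ (mu J)); first by apply: le_measure; rewrite ?inE.
by rewrite lebesgue_measure_itv/=; case: ifP => _; rewrite ltry.
Qed.

End lower_spectral_bound.

Section scales.
Context {R : realType} {T : time} {d : measure_display} {Omega : measurableType d}
  {P : probability Omega R} {X : R -> {RV P >-> R}}
  {rho : {finite_measure set (measurableTypeR R) -> \bar R}}
  {rho_ac : {measure set (measurableTypeR R) -> \bar R}}
  {E : set (measurableTypeR R)} {nu : R}.
Hypothesis spec : is_spectral_measure T X rho.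
Hypothesis ac : is_ac_component rho rho_ac.
Hypothesis acE : ac_lower_bound rho_ac E nu.
Local Notation mu := (@lebesgue_measure R).

(* For T = Z only h = 1 is available, and E is cut to the frequency domain. *)
Lemma coarse_scale : exists (h : R) (F : set (measurableTypeR R)),
  [/\ times R T h, 0 < h <= 1, measurable F, F `<=` E `&` `[- (pi / h), pi / h]%classic
    & mu F = mu E].
Proof.
have [mE bE E0 nu0 _] := acE.
case: T spec => [sp|sp].
- exists 1, (E `&` `[- pi, pi]%classic).
  have mI : measurable (`[- pi, pi]%classic : set (measurableTypeR R)).
    exact: measurable_itv.
  rewrite ltr01 lexx divr1; split => //.
  + by exists 1.
  + exact: measurableI.
  + have mD : measurable (E `\` `[- pi, pi]%classic) by exact: measurableD.
    (* The spectral measure does not charge the part of E outside the frequency domain, and it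
       dominates nu dx there, so that part is Lebesgue null. *)
    have : (nu%:E * mu (E `\` `[(- pi)%R, pi]%classic) <= 0)%E.
      apply: (le_trans (lebesgue_le_spectral ac acE mD _)); first by move=> x [].
      rewrite -(spectral_carried sp); apply: le_measure; rewrite ?inE//.
      exact: measurableC.
    rewrite pmule_rle0 ?lte_fin// => h.
    rewrite -[in RHS](setUIDK E `[- pi, pi]%classic) measureU//.
    - rewrite [X in (_ + X)%E](_ : _ = 0%E) ?adde0//.
      by apply/eqP; rewrite eq_le h measure_ge0.
    - exact: measurableI.
    - by rewrite -subset0 => x [[_ a] [_ /(_ a)]].
- have [K [_ /(_ (`|K| + 1)) hK]] := bE.
  have K1 : 0 < `|K| + 1 by rewrite ltr_wpDl.
  have pK : 0 < pi + (`|K| + 1) by rewrite addr_gt0// pi_gt0.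
  (* Chosen so that pi / h = pi + (|K| + 1): the bound of E fits, and the extra pi forces h <= 1. *)
  exists (pi / (pi + (`|K| + 1))), E; split => //.
  + rewrite divr_gt0 ?pi_gt0//= ler_pdivrMr// mul1r lerDl.
    exact: ltW.
  + move=> x Ex; split => //.
    rewrite invfM invrK mulrA divff ?gt_eqF ?pi_gt0// mul1r.
    rewrite /= in_itv/= -ler_norml; apply: (@le_trans _ _ (`|K| + 1)).
      by apply: hK => //; rewrite (le_lt_trans (ler_norm _))// ltrDl.
    by rewrite lerDr pi_ge0.
Qed.

(** A progression of step h damps frequencies only up to pi / h. Beyond it there is no mass for
    integer times, and arbitrarily little for real times by continuity from above. *)
Lemma fine_scale (eps : R) : 0 < eps -> exists h : R,
  [/\ times R T h, 0 < h <= 1 & fine (rho [set x | (pi / h < `|x|)%R]) <= eps].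
Proof.
move=> eps0.
have mset (B : R) : measurable ([set x | (B < `|x|)%R] : set (measurableTypeR R)).
  rewrite (_ : [set _ | _] = ~` `[- B, B]%classic).
    by apply: measurableC; exact: measurable_itv.
  apply/seteqP; split => x /=; rewrite in_itv/= -ler_norml leNgt.
    by move=> ->.
  by move/negP; rewrite negbK.
case: T spec => [sp|sp].
- exists 1; split; [by exists 1|by rewrite ltr01 lexx|].
  rewrite divr1 [X in fine X](_ : _ = 0%E) ?ltW//.
  rewrite -(spectral_carried sp); congr (rho _).
  apply/seteqP; split => x /=; rewrite in_itv/= -ler_norml leNgt.
    by move=> ->.
  by move/negP; rewrite negbK.
- pose F (n : nat) : set (measurableTypeR R) := [set x | (pi * n.+1%:R < `|x|)%R].
  have Fcvg : rho (F n) @[n --> \oo] --> rho (\bigcap_n F n).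
    apply: nonincreasing_cvg_mu => //.
    - by rewrite ltey_eq fin_num_measure//; exact: mset.
    - by move=> n; exact: mset.
    - by apply: bigcap_measurable => //= n _; exact: mset.
    - move=> m n mn; apply/subsetPset => x /=; apply: le_lt_trans.
      by rewrite ler_wpM2l ?pi_ge0// ler_nat.
  have F0 : \bigcap_n F n = set0.
    rewrite -subset0 => x h; have := h (Num.truncn `|x|) I; rewrite /F/=.
    rewrite ltNge => /negP; apply; apply: (le_trans (ltW (truncnS_gt _))).
    by rewrite ler_peMl// (le_trans _ (pi_ge2 R))// ler1n.
  rewrite F0 measure0 in Fcvg.
  have /fine_cvgP[_ /cvgrPdist_le/(_ _ eps0)[n _ /(_ n (leqnn n))]] := Fcvg.
  rewrite /= sub0r normrN ger0_norm ?fine_ge0// => hn.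
  exists (n.+1%:R^-1); split => //.
    by rewrite invr_gt0 ltr0n/= invf_le1 ?ler1n// ltr0n.
  by rewrite invrK.
Qed.

End scales.

(** * The persistence bound at fixed N *)

Section persistence.
Context {R : realType} {T : time} {d : measure_display} {Omega : measurableType d}
  {P : probability Omega R} {X : R -> {RV P >-> R}}
  {rho : {finite_measure set (measurableTypeR R) -> \bar R}}.
Hypothesis gsp : is_GSP T X.
Hypothesis spec : is_spectral_measure T X rho.
Hypothesis mass1 : moment T rho 0 = 1%E.

Lemma measurable_process_gt0 (s : seq R) (f : R -> R) :
  measurable [set w | forall u, u \in s -> 0 < X (f u) w].
Proof.
elim: s => [|v s ih].
  rewrite (_ : [set _ | _] = setT); first exact: measurableT.
  by apply/seteqP; split.
rewrite (_ : [set _ | _] = X (f v) @^-1` `]0, +oo[%classic `&`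
    [set w | forall u, u \in s -> 0 < X (f u) w]).
  apply: measurableI => //; rewrite -[X in measurable X]setTI.
  by apply: measurable_funPT => //; exact: measurable_itv.
apply/seteqP; split => w /=; rewrite in_itv/= andbT.
  move=> h; split; first by apply: h; rewrite mem_head.
  by move=> u us; apply: h; rewrite inE us orbT.
by move=> [h1 h2] u; rewrite inE => /predU1P[->//|/h2].
Qed.

(** Monotonicity of the outer measure passes to finitely many times, where the event is measurable
    and the outer measure is P. *)
Lemma persistence_le_finite (N : R) (s : seq R) :
  (forall u, u \in s -> times R T u /\ 0 < u <= N) ->
  (persistence T X N <= P [set w | forall u, u \in s -> (0 < X u w)%R])%E.
Proof.
move=> hs; have mS := measurable_process_gt0 s id.
rewrite /persistence -[leRHS](@measurable_mu_extE _ _ _ P)//.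
by apply: le_mu_ext => w h u /hs[tu uN]; exact: h.
Qed.

(* The left-hand side is the probability that a positive path on the shifted
   grid [tau + tm j], j in l, has average at most 2 lv there. *)
Lemma small_average_le (M : nat) (tm : 'I_M -> R) (tau : R) (l : seq 'I_M)
    (lo lv beta s a0 : R) (cs : seq (R * R * R)) :
  (forall j, times R T (tm j)) -> times R T tau -> 0 < lv -> 0 <= lo -> 0 <= s ->
  nondegenerate (trig_form tm rho setT) lo 1 (map (delta_mx 0) l) ->
  (forall t, t \in cs -> 0 < t.2) -> (forall y, 0 <= bumps a0 cs y) ->
  (forall y, 0 < y -> expR (beta * (1 - y / (2 * lv))) <= bumps a0 cs y) ->
  (forall w y, lo <= w <= 1 -> bumps_avg a0 cs w y <= s) ->
  0 <= beta ->
  forall A : set Omega, measurable A ->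
  (forall w, A w -> (forall j, j \in l -> 0 < X (tau + tm j) w) /\
     \sum_(j <- l) X (tau + tm j) w <= 2 * lv * (size l)%:R) ->
  (P A <= (s ^+ size l)%:E)%E.
Proof.
move=> ttm ttau lv0 lo0 s0 nd cs0 g0 gle gs beta0 A mA hA.
pose tn j := tau + tm j.
have ttn j : times R T (tn j) by exact: timesD.
(* The form sees time differences only, so the selection made once on the unshifted grid serves for
   every shift [tau]. *)
have qE : trig_form tn rho setT = trig_form tm rho setT.
  apply/funext => a; apply/funext => b; apply: eq_Rintegral => x _.
  rewrite !trig_prodE; apply: eq_bigr => i _; apply: eq_bigr => j _.
  by congr (_ * cos (_ * _)); rewrite /tn; ring.
have rhoT : (rho setT < +oo)%E by exact: rho_lty.
have mT : measurable (setT : set (measurableTypeR R)) by exact: measurableT.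
have Wc a c := (combination_gaussian gsp spec ttn a).1 c.
have key := @expectation_prod_bumps_le _ _ _ P _ (combination (X := X) tn)
  (trig_form tn rho setT) (measurable_combination tn) (combinationD tn)
  (combinationZ tn) (trig_formC tn rho setT) (trig_formD tn mT rhoT)
  (trig_formZ tn mT rhoT) Wc a0 cs cs0 lo 1 s (map (delta_mx 0) l) lo0 s0.
rewrite qE in key; have {}key := key nd g0 gs.
have cd j w : combination (X := X) tn (delta_mx 0 j) w = X (tau + tm j) w.
  rewrite /combination (bigD1 j)//= mxE !eqxx mul1r big1 ?addr0// => i ij.
  by rewrite mxE (negPf ij) andbF mul0r.
rewrite size_map in key.
have bprod : bdm (fun w => \prod_(y <- map (delta_mx 0) l)
    bumps a0 cs (combination (X := X) tn y w)).
  elim: (map _ l) => [|y l' ih].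
    by under eq_fun do rewrite big_nil; exact: bdm_cst.
  under eq_fun do rewrite big_cons; apply: bdmM => //; apply: bdm_bumps.
  exact: measurable_combination.
have bA : bdm (\1_A : Omega -> R).
  split; first exact: measurable_indic.
  by exists 1 => x; rewrite indicE; case: (_ \in _); rewrite ?normr1 ?normr0.
have PA : fine (P A) = \int[P]_w (\1_A w).
  by rewrite /Rintegral integral_indic// setIT.
rewrite -[P A]fineK ?fin_num_measure// lee_fin PA.
apply: le_trans key; apply: le_Rintegral => //; [exact: bdm_integrableT..|].
move=> w _; rewrite indicE.
have pr0 : 0 <= \prod_(y <- map (delta_mx 0) l)
    bumps a0 cs (combination (X := X) tn y w) by exact: prodr_ge0.
case: (boolP (w \in A)) => // /set_mem /hA[pos avg].
(* Exponential Markov inequality: an average at most 2 lv makes the summed exponent nonnegative, so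
   the product is at least 1. *)
apply: (@le_trans _ _ (\prod_(j <- l) expR (beta * (1 - X (tau + tm j) w / (2 * lv))))).
  rewrite -expR_sum -[X in X <= _]expR0 ler_expR -mulr_sumr mulr_ge0//.
  rewrite sumrB -mulr_suml big_const_seq count_predT iter_addr_0.
  by rewrite subr_ge0 ler_pdivrMr ?mulr_gt0// mulrC.
rewrite big_map [leLHS]big_seq [leRHS]big_seq; apply: ler_prod => j jl.
by rewrite expR_ge0/= cd gle// pos.
Qed.

Variables (b gamma : R).
Hypothesis b_gt0 : 0 < b.
Hypothesis gamma_gt0 : 0 < gamma.
Hypothesis small_rho : forall N : R, 0 < N ->
  (rho `[0%R, (N^-1)%R]%classic <= (b * N `^ (- gamma))%:E)%E.

(** 6 is 5 from the dyadic bound plus 1 from the mass beyond the aliasing frequency; (16 p)^gamma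
    comes from the damping scale h L / 4 >= N / (16 p). *)
Definition variance_cst (b gamma : R) (p : nat) : R :=
  6 * 4 ^+ p * b * (16 * p%:R) `^ gamma.

(** The normalised power of a sumset is a product: the factor of the selected times is at most 1
    whatever they are, and the factor of the shifts has the decay required by
    [integral_decay_le]. *)
Lemma power_mean_le (p L : nat) (h : R) (s : seq R) (N : R) :
  (0 < p)%N -> gamma + 1 <= (2 * p)%:R -> 0 < N -> 0 < h -> (0 < L)%N ->
  N / (4 * p%:R) <= h * L%:R -> (0 < size s)%N ->
  fine (rho [set x | (pi / h < `|x|)%R]) <=
    4 ^+ p * b * (N / (16 * p%:R)) `^ (- gamma) ->
  \int[rho]_x (trig_power (sumset (shifts h L p) s) x /
      (size (sumset (shifts h L p) s))%:R ^+ 2) <=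
    variance_cst b gamma p * N `^ (- gamma).
Proof.
move=> p0 gp N0 h0 L0 hL s0 hh; set U := sumset _ _; set f := fun x => _.
have pR : 0 < p%:R :> R by rewrite ltr0n.
have LR : 0 < L%:R :> R by rewrite ltr0n.
have sR : 0 < (size s)%:R :> R by rewrite ltr0n.
have nR : (size U)%:R = L%:R ^+ p * (size s)%:R :> R.
  by rewrite /U size_sumset size_shifts natrM natrX.
have n0 : 0 < (size U)%:R :> R by rewrite nR mulr_gt0 ?exprn_gt0.
have mid : measurable_fun setT (fun x : measurableTypeR R => x : R).
  exact: measurable_id.
have bf : bdm (f : measurableTypeR R -> R).
  rewrite /f /trig_power; apply: bdmM; last exact: bdm_cst.
  by apply: bdmD; apply: bdmM; apply: bdm_sum => u; [apply: bdm_cos|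
    apply: bdm_cos|apply: bdm_sin|apply: bdm_sin]; exact: measurable_funM.
have f01 x : 0 <= f x <= 1.
  rewrite /f divr_ge0 ?trig_power_ge0 ?sqr_ge0//= ler_pdivrMr ?exprn_gt0//.
  by rewrite mul1r trig_power_le.
have A0 : 0 < h * L%:R / 4 by rewrite divr_gt0// mulr_gt0.
have dec x : `|x| <= pi / h -> (h * L%:R / 4 * `|x|) ^+ (2 * p) * f x <= 1.
  rewrite ler_pdivlMr// => xh.
  rewrite /f trig_power_sumset trig_power_shifts nR.
  have hp := trig_power_progression L xh (ltW h0).
  have hs := trig_power_le s x.
  have -> : (h * L%:R / 4 * `|x|) ^+ (2 * p) *
      (trig_power (progression h L) x ^+ p * trig_power s x /
       (L%:R ^+ p * (size s)%:R) ^+ 2) =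
      ((`|x| * h / 4) ^+ 2 * trig_power (progression h L) x) ^+ p *
      (trig_power s x / (size s)%:R ^+ 2).
    have -> : h * L%:R / 4 * `|x| = L%:R * (`|x| * h / 4) by ring.
    move: (`|x| * h / 4) (trig_power _ x) => y t.
    have e1 (z : R) : z ^+ (2 * p) = (z ^+ p) ^+ 2 by rewrite mulnC exprM.
    have e2 : (y ^+ 2 * t) ^+ p = (y ^+ p) ^+ 2 * t ^+ p.
      by rewrite exprMn exprAC.
    rewrite e1 e2 [(L%:R * y) ^+ p]exprMn; field.
    by rewrite !gt_eqF// exprn_gt0.
  apply: mulr_ile1.
  - by rewrite exprn_ge0// mulr_ge0 ?sqr_ge0 ?trig_power_ge0.
  - by rewrite divr_ge0 ?trig_power_ge0 ?sqr_ge0.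
  - by rewrite exprn_ile1// mulr_ge0 ?sqr_ge0 ?trig_power_ge0.
  - by rewrite ler_pdivrMr ?exprn_gt0// mul1r.
have main := integral_decay_le spec mass1 b_gt0 gamma_gt0 small_rho A0 gp bf f01 dec.
apply: (le_trans main).
have N16 : 0 < N / (16 * p%:R) by rewrite divr_gt0// mulr_gt0.
have AN : (h * L%:R / 4) `^ (- gamma) <= (N / (16 * p%:R)) `^ (- gamma).
  rewrite !powRN lef_pV2 ?posrE ?powR_gt0// ge0_ler_powR ?nnegrE ?(ltW gamma_gt0) ?(ltW N16) ?(ltW A0)//.
  rewrite ler_pdivlMr//; apply: le_trans hL.
  by rewrite le_eqVlt; apply/orP; left; apply/eqP; field; rewrite gt_eqF.
have NE : (N / (16 * p%:R)) `^ (- gamma) = (16 * p%:R) `^ gamma * N `^ (- gamma).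
  rewrite powRM ?invr_ge0 ?mulr_ge0 ?(ltW N0)// mulrC; congr (_ * _).
  rewrite -powR_inv1 ?mulr_ge0// -powRrM mulN1r opprK.
  by [].
have c0 : 0 <= 5 * 4 ^+ p * b by rewrite !mulr_ge0 ?exprn_ge0 ?(ltW b_gt0).
have := ler_wpM2l c0 AN; rewrite /variance_cst NE in hh *.
by lra.
Qed.

Lemma times_shifts (h : R) (L p : nat) (u : R) :
  times R T h -> u \in shifts h L p -> times R T u.
Proof.
move=> th; elim: p u => [|p ih] u /=; first by rewrite inE => /eqP->.
move=> /allpairsP[[v w] /= [/mapP[i _ ->] /ih tw ->]].
by apply: timesD => //; exact: timesMn.
Qed.

Section persistence_le.
Context {rho_ac : {measure set (measurableTypeR R) -> \bar R}}
  {E : set (measurableTypeR R)} {nu : R}.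
Hypothesis ac : is_ac_component rho rho_ac.
Hypothesis acE : ac_lower_bound rho_ac E nu.
Local Notation mu := (@lebesgue_measure R).

Let half_truncn (x : R) : 1 <= x ->
  (0 < Num.truncn x)%N /\ x / 2 <= (Num.truncn x)%:R <= x.
Proof.
move=> x1; have x0 : 0 <= x by rewrite (le_trans _ x1).
have t0 : (0 < Num.truncn x)%N by rewrite truncn_gt0.
split => //; apply/andP; split; last by rewrite truncn_le.
have := truncnS_gt x; have : 1 <= (Num.truncn x)%:R :> R by rewrite ler1n.
by rewrite -natr1; lra.
Qed.

(* The Gaussian term bounds the event that the mean over all shifts and selected
   times exceeds lv; the other one is Markov's inequality for the proportion of
   shifts with mean at most 2 lv. *)
Lemma persistence_le (N lv beta s a0 : R) (p m : nat) (cs : seq (R * R * R)) :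
  (0 < p)%N -> gamma + 1 <= (2 * p)%:R -> 4 * p%:R <= N ->
  (0 < m)%N -> m%:R <= N * fine (mu E) / (16 * pi) ->
  0 < lv -> 0 <= s -> 0 <= beta ->
  (forall t, t \in cs -> 0 < t.2) -> (forall y, 0 <= bumps a0 cs y) ->
  (forall y, 0 < y -> expR (beta * (1 - y / (2 * lv))) <= bumps a0 cs y) ->
  (forall w y, nu * (fine (mu E) / 2) <= w <= 1 -> bumps_avg a0 cs w y <= s) ->
  (persistence T X N <=
    (expR (- (lv ^+ 2 / (2 * (variance_cst b gamma p * N `^ (- gamma)))))
     + 2 * s ^+ m)%:E)%E.
Proof.
move=> p0 gp pN m0 mN lv0 s0 beta0 cs0 g0 gle gs.
have [mE _ E0 nu0 _] := acE.
have pR : 1 <= p%:R :> R by rewrite ler1n.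
have N4 : 4 <= N by rewrite (le_trans _ pN)//; lra.
have N0 : 0 < N by lra.
have pi0 := pi_gt0 R.
set e := fine (mu E) in mN gs.
have Eoo := spectral_set_lty acE.
have e0 : 0 < e by rewrite fine_gt0// E0.
have [h0 [F [th0 /andP[h00 h01] mF FE FEmu]]] := coarse_scale spec ac acE.
have Foo : (mu F < +oo)%E by rewrite FEmu.
have V0 : 0 < variance_cst b gamma p * N `^ (- gamma).
  rewrite /variance_cst !mulr_gt0 ?exprn_gt0 ?powR_gt0//.
  by rewrite mulr_gt0// (lt_le_trans _ pR).
have eps0 : 0 < 4 ^+ p * b * (N / (16 * p%:R)) `^ (- gamma).
  rewrite !mulr_gt0 ?exprn_gt0 ?powR_gt0// divr_gt0//.
  by rewrite mulr_gt0// (lt_le_trans _ pR).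
have [h [th /andP[hp h1] hfine]] := fine_scale spec eps0.
(* The window (0, N] is split evenly: grid times stay below N/2, and [L] below is chosen so that the
   shifts do too. *)
pose M := Num.truncn (N / (2 * h0)).
have [M0 /andP[M1 M2]] : (0 < M)%N /\ N / (2 * h0) / 2 <= M%:R <= N / (2 * h0).
  apply: half_truncn; rewrite ler_pdivlMr ?mulr_gt0// mul1r.
  by apply: (@le_trans _ _ (2 * 1)); [rewrite ler_wpM2l|lra].
pose L := Num.truncn (N / (2 * p%:R * h)).
have ph0 : 0 < 2 * p%:R * h by rewrite !mulr_gt0// (lt_le_trans _ pR).
have [L0 /andP[L1 L2]] : (0 < L)%N /\
    N / (2 * p%:R * h) / 2 <= L%:R <= N / (2 * p%:R * h).
  apply: half_truncn; rewrite ler_pdivlMr// mul1r.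
  apply: (@le_trans _ _ (2 * p%:R * 1)); last by lra.
  by rewrite ler_wpM2l// mulr_ge0.
pose tm (j : 'I_M) : R := j%:R * h0.
have ttm j : times R T (tm j) by exact: timesMn.
have mT : measurable (setT : set (measurableTypeR R)) by exact: measurableT.
have rhoT : (rho setT < +oo)%E by exact: rho_lty.
have [l [lm nd]] : exists l : seq 'I_M, size l = m /\
    nondegenerate (trig_form tm rho setT) (nu * (e / 2)) 1 (map (delta_mx 0) l).
  (* The Bessel constant is the period 2 pi / h0. With M >= N / (4 h0) candidates, selecting m of
     them requires 2 pi m / h0 <= M e / 2; h0 cancels and m <= N e / (16 pi) suffices. *)
  have B0 : 0 <= 2 * (pi / h0) by rewrite mulr_ge0// divr_ge0// ltW.
  apply: (@greedy_selection _ _ (trig_form tm mu F) _ (trig_formC tm mu F)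
    (trig_formD tm mF Foo) (trig_formZ tm mF Foo) (trig_form_ge0 tm mu F)
    (trig_formC tm rho setT) (trig_formD tm mT rhoT) (trig_formZ tm mT rhoT)
    (trig_form_ge0 tm rho setT) _ (delta_mx 0) nu e (2 * (pi / h0)) 1 (ltW nu0)).
  - move=> a; apply: (ac_integral_le ac acE) => //.
    + by move=> x /FE[].
    + exact: bdm_trig_prod.
    + exact: trig_prod_ge0.
  - move=> i; transitivity (fine (mu F)); last by rewrite FEmu.
    exact: trig_form_delta.
  - move=> i; rewrite (_ : trig_form _ _ _ _ _ = fine (rho setT)).
      by rewrite (rho_setT spec mass1).
    exact: trig_form_delta.
  - exact: B0.
  - apply: trig_form_bessel => // a; apply: trig_form_subset_le => //.
    by move=> x /FE[].
  - by rewrite card_ord.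
  rewrite card_ord.
  have : m%:R * (2 * (pi / h0)) <= N * e / (16 * pi) * (2 * (pi / h0)).
    by rewrite ler_wpM2r.
  move/le_trans; apply.
  apply: (@le_trans _ _ (N / (2 * h0) / 2 * e / 2)); last first.
    by rewrite ler_wpM2r// ler_wpM2r// ltW.
  have cancel (q : R) : 0 < q ->
      N * e / (16 * q) * (2 * (q / h0)) = N / (2 * h0) / 2 * e / 2.
    by move=> q0; field; rewrite !gt_eqF.
  by rewrite cancel.
pose C := map tm l.
pose U := sumset (shifts h L p) C.
have tsh u := @times_shifts h L p u th.
have Ubd u : u \in U -> times R T u /\ 0 < u <= N.
  move=> /allpairsP[[v w] /= [vs /mapP[j _ ->] ->]].
  split; first by apply: timesD => //; exact: tsh.
  have /andP[v0 v1] := shifts_bounds hp vs.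
  have tj0 : 0 <= tm j by rewrite mulr_ge0// ltW.
  have tj1 : tm j <= N / 2.
    apply: (@le_trans _ _ (M%:R * h0)).
      by rewrite ler_wpM2r ?(ltW h00)// ler_nat ltnW.
    apply: le_trans (ler_wpM2r (ltW h00) M2) _.
    by rewrite le_eqVlt; apply/orP; left; apply/eqP; field; rewrite gt_eqF.
  have v2 : v <= N / 2.
    apply: (le_trans v1); apply: (@le_trans _ _ (h * (p%:R * L%:R))).
      rewrite ler_wpM2l ?(ltW hp)// -natrM addrC natr1 ler_nat.
      by rewrite -[in leqRHS](prednK L0) mulnS -add1n leq_add2r.
    have := ler_wpM2l (mulr_ge0 (ltW hp) (ler0n R p)) L2.
    rewrite -mulrA => /le_trans; apply.
    rewrite le_eqVlt; apply/orP; left; apply/eqP; field.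
    by rewrite !gt_eqF// (lt_le_trans _ pR).
  by apply/andP; split; [rewrite ltr_pwDl|lra].
have sC : size C = m by rewrite size_map.
have hL : N / (4 * p%:R) <= h * L%:R.
  apply: le_trans (ler_wpM2l (ltW hp) L1).
  rewrite le_eqVlt; apply/orP; left; apply/eqP; field.
  by rewrite !gt_eqF// (lt_le_trans _ pR).
have Vle := power_mean_le p0 gp N0 hp L0 hL (s := C).
rewrite sC in Vle; have {}Vle := Vle m0 hfine.
rewrite -/U in Vle.
pose K := size (shifts h L p).
have KE : K = (L ^ p)%N by exact: size_shifts.
have K0 : 0 < K%:R :> R by rewrite ltr0n KE expn_gt0 L0.
have mR : 0 < m%:R :> R by rewrite ltr0n.
have nE : size U = (K * m)%N by rewrite size_sumset sC.
have n0 : 0 < (size U)%:R :> R by rewrite nE natrM mulr_gt0.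
(* Positions rather than values index the average, so a time reached in several ways counts with
   multiplicity, as in [trig_power]. *)
pose tU (i : 'I_(size U)) : R := U`_i.
have ttU i : times R T (tU i) by apply: (Ubd _ _).1; exact: mem_nth.
pose a : 'rV[R]_(size U) := const_mx (size U)%:R^-1.
have qa : trig_form tU rho setT a a <= variance_cst b gamma p * N `^ (- gamma).
  apply: le_trans Vle; rewrite le_eqVlt; apply/orP; left; apply/eqP.
  apply: eq_Rintegral => x _; rewrite trig_prodE trig_powerE (big_nth 0) big_mkord.
  rewrite mulr_suml; apply: eq_bigr => i _.
  rewrite (big_nth 0) big_mkord mulr_suml; apply: eq_bigr => j _.
  by rewrite !mxE /tU expr2 invfM mulrC.
have tail := (combination_gaussian gsp spec ttU a).2 lv _ lv0 V0 qa.
have combE w : combination (X := X) tU a w = (\sum_(u <- U) X u w) / (size U)%:R.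
  rewrite (big_nth 0) big_mkord mulr_suml; apply: eq_bigr => i _.
  by rewrite mxE mulrC.
pose A1 := [set w | (lv < combination (X := X) tU a w)%R].
have mA1 : measurable A1.
  have := measurable_combination (X := X) tU a.
  move=> /(_ measurableT `]lv, +oo[%classic); rewrite setTI.
  rewrite (_ : _ @^-1` _ = A1); first by apply; exact: measurable_itv.
  by apply/seteqP; split => w /=; rewrite in_itv/= andbT.
pose G0 := [set w | forall u, u \in U -> (0 < X u w)%R].
have mG0 : measurable G0 := measurable_process_gt0 U id.
pose At tau := [set w | forall j, j \in C -> (0 < X (tau + j) w)%R] `&`
  [set w | (\sum_(j <- l) X (tau + tm j) w <= 2 * lv * m%:R)%R].
have mAt tau : measurable (At tau).
  apply: measurableI; first exact: measurable_process_gt0.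
  have ms : measurable_fun setT (fun w => \sum_(j <- l) X (tau + tm j) w).
    by apply: measurable_sum => j.
  have := ms measurableT `]-oo, 2 * lv * m%:R]%classic; rewrite setTI.
  rewrite (_ : _ @^-1` _ = [set w | (\sum_(j <- l) X (tau + tm j) w <= 2 * lv * m%:R)%R]).
    by apply; exact: measurable_itv.
  by apply/seteqP; split => w /=; rewrite in_itv.
have PAt tau : tau \in shifts h L p -> (P (At tau) <= (s ^+ m)%:E)%E.
  move=> taus; rewrite -lm.
  have lo0 : 0 <= nu * (e / 2) by rewrite mulr_ge0 ?divr_ge0 ?(ltW nu0) ?(ltW e0).
  apply: (small_average_le ttm (tsh _ taus) lv0 lo0 s0 nd cs0 g0 gle gs beta0 (mAt tau)).
  move=> w [pos avg]; split; last by rewrite lm.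
  by move=> j jl; apply: pos; exact: map_f.
apply: (le_trans (persistence_le_finite Ubd)).
rewrite -/G0 EFinD.
have -> : G0 = (G0 `&` A1) `|` (G0 `\` A1) by rewrite setUIDK.
apply: (@le_trans _ _ (P (G0 `&` A1) + P (G0 `\` A1))%E).
  by apply: measureU2; [exact: measurableI|exact: measurableD].
apply: leeD.
  by apply: le_trans tail; apply: le_measure; rewrite ?inE//; exact: measurableI.
have mG : measurable (G0 `\` A1) by exact: measurableD.
have bi (D : set Omega) : measurable D -> bdm (\1_D : Omega -> R).
  move=> mD; split; first exact: measurable_indic.
  by exists 1 => x; rewrite indicE; case: (_ \in _); rewrite ?normr1 ?normr0.
have PI (D : set Omega) : measurable D -> fine (P D) = \int[P]_w (\1_D w).
  by move=> mD; rewrite /Rintegral integral_indic// setIT.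
rewrite -[P _]fineK ?fin_num_measure// lee_fin PI//.
have [is1 is2] := Rintegral_sum (m := P) (F := fun tau => \1_(At tau))
  (shifts h L p) (fun tau => bdm_integrableT P (bi _ (mAt tau))).
apply: (@le_trans _ _ (\int[P]_w (2 / K%:R * \sum_(tau <- shifts h L p) \1_(At tau) w))).
  apply: le_Rintegral => //.
  - exact: bdm_integrableT (bi _ mG).
  - exact: (integrableZl measurableT (2 / K%:R) is1).
  move=> w _; rewrite indicE.
  have S0 : 0 <= \sum_(tau <- shifts h L p) \1_(At tau) w :> R by exact: sumr_ge0.
  case: (boolP (w \in _)) => [/set_mem[Gw nA]|_]; last first.
    by rewrite mulr_ge0// divr_ge0// ltW.
  rewrite mulrAC ler_pdivlMr// mul1r.
  have {}nA : combination (X := X) tU a w <= lv by rewrite leNgt; exact/negP.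
  rewrite combE ler_pdivrMr// nE natrM in nA.
  (* On positive paths a shift outside [At tau] contributes at least 2 lv m and any other at least
     0. The total is at most lv K m, so at most K/2 shifts lie outside. *)
  have h2 tau : tau \in shifts h L p ->
      2 * lv * m%:R * (1 - \1_(At tau) w) <= \sum_(j <- l) X (tau + tm j) w.
    move=> taus.
    have posj j : j \in C -> 0 < X (tau + j) w.
      by move=> jl; apply: Gw; apply/allpairsP; exists (tau, j).
    rewrite indicE; case: (boolP (w \in At tau)) => [_|nAt].
      rewrite subrr mulr0 big_seq sumr_ge0// => j jl.
      by rewrite ltW// posj// map_f.
    rewrite subr0 mulr1 leNgt; apply/negP => lt; move/negP: nAt; apply.
    by apply/mem_set; split => //=; exact: ltW.
  have h3 : \sum_(tau <- shifts h L p) (2 * lv * m%:R * (1 - \1_(At tau) w)) <=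
      \sum_(u <- U) X u w.
    rewrite /U /sumset big_allpairs_dep/= big_seq [leRHS]big_seq.
    by apply: ler_sum => tau taus; rewrite big_map; exact: h2.
  rewrite -mulr_sumr sumrB big_const_seq count_predT iter_addr_0 -/K in h3.
  have h4 := le_trans h3 nA.
  have lm0 : 0 < lv * m%:R by rewrite mulr_gt0.
  have : 2 * (K%:R - \sum_(tau <- shifts h L p) \1_(At tau) w) <= K%:R :> R.
    by rewrite -(ler_pM2l lm0); move: h4; congr (_ <= _); ring.
  by move: S0; lra.
rewrite RintegralZl// is2.
apply: (@le_trans _ _ (2 / K%:R * \sum_(tau <- shifts h L p) s ^+ m)).
  apply: ler_wpM2l; first by rewrite divr_ge0// ltW.
  rewrite big_seq [leRHS]big_seq; apply: ler_sum => tau taus.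
  by rewrite -PI// -lee_fin fineK ?fin_num_measure// PAt.
rewrite big_const_seq count_predT iter_addr_0 -/K -mulr_natr.
by rewrite le_eqVlt; apply/orP; left; apply/eqP; field; rewrite gt_eqF.
Qed.

End persistence_le.

End persistence.

(** * Test functions and rates *)

Section test_functions.
Context {R : realType}.

Definition admissible_test (lo lv beta s a0 : R) (cs : seq (R * R * R)) :=
  [/\ (0 < lv /\ 0 <= s), 0 <= beta /\ (forall t, t \in cs -> 0 < t.2),
    forall y, 0 <= bumps a0 cs y,
    forall y, 0 < y -> expR (beta * (1 - y / (2 * lv))) <= bumps a0 cs y &
    forall w y, lo <= w <= 1 -> bumps_avg a0 cs w y <= s].

Let avg_le1 (e w : R) : 0 < e -> 0 <= w -> 0 <= e / Num.sqrt (e ^+ 2 + w) <= 1.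
Proof.
move=> e0 w0; have p : 0 < e ^+ 2 + w by rewrite ltr_pwDl// exprn_gt0.
rewrite divr_ge0 ?sqrtr_ge0 ?(ltW e0)//= ler_pdivrMr ?sqrtr_gt0// mul1r.
by rewrite -[leLHS](gtr0_norm e0) -sqrtr_sqr ler_sqrt ?lerDl// ltW.
Qed.

(** With beta = 1: for y >= 2 lv t the exponential is at most e exp(-t), the constant term; for
    smaller y the factor exp(1/2) brings the bump of width 2 lv t above 1. A narrow bump has average
    at most width / sqrt(lo), so s is small when t is large and lv t small. *)
Lemma admissible_test_steep (lo lv t : R) : 0 < lo -> 0 < lv -> 0 < t ->
  admissible_test lo lv 1
    (expR 1 * expR (- t) + expR 2 * (2 * lv * t / Num.sqrt lo))
    (expR 1 * expR (- t)) [:: (expR 1 * expR (2^-1), 0, 2 * lv * t)].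
Proof.
move=> lo0 lv0 t0; set L := 2 * lv * t.
have L0 : 0 < L by rewrite !mulr_gt0.
have r0 : 0 < Num.sqrt lo by rewrite sqrtr_gt0.
split.
- split => //; rewrite addr_ge0// mulr_ge0 ?expR_ge0//.
  by rewrite divr_ge0 ?(ltW L0) ?(ltW r0).
- by split => // z; rewrite inE => /eqP->.
- by move=> y /=; rewrite addr_ge0// !mulr_ge0 ?expR_ge0.
- move=> y y0 /=; rewrite mul1r expRD -mulrA -mulrDr ler_wpM2l ?expR_ge0//.
  have [yL|yL] := leP L y.
    apply: (@le_trans _ _ (expR (- t))).
      by rewrite ler_expR lerN2 ler_pdivlMr ?mulr_gt0// mulrC.
    by rewrite lerDr mulr_ge0 ?expR_ge0.
  apply: (@le_trans _ _ 1).
    by rewrite expR_le1 oppr_le0 divr_ge0 ?mulr_ge0 ?(ltW lv0) ?(ltW y0).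
  apply: ler_wpDr; first exact: expR_ge0.
  rewrite /bump -expRD -[leLHS]expR0 ler_expR subr_ge0 subr0.
  rewrite ler_pdivrMr ?mulr_gt0 ?exprn_gt0// mulrA mulVf// mul1r.
  by rewrite ler_sqr ?nnegrE ?(ltW y0) ?(ltW L0)// ltW.
- move=> w y /andP[w0 _] /=.
  rewrite addrC lerD2l.
  have wp : 0 < w by exact: lt_le_trans w0.
  have p : 0 < L ^+ 2 + w by rewrite ltr_pwDl ?exprn_gt0// ltW.
  have e2 : expR 1 * expR (2^-1) <= expR 2 :> R.
    by rewrite -expRD ler_expR; lra.
  have q0 : 0 <= L / Num.sqrt (L ^+ 2 + w) by rewrite divr_ge0 ?sqrtr_ge0 ?(ltW L0).
  apply: (ler_pM (mulr_ge0 (expR_ge0 _) (expR_ge0 _)) (mulr_ge0 q0 (bump_ge0 _ _ _)) e2).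
  apply: (@le_trans _ _ (L / Num.sqrt (L ^+ 2 + w))).
    by rewrite ler_piMr ?bump_le1// divr_ge0 ?sqrtr_ge0 ?(ltW L0).
  rewrite ler_wpM2l ?(ltW L0)// lef_pV2 ?posrE ?sqrtr_gt0//.
  by rewrite ler_sqrt ?(ltW p)// (le_trans w0)// lerDr sqr_ge0.
Qed.

Let expR_le_quadratic (x : R) : 0 <= x <= 2^-1 -> expR x <= 1 + x + 2 * x ^+ 2.
Proof.
move=> /andP[x0 x1].
have h : 1 - x <= expR (- x) by have := expR_ge1Dx (- x).
rewrite -[leLHS]invrK -expRN.
have p : 0 < 1 - x by lra.
apply: (@le_trans _ _ (1 - x)^-1); first by rewrite lef_pV2 ?posrE ?expR_gt0.
rewrite -[leLHS]mul1r ler_pdivrMr//.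
have -> : (1 + x + 2 * x ^+ 2) * (1 - x) = 1 + x ^+ 2 * (1 - 2 * x) by ring.
by rewrite lerDl mulr_ge0 ?sqr_ge0//; lra.
Qed.

Let expRN_le_quadratic (x : R) : 0 <= x -> expR (- x) <= 1 - x + x ^+ 2.
Proof.
move=> x0; have p : 0 < 1 + x by lra.
rewrite expRN; apply: (@le_trans _ _ (1 + x)^-1).
  by rewrite lef_pV2 ?posrE ?expR_gt0// expR_ge1Dx.
rewrite -[leLHS]mul1r ler_pdivrMr//.
have -> : (1 - x + x ^+ 2) * (1 + x) = 1 + x ^+ 3 by ring.
by rewrite lerDl exprn_ge0.
Qed.

(* The bump to the left of 0 exploits positivity: it lowers the average
   whenever the conditional mean is at most of order lv, while on positive
   paths it costs no more than its value [leak] at 0. *)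
Lemma admissible_test_flat (lo lv : R) :
  let v := Num.sqrt lo in
  let eps := v / 20 in
  let beta := eps / 8 * expR (- (113 * (lv ^+ 2 / lo))) in
  let leak := 2^-1 * expR (- (200 * (lv ^+ 2 / lo))) in
  0 < lo -> 1 <= lv -> beta <= 64^-1 -> leak <= beta / 32 ->
  admissible_test lo lv beta (1 - beta / 8)
    (1 - beta / 4 + 2 * beta ^+ 2 + leak)
    [:: (2 * beta, 0, 4 * lv); (- 2^-1, - lv, eps)].
Proof.
move=> v eps beta leak lo0 lv1 beta64 leakb.
have lv0 : 0 < lv by lra.
have v0 : 0 < v by rewrite sqrtr_gt0.
have vE : v ^+ 2 = lo by rewrite sqr_sqrtr// ltW.
have eps0 : 0 < eps by rewrite divr_gt0.
have beta0 : 0 < beta by rewrite mulr_gt0 ?expR_gt0// divr_gt0.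
have leak0 : 0 <= leak by rewrite mulr_ge0 ?expR_ge0.
have b2 : 2 * beta ^+ 2 <= beta / 32.
  have : beta * beta <= beta * 64^-1 by rewrite ler_wpM2l// ltW.
  by rewrite -expr2; lra.
have sb := sqr_ge0 beta.
split.
- by split => //; lra.
- split; first exact: ltW.
  by move=> z; rewrite !inE => /orP[] /eqP->//=; rewrite mulr_gt0.
- move=> y /=; have := bump_ge0 0 (4 * lv) y; have := bump_le1 (- lv) eps y.
  move=> h1 h2; have := mulr_ge0 (ltW beta0) h2.
  by lra.
- move=> y y0 /=.
  have hl : 2^-1 * bump (- lv) eps y <= leak.
    rewrite ler_wpM2l// ler_expR lerN2 opprK.
    have -> : 200 * (lv ^+ 2 / lo) = lv ^+ 2 / (2 * eps ^+ 2).
      by rewrite -vE /eps; field; rewrite gt_eqF.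
    have q0 : 0 <= (2 * eps ^+ 2)^-1 by rewrite invr_ge0 mulr_ge0// sqr_ge0.
    rewrite ler_wpM2r//.
    by rewrite ler_sqr ?nnegrE ?addr_ge0 ?(ltW y0) ?(ltW lv0)// lerDr ltW.
  set u := y / (2 * lv).
  have u0 : 0 <= u by rewrite divr_ge0 ?(ltW y0)// mulr_ge0// ltW.
  suff : expR (beta * (1 - u)) <=
      1 - beta / 4 + 2 * beta ^+ 2 + 2 * beta * bump 0 (4 * lv) y by lra.
  have bE : bump 0 (4 * lv) y = expR (- (u ^+ 2 / 8)).
    by rewrite /bump /u; congr (expR (- _)); field; rewrite gt_eqF.
  (* Beyond 3/2 the exponential is at most exp(-beta/2), below 1 - beta/4 + 2 beta^2. Before 3/2 the
     wide bump is at least 1 - 9/32 = 23/32, and 2 beta 23/32 exceeds the 5 beta / 4 needed to reach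
     1 + beta. *)
  have [u1|u1] := leP (3 / 2) u.
    apply: (@le_trans _ _ (expR (- (beta / 2)))).
      by rewrite ler_expR; nra.
    have := @expRN_le_quadratic (beta / 2); rewrite divr_ge0 ?(ltW beta0)// => /(_ isT).
    have := mulr_ge0 (ltW beta0) (bump_ge0 0 (4 * lv) y).
    by nra.
  apply: (@le_trans _ _ (expR beta)).
    by rewrite ler_expR; nra.
  have := @expR_le_quadratic beta; rewrite (ltW beta0)/= => /(_ _).
  have -> : beta <= 2^-1 by lra.
  move=> /(_ isT) h.
  have h3 : 23 / 32 <= bump 0 (4 * lv) y.
    rewrite bE; apply: le_trans (expR_ge1Dx _).
    by nra.
  have := ler_wpM2l (ltW beta0) h3.
  by lra.
- move=> w y /andP[w0 w1] /=.
  have v1 : v <= 1 by rewrite -sqrtr1 ler_sqrt// (le_trans w0).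
  have wp : 0 <= w by rewrite (le_trans _ w0)// ltW.
  have lv4 : 0 < 4 * lv by rewrite mulr_gt0.
  set A1 := (4 * lv) / _; set B1 := bump 0 _ y.
  set A2 := eps / _; set B2 := bump (- lv) _ y.
  have /andP[a10 a11] : 0 <= A1 <= 1 by exact: avg_le1.
  have /andP[a20 a21] : 0 <= A2 <= 1 by exact: avg_le1.
  have b10 : 0 <= B1 by exact: bump_ge0.
  have b11 : B1 <= 1 by exact: bump_le1.
  have b20 : 0 <= B2 by exact: bump_ge0.
  have ab1 : A1 * B1 <= B1 by rewrite ler_piMl.
  (* For a conditional mean beyond 14 lv the wide bump averages at most exp(-5) <= 1/32, because 196
     lv^2 >= 10 (16 lv^2 + w) when w <= 1 <= lv; the errors then sum to beta / 8. For smaller means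
     the negative bump must cancel the wide one. *)
  have [yl|yl] := leP (14 * lv) `|y|.
    have hB1 : B1 <= 32^-1.
      apply: (@le_trans _ _ (expR (- 5))).
        rewrite /B1 /bump ler_expR lerN2 subr0 sqr_sqrtr; last first.
          by rewrite addr_ge0// sqr_ge0.
        have y2 : (14 * lv) ^+ 2 <= y ^+ 2.
          rewrite -[y ^+ 2](real_normK (num_real y)).
          by rewrite ler_sqr ?nnegrE// mulr_ge0// ltW.
        rewrite ler_pdivlMr; last by rewrite mulr_gt0// ltr_pwDl// exprn_gt0.
        by nra.
      rewrite expRN lef_pV2 ?posrE ?expR_gt0//.
      have -> : 5 = 1 *+ 5 :> R by rewrite -[RHS]mulr_natl mulr1.
      rewrite -mulr_natl mulr1 -[5]mulr1 mulrC expRM_natr.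
      have e2 : 2 <= expR 1 :> R by apply: le_trans (expR_ge1Dx _); lra.
      apply: (@le_trans _ _ (2 ^+ 5)); first by rewrite -natrX.
      by rewrite lerXn2r// nnegrE.
    have := mulr_ge0 a20 b20.
    have : 2 * beta * (A1 * B1) <= 2 * beta * 32^-1.
      by rewrite ler_wpM2l ?(le_trans ab1)// mulr_ge0// ltW.
    by lra.
  have hA2 : eps / 2 <= A2.
    rewrite /A2 ler_wpM2l ?(ltW eps0)// lef_pV2 ?posrE ?sqrtr_gt0//; last first.
      by rewrite ltr_pwDl// exprn_gt0.
    have -> : 2 = Num.sqrt (2 ^+ 2) :> R by rewrite sqrtr_sqr ger0_norm.
    by rewrite ler_sqrt ?exprn_ge0//; rewrite /eps; nra.
  (* The distance from y to -lv is at most 15 lv and 15^2 / 2 < 113. Together with [hA2] this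
     explains [beta]: half the averaged negative bump is at least eps / 4 times this exponential,
     that is 2 beta. *)
  have hB2 : expR (- (113 * (lv ^+ 2 / lo))) <= B2.
    rewrite /B2 /bump ler_expR lerN2 opprK sqr_sqrtr; last first.
      by rewrite addr_ge0// sqr_ge0.
    have y2 : (y + lv) ^+ 2 <= (15 * lv) ^+ 2.
      rewrite -[(y + lv) ^+ 2](real_normK (num_real _)).
      rewrite ler_sqr ?nnegrE//; last by rewrite mulr_ge0// ltW.
      apply: (le_trans (ler_normD _ _)); rewrite (gtr0_norm lv0).
      by lra.
    have q0 : 0 < 2 * (eps ^+ 2 + w) by rewrite mulr_gt0// ltr_pwDl// exprn_gt0.
    rewrite ler_pdivrMr//; apply: (le_trans y2).
    have low : lo <= eps ^+ 2 + w by rewrite (le_trans w0)// lerDr sqr_ge0.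
    have -> : (15 * lv) ^+ 2 = 113 * (lv ^+ 2 / lo) * (2 * lo) - lv ^+ 2.
      by field; rewrite gt_eqF.
    apply: (@le_trans _ _ (113 * (lv ^+ 2 / lo) * (2 * lo))).
      by rewrite gerBl sqr_ge0.
    rewrite ler_wpM2l; first by [].
      by rewrite mulr_ge0// divr_ge0 ?sqr_ge0// ltW.
    by rewrite ler_wpM2l.
  have h2b : 2 * beta <= 2^-1 * (A2 * B2).
    have := ler_pM (divr_ge0 (ltW eps0) (ler0n R 2)) (expR_ge0 _) hA2 hB2.
    rewrite /beta; lra.
  have : 2 * beta * (A1 * B1) <= 2 * beta.
    rewrite ler_piMr ?(le_trans ab1)// mulr_ge0// ltW//.
  by lra.
Qed.

End test_functions.

(** * Logarithms against powers *)

Section growth.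
Context {R : realType}.
Implicit Types K a : R.

Lemma near_le_ln K : \forall N \near +oo, K <= ln (N : R).
Proof.
near=> N; have h : expR K <= N by near: N; exact: nbhs_pinfty_ge.
have N0 : 0 < N by apply: lt_le_trans h; exact: expR_gt0.
by rewrite -ler_expR lnK.
Unshelve. all: by end_near. Qed.

(** N^a is the square of exp(a ln N / 2), hence at least quadratic in ln N. *)
Lemma near_mul_ln_le K a : 0 < a -> \forall N \near +oo, K * ln N <= (N : R) `^ a.
Proof.
move=> a0; near=> N.
have N0 : 0 < N by near: N; exact: nbhs_pinfty_gt.
have x0 : 0 <= ln N by near: N; exact: near_le_ln.
have x1 : 4 * K / a ^+ 2 <= ln N by near: N; exact: near_le_ln.
rewrite /powR gt_eqF// -[a * ln N](divfK (lt0r_neq0 (ltr0n R 2)))//.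
rewrite expRM_natr.
have h : a * ln N / 2 <= expR (a * ln N / 2).
  by apply: le_trans (expR_ge1Dx _); rewrite lerDr.
apply: (@le_trans _ _ ((a * ln N / 2) ^+ 2)); last first.
  by rewrite lerXn2r ?nnegrE ?expR_ge0// divr_ge0// mulr_ge0// ltW.
have a20 : 0 < a ^+ 2 by rewrite exprn_gt0.
have -> : (a * ln N / 2) ^+ 2 = (a ^+ 2 / 4 * ln N) * ln N by field.
rewrite ler_wpM2r//.
move: x1; rewrite ler_pdivrMr//; lra.
Unshelve. all: by end_near. Qed.

Lemma near_le_powR K a : 0 < a -> \forall N \near +oo, K <= (N : R) `^ a.
Proof.
move=> a0; near=> N.
have x1 : 1 <= ln N by near: N; exact: near_le_ln.
have h : `|K| * ln N <= N `^ a by near: N; exact: near_mul_ln_le.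
by apply: le_trans h; rewrite (le_trans (ler_norm K))// ler_peMr.
Unshelve. all: by end_near. Qed.

End growth.

(** * Choice of parameters for the three rates *)

Section rates.
Context {R : realType}.

Definition test_bound (b gamma nu e N y : R) :=
  exists (p m : nat) (lv beta s a0 : R) (cs : seq (R * R * R)),
  [/\ ((0 < p)%N /\ gamma + 1 <= (2 * p)%:R) /\ 4 * p%:R <= N,
    (0 < m)%N /\ m%:R <= N * e / (16 * pi),
    admissible_test (nu * (e / 2)) lv beta s a0 cs &
    expR (- (lv ^+ 2 / (2 * (variance_cst b gamma p * N `^ (- gamma))))) +
      2 * s ^+ m <= expR (- y)].

(** Takes m as the integer part of N e / (16 pi), at least half of it for N large. Both terms are
    asked to decay at the doubled rate 2 y, since 3 exp(-2y) <= exp(-y) once y >= 2 removes the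
    prefactors. *)
Lemma test_boundP (b gamma nu e N y z : R) (p : nat) lv beta s a0 cs :
  0 < b -> 0 < gamma -> 0 < e ->
  (0 < p)%N -> gamma + 1 <= (2 * p)%:R -> 4 * p%:R <= N ->
  32 * pi / e <= N ->
  admissible_test (nu * (e / 2)) lv beta s a0 cs ->
  0 <= z -> s <= expR (- z) -> 2 <= y ->
  2 * y <= lv ^+ 2 * N `^ gamma / (2 * variance_cst b gamma p) ->
  2 * y <= N * e / (32 * pi) * z ->
  test_bound b gamma nu e N y.
Proof.
move=> b0 g0 e0 p0 gp pN Ne adm z0 sz y2 h1 h2.
have pi0 : 0 < pi :> R := pi_gt0 R.
have p32 : 0 < 32 * pi :> R by rewrite mulr_gt0.
have p16 : 0 < 16 * pi :> R by rewrite mulr_gt0.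
have N0 : 0 < N by apply: lt_le_trans Ne; rewrite divr_gt0.
have V0 : 0 < variance_cst b gamma p.
  by rewrite /variance_cst !mulr_gt0 ?exprn_gt0 ?powR_gt0 ?mulr_gt0 ?ltr0n.
set T := N * e / (32 * pi).
have T1 : 1 <= T by rewrite /T ler_pdivlMr// mul1r -ler_pdivrMr.
have T16 : N * e / (16 * pi) = 2 * T.
  by rewrite /T; move: pi0; generalize (pi : R) => q q0; field; rewrite gt_eqF.
have T20 : 0 <= 2 * T by lra.
have /andP[t1 t2] := truncn_itv T20.
set m := Num.truncn (2 * T) in t1 t2 *.
have mT : T <= m%:R by move: t2; rewrite -natr1; lra.
have m0 : (0 < m)%N by rewrite -(ltr_nat R); lra.
exists p, m, lv, beta, s, a0, cs; split => //; first by rewrite T16.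
have s0 : 0 <= s by case: adm => -[].
have -> : lv ^+ 2 / (2 * (variance_cst b gamma p * N `^ (- gamma))) =
    lv ^+ 2 * N `^ gamma / (2 * variance_cst b gamma p).
  by rewrite powRN; field; rewrite !gt_eqF// powR_gt0.
have k1 : expR (- (lv ^+ 2 * N `^ gamma / (2 * variance_cst b gamma p))) <=
    expR (- (2 * y)) by rewrite ler_expR lerN2.
have k2 : s ^+ m <= expR (- (2 * y)).
  apply: (@le_trans _ _ (expR (- z) ^+ m)).
    by rewrite lerXn2r// nnegrE expR_ge0.
  rewrite -expRM_natr ler_expR mulNr lerN2 (le_trans h2)// mulrC ler_wpM2l//.
have k3 : 3 * expR (- (2 * y)) <= expR (- y).
  have -> : - (2 * y) = - y - y by ring.
  rewrite expRD mulrCA ler_piMr ?expR_ge0// expRN ler_pdivrMr ?expR_gt0// mul1r.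
  by apply: le_trans (expR_ge1Dx _); lra.
by lra.
Qed.

Lemma near_test_size (gamma : R) : 0 < gamma ->
  exists p, [/\ (0 < p)%N, gamma + 1 <= (2 * p)%:R & forall e : R,
    \forall N \near +oo, 4 * p%:R <= N /\ 32 * pi / e <= N].
Proof.
move=> g0; have g1 : 0 <= gamma + 1 by lra.
have /andP[_ h] := truncn_itv g1.
exists (Num.truncn (gamma + 1)).+1; split => // [|e].
  by rewrite natrM (le_trans (ltW h))// ler_peMl// ler1n.
by near=> N; split; near: N; exact: (nbhs_pinfty_ge (num_real _)).
Unshelve. all: by end_near. Qed.

Lemma test_bound_eq1 (b nu : R) : 0 < b -> 0 < nu ->
  exists2 c, 0 < c & forall e, 0 < e ->
    \forall N \near +oo, test_bound b 1 nu e N (c * e * N).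
Proof.
move=> b0 nu0; have [p [p0 gp nr]] := near_test_size ltr01.
have pi0 : 0 < pi :> R := pi_gt0 R.
pose C1 := variance_cst b 1 p.
have V0 : 0 < C1.
  by rewrite /C1 /variance_cst !mulr_gt0 ?exprn_gt0 ?powR_gt0 ?mulr_gt0 ?ltr0n.
have c10 : 0 < nu * expR (- 8) / (288 * C1).
  by rewrite divr_gt0// mulr_gt0 ?expR_gt0 ?ltr0n.
have c20 : 0 < (64 * pi)^-1 :> R by rewrite invr_gt0 mulr_gt0 ?ltr0n.
pose c := Num.min (nu * expR (- 8) / (288 * C1)) (64 * pi)^-1.
have c0 : 0 < c by rewrite lt_min c10.
have c1 : c <= nu * expR (- 8) / (288 * C1) by rewrite ge_min lexx.
have c2 : c <= (64 * pi)^-1 by rewrite ge_min lexx orbT.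
exists c => // e e0; have {}nr := nr e.
set lo := nu * (e / 2).
have lo0 : 0 < lo by rewrite mulr_gt0// divr_gt0.
have v0 : 0 < Num.sqrt lo by rewrite sqrtr_gt0.
near=> N; have [pN eN] : 4 * p%:R <= N /\ 32 * pi / e <= N by near: N.
have N0 : 0 < N by near: N; exact: nbhs_pinfty_gt.
have N2 : 2 / (c * e) <= N by near: N; exact: (nbhs_pinfty_ge (num_real _)).
(* With t = 3 the bump width over sqrt(lo) is exp(-4), so s is 2 exp(-2), at most exp(-1). As lv^2
   is proportional to lo = nu e / 2, the Gaussian exponent is linear in e. *)
pose lv := Num.sqrt lo * expR (- 4) / 6.
have lv0 : 0 < lv by rewrite divr_gt0 ?mulr_gt0 ?expR_gt0.
apply: (test_boundP b0 ltr01 e0 p0 gp pN eN (admissible_test_steep lo0 lv0 (ltr0n R 3)) ler01).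
- have -> : 2 * lv * 3 / Num.sqrt lo = expR (- 4) by rewrite /lv; field; rewrite gt_eqF.
  rewrite -!expRD (_ : 1 + - 3 = - 2 :> R); last by ring.
  rewrite (_ : 2 + - 4 = - 2 :> R); last by ring.
  rewrite (_ : - 2 = - 1 - 1 :> R); last by ring.
  rewrite expRD -mulrDr ler_piMr ?expR_ge0// expRN -mulr2n -mulr_natr.
  rewrite mulrC ler_pdivrMr ?expR_gt0// mul1r.
  by apply: le_trans (expR_ge1Dx _); lra.
- by rewrite mulrC -ler_pdivrMr// mulr_gt0.
- rewrite powRr1 ?(ltW N0)// -/C1.
  have -> : lv ^+ 2 * N / (2 * C1) = 2 * (nu * expR (- 8) / (288 * C1) * e * N).
    have -> : - 8 = - 4 * 2%:R :> R by ring.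
    rewrite expRM_natr /lv !exprMn sqr_sqrtr ?(ltW lo0)// /lo.
    by field; rewrite gt_eqF.
  by rewrite ler_wpM2l// !ler_wpM2r ?(ltW e0) ?(ltW N0).
- rewrite mulr1.
  have -> : N * e / (32 * pi) = 2 * ((64 * pi)^-1 * e * N).
    by move: pi0; generalize (pi : R) => q q0; field; rewrite gt_eqF.
  by rewrite ler_wpM2l// !ler_wpM2r ?(ltW e0) ?(ltW N0).
Unshelve. all: by end_near. Qed.

Lemma test_bound_gt1 (b gamma nu : R) : 0 < b -> 1 < gamma -> 0 < nu ->
  exists2 c, 0 < c & forall e, 0 < e ->
    \forall N \near +oo, test_bound b gamma nu e N (c * e * (N * ln N)).
Proof.
move=> b0 g1 nu0; have g0 : 0 < gamma by lra.
have [p [p0 gp nr]] := near_test_size g0.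
have pi0 : 0 < pi :> R := pi_gt0 R.
pose C1 := variance_cst b gamma p.
have V0 : 0 < C1.
  by rewrite /C1 /variance_cst !mulr_gt0 ?exprn_gt0 ?powR_gt0 ?mulr_gt0 ?ltr0n.
(* With lv = N^(-a) the Gaussian exponent has order N^(gamma - 2a) = N^(1 + 2a), above N ln N; t =
   (a/2) ln N gives s <= N^(-a/4), hence a factor ln N per selected time. *)
pose a := (gamma - 1) / 4.
have a0 : 0 < a by rewrite divr_gt0// subr_gt0.
pose c := a / (256 * pi).
have c0 : 0 < c by rewrite (divr_gt0 a0)// mulr_gt0 ?ltr0n.
exists c => // e e0; have {}nr := nr e.
set lo := nu * (e / 2).
have lo0 : 0 < lo by rewrite mulr_gt0// divr_gt0.
have v0 : 0 < Num.sqrt lo by rewrite sqrtr_gt0.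
near=> N; have [pN eN] : 4 * p%:R <= N /\ 32 * pi / e <= N by near: N.
have N0 : 0 < N by near: N; exact: nbhs_pinfty_gt.
have N2 : 2 / (c * e) <= N by near: N; exact: (nbhs_pinfty_ge (num_real _)).
have l1 : 1 <= ln N by near: N; exact: near_le_ln.
have l0 : 0 < ln N by lra.
have q1 : 2 * expR 1 <= N `^ (a / 4).
  by near: N; apply: near_le_powR; rewrite divr_gt0.
have q2 : 2 * expR 2 * a / Num.sqrt lo * ln N <= N `^ (3 * a / 4).
  by near: N; apply: near_mul_ln_le; rewrite divr_gt0// mulr_gt0.
have q3 : 4 * c * e * C1 * ln N <= N `^ (2 * a).
  by near: N; apply: near_mul_ln_le; rewrite mulr_gt0.
have pw u : 0 < N `^ u by exact: powR_gt0.
have pD u w : N `^ (u + w) = N `^ u * N `^ w by rewrite powRD// (gt_eqF N0) implybT.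
pose lv := N `^ (- a).
have lv0 : 0 < lv by exact: pw.
have t0 : 0 < a / 2 * ln N by rewrite mulr_gt0// divr_gt0.
have z0 : 0 <= a / 4 * ln N by rewrite mulr_ge0 ?(ltW l0)// divr_ge0// ltW.
have pE u : expR (- (u * ln N)) = N `^ (- u).
  by rewrite /powR gt_eqF// mulNr.
apply: (test_boundP b0 g0 e0 p0 gp pN eN (admissible_test_steep lo0 lv0 t0) z0).
- rewrite !pE.
  have r1 : expR 1 * N `^ (- (a / 2)) <= N `^ (- (a / 4)) / 2.
    have -> : - (a / 2) = - (a / 4) - a / 4 by field.
    rewrite pD mulrCA ler_wpM2l ?(ltW (pw _))// powRN.
    by rewrite ler_pdivrMr//; lra.
  have r2 : expR 2 * (2 * lv * (a / 2 * ln N) / Num.sqrt lo) <= N `^ (- (a / 4)) / 2.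
    rewrite /lv (_ : - a = - (a / 4) - 3 * a / 4); last by field.
    rewrite pD [N `^ (- (3 * a / 4))]powRN.
    have -> : expR 2 * (2 * (N `^ (- (a / 4)) / N `^ (3 * a / 4)) * (a / 2 * ln N) / Num.sqrt lo)
        = N `^ (- (a / 4)) / 2 * ((2 * expR 2 * a / Num.sqrt lo * ln N) / N `^ (3 * a / 4)).
      by field; rewrite !gt_eqF.
    rewrite ler_piMr// ?divr_ge0 ?(ltW (pw _))//.
    by rewrite ler_pdivrMr ?mul1r.
  by lra.
- rewrite mulrA; apply: (@le_trans _ _ (c * e * N)).
    by rewrite mulrC -ler_pdivrMr// mulr_gt0.
  exact: (ler_peMr (ltW (mulr_gt0 (mulr_gt0 c0 e0) N0)) l1).
- have V2 : 0 < 2 * C1 by rewrite mulr_gt0.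
  rewrite -/C1 ler_pdivlMr//.
  have -> : lv ^+ 2 * N `^ gamma = N * N `^ (2 * a).
    rewrite -[X in X * N `^ (2 * a)]powRr1 ?(ltW N0)// -pD expr2 /lv -!pD.
    by congr (_ `^ _); rewrite /a; field.
  have -> : 2 * (c * e * (N * ln N)) * (2 * C1) = N * (4 * c * e * C1 * ln N) by ring.
  by rewrite ler_wpM2l ?(ltW N0).
- rewrite /c le_eqVlt; apply/orP; left; apply/eqP.
  by move: pi0; generalize (pi : R) => q q0; field; rewrite gt_eqF.
Unshelve. all: by end_near. Qed.

Lemma test_bound_lt1 (b gamma nu : R) : 0 < b -> 0 < gamma < 1 -> 0 < nu ->
  exists2 c, 0 < c & forall e, 0 < e ->
    \forall N \near +oo, test_bound b gamma nu e N (c * e * (N `^ gamma * ln N)).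
Proof.
move=> b0 /andP[g0 g1] nu0.
have [p [p0 gp nr]] := near_test_size g0.
have pi0 : 0 < pi :> R := pi_gt0 R.
pose C1 := variance_cst b gamma p.
have V0 : 0 < C1.
  by rewrite /C1 /variance_cst !mulr_gt0 ?exprn_gt0 ?powR_gt0 ?mulr_gt0 ?ltr0n.
(* With lv^2 = 2 k lo ln N the constants 113 and 200 of the flat test become the powers 226 k and
   400 k. Since 1 - gamma = 452 k, one power 226 k pays for the size of [beta] and the other absorbs
   ln N. *)
pose k := (1 - gamma) / 452.
have k0 : 0 < k by rewrite divr_gt0 ?subr_gt0 ?ltr0n.
pose c := k * nu / (4 * C1).
have c0 : 0 < c by rewrite (divr_gt0 (mulr_gt0 k0 nu0))// mulr_gt0 ?ltr0n.
exists c => // e e0; have {}nr := nr e.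
set lo := nu * (e / 2).
have lo0 : 0 < lo by rewrite mulr_gt0// divr_gt0.
have v0 : 0 < Num.sqrt lo by rewrite sqrtr_gt0.
set v := Num.sqrt lo in v0.
have pk u : 0 < u -> 0 < u * k by move=> u0; rewrite mulr_gt0.
have [K KE] : exists K : R, K = 160 * 256 by exists (160 * 256).
have K0 : 0 < K by rewrite KE mulr_gt0 ?ltr0n.
near=> N; have [pN eN] : 4 * p%:R <= N /\ 32 * pi / e <= N by near: N.
have N0 : 0 < N by near: N; exact: nbhs_pinfty_gt.
have N2 : 2 / (c * e) <= N `^ gamma by near: N; exact: near_le_powR.
have l1 : 1 <= ln N by near: N; exact: near_le_ln.
have l2 : (2 * k * lo)^-1 <= ln N by near: N; exact: near_le_ln.
have l0 : 0 < ln N by lra.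
have q1 : v / 20 / 8 * 64 <= N `^ (226 * k) by near: N; apply: near_le_powR; apply: pk; rewrite ltr0n.
have q2 : 2560 / v <= N `^ (174 * k) by near: N; apply: near_le_powR; apply: pk; rewrite ltr0n.
have q3 : 2 * c * K * pi / v * ln N <= N `^ (226 * k).
  by near: N; apply: near_mul_ln_le; apply: pk; rewrite ltr0n.
have pw u : 0 < N `^ u by exact: powR_gt0.
have pD u w : N `^ (u + w) = N `^ u * N `^ w by rewrite powRD// (gt_eqF N0) implybT.
pose lv := Num.sqrt (2 * k * lo * ln N).
have l3 : 1 <= 2 * k * lo * ln N.
  have kl : 0 < 2 * k * lo := mulr_gt0 (mulr_gt0 (ltr0n R 2) k0) lo0.
  by rewrite -ler_pdivrMl// mulr1.
have lvE : lv ^+ 2 = 2 * k * lo * ln N by rewrite sqr_sqrtr// (le_trans _ l3).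
have lv1 : 1 <= lv by rewrite -sqrtr1 ler_sqrt// (le_trans _ l3).
have lvlo : lv ^+ 2 / lo = 2 * k * ln N by rewrite lvE; field; rewrite gt_eqF.
have E1 : expR (- (113 * (lv ^+ 2 / lo))) = N `^ (- (226 * k)).
  by rewrite lvlo /powR gt_eqF//; congr expR; ring.
have E2 : expR (- (200 * (lv ^+ 2 / lo))) = N `^ (- (226 * k)) / N `^ (174 * k).
  rewrite lvlo -powRN -pD /powR gt_eqF//.
  by congr expR; ring.
have := @admissible_test_flat R lo lv; rewrite -/v E1 E2; cbv zeta.
set beta := v / 20 / 8 * N `^ (- (226 * k)).
have b1 : beta <= 64^-1.
  rewrite /beta powRN ler_pdivrMr; [lra|exact: pw].
have b2 : 0 < beta by rewrite !mulr_gt0.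
have lkb : 2^-1 * (N `^ (- (226 * k)) / N `^ (174 * k)) <= beta / 32.
  have -> : beta / 32 = 2^-1 * N `^ (- (226 * k)) * (v / 2560) by rewrite /beta; field.
  rewrite mulrA ler_wpM2l ?mulr_ge0 ?(ltW (pw _))//.
  by rewrite -[v / 2560]invf_div lef_pV2 ?posrE ?divr_gt0 ?ltr0n.
move=> /(_ lo0 lv1 b1 lkb) adm.
have z0 : 0 <= beta / 8 by rewrite divr_ge0// ltW.
apply: (test_boundP b0 g0 e0 p0 gp pN eN adm z0).
- by have := expR_ge1Dx (- (beta / 8)).
- rewrite mulrA; apply: (@le_trans _ _ (c * e * N `^ gamma)).
    by rewrite mulrC -ler_pdivrMr// mulr_gt0.
  exact: (ler_peMr (ltW (mulr_gt0 (mulr_gt0 c0 e0) (pw _))) l1).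
- rewrite -/C1 lvE /c /lo le_eqVlt; apply/orP; left; apply/eqP.
  by field; rewrite gt_eqF.
- have NE : N = N `^ gamma * (N `^ (226 * k) * N `^ (226 * k)).
    rewrite -!pD -[LHS]powRr1 ?(ltW N0)//; congr (_ `^ _).
    by rewrite /k; field.
  have -> : N * e / (32 * pi) * (beta / 8) =
      N `^ gamma * (e * (v / (K * pi)) * N `^ (226 * k)).
    rewrite [N in LHS]NE /beta powRN KE.
    by move: pi0; generalize (pi : R) => q q0; field; rewrite !gt_eqF.
  rewrite (_ : 2 * _ = N `^ gamma * (2 * c * e * ln N)); last by ring.
  rewrite ler_wpM2l ?(ltW (pw _))//.
  rewrite (_ : 2 * c * e * ln N = e * (v / (K * pi)) * (2 * c * K * pi / v * ln N)).
    have w0 := divr_ge0 (ltW v0) (mulr_ge0 (ltW K0) (ltW pi0)).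
    by rewrite ler_wpM2l// mulr_ge0 ?(ltW e0).
  by rewrite KE; move: pi0; generalize (pi : R) => q q0; field; rewrite !gt_eqF.
Unshelve. all: by end_near. Qed.

(** The order of quantifiers carries the linearity: c precedes e, and only the threshold depends on
    e, which stands for |E|. *)
Lemma test_bound_rate (b gamma nu : R) : 0 < b -> 0 < gamma -> 0 < nu ->
  exists2 c, 0 < c & forall e, 0 < e -> exists2 N0, 0 < N0 &
    forall N, N0 < N -> test_bound b gamma nu e N (c * e * persistence_rate gamma N).
Proof.
move=> b0 g0 nu0.
suff [c c0 h] : exists2 c, 0 < c & forall e, 0 < e ->
    \forall N \near +oo, test_bound b gamma nu e N (c * e * persistence_rate gamma N).
  exists c => // e /h[M [_ hM]]; exists (Num.max M 1); first by rewrite lt_max ltr01 orbT.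
  by move=> N; rewrite gt_max => /andP[MN _]; exact: hM.
rewrite /persistence_rate; case: ltgtP => [g1|g1|->].
- by apply: test_bound_lt1 => //; rewrite g0.
- exact: test_bound_gt1.
- exact: test_bound_eq1.
Qed.

End rates.

(** * Existence of E and nu *)

Section ac_component.
Context {R : realType}.
Implicit Types (rho : {finite_measure set (measurableTypeR R) -> \bar R})
  (rho_ac : {measure set (measurableTypeR R) -> \bar R}).

(** The sets where the density is at least 1/(n+1), cut to [-n, n], exhaust the set where it is
    positive; if all were Lebesgue null, rho_ac would vanish. *)
Lemma ac_lower_bound_exists rho rho_ac :
  is_ac_component rho rho_ac -> rho_ac setT <> 0%E ->
  exists E nu, ac_lower_bound rho_ac E nu.
Proof.
move=> [dom [rho_s [_ rhoE]]] nz.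
have le_rho A : measurable A -> (rho_ac A <= rho A)%E.
  by move=> mA; rewrite rhoE// leeDl.
have fin : (rho_ac setT < +oo)%E.
  by apply: le_lt_trans (le_rho _ measurableT) _; rewrite ltey_eq fin_num_measure.
(* Restriction to the whole line only records finiteness, inherited from rho, in the form expected
   by the Radon-Nikodym theorem. *)
pose mu := mfrestr (measurableT : measurable [set: measurableTypeR R]) fin.
have muE A : mu A = rho_ac A by rewrite /mu /mfrestr /mrestr setIT.
have domm : mu `<< (@lebesgue_measure R).
  by apply/null_content_dominatesP => A mA A0; rewrite muE dom.
have [f [f0 ffin fi fE]] := radon_nikodym_sigma_finite domm.
have {}fE A : measurable A -> rho_ac A = (\int[lebesgue_measure]_(x in A) f x)%E.
  by move=> mA; rewrite -muE; exact: fE.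
have mf : measurable_fun setT f := measurable_int _ fi.
pose E n := [set x | ((n.+1%:R^-1)%:E <= f x)%E] `&` `[- n%:R, n%:R]%classic
   : set (measurableTypeR R).
have mE n : measurable (E n).
  apply: measurableI; last exact: measurable_itv.
  by rewrite -[X in measurable X]setTI; exact: emeasurable_fun_c_infty.
have [n En] : exists n, lebesgue_measure (E n) <> 0%E.
  apply/existsNP => E0; apply: nz.
  pose Z := [set x | f x = 0%E] : set (measurableTypeR R).
  have mZ : measurable Z.
    rewrite -[X in measurable X]setTI; exact: (mf measurableT _ (emeasurable_set1 0%E)).
  have rZ : rho_ac Z = 0%E.
    rewrite fE// -[RHS](integral0 lebesgue_measure Z).
    by apply: eq_integral => x /set_mem.
  have : rho_ac.-negligible (Z `|` \bigcup_n E n).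
    apply: negligibleU; last apply: negligible_bigcup => n.
      exact/negligibleP.
    by apply/negligibleP => //; exact: (dom _ (mE n) (E0 n)).
  suff -> : Z `|` \bigcup_n E n = setT by move=> /negligibleP->//.
  apply/seteqP; split => // x _.
  have [fx0|fx0] := eqVneq (f x) 0%E; [by left|right].
  have fxp : 0 < fine (f x).
    by rewrite -lte_fin fineK// lt0e fx0 f0.
  have fi0 : 0 <= (fine (f x))^-1 by rewrite invr_ge0 ltW.
  pose n := (Num.truncn (fine (f x))^-1 + Num.truncn `|x|).+1%N.
  have h1 : (fine (f x))^-1 <= n.+1%:R.
    have /andP[_ h] := truncn_itv fi0; apply: (le_trans (ltW h)).
    by rewrite ler_nat ltnS leqW// leq_addr.
  have h2 : `|x| <= n%:R.
    have /andP[_ h] := truncn_itv (normr_ge0 x); apply: (le_trans (ltW h)).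
    by rewrite ler_nat ltnS leq_addl.
  exists n => //; split => /=; last by rewrite in_itv/= -ler_norml.
  by rewrite -(fineK (ffin x)) lee_fin -[leRHS]invrK lef_pV2 ?posrE ?invr_gt0.
exists (E n), (n.+1%:R^-1); split => //.
- exists n%:R; split => // M nM x [_ /=]; rewrite in_itv/= -ler_norml => h.
  exact: le_trans h (ltW nM).
- by rewrite lt0e; apply/andP; split; [exact/eqP|].
- move=> A mA AE; rewrite fE// -integral_cst//.
  apply: ge0_le_integral => //.
  + by move=> x _; rewrite lee_fin.
  + exact: measurable_funS mf.
  + by move=> x /AE[].
Qed.
End ac_component.

(** * Uniform choice of the constants and conclusion *)

Unset Implicit Arguments.

Theorem proposition3 (R : realType) (eps : R) (eps_gt0 : 0 < eps) :
  exists (c : R -> R -> \bar R -> \bar R -> R -> R)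
         (N0 : R -> R -> \bar R -> \bar R -> R -> set R -> R),
  forall (T : time) (d : measure_display) (Omega : measurableType d)
    (P : probability Omega R) (X : R -> {RV P >-> R})
    (rho : {finite_measure set (measurableTypeR R) -> \bar R})
    (rho_ac : {measure set (measurableTypeR R) -> \bar R})
    (delta b gamma : R) (k : nat) (s : R),
  is_GSP T X ->
  is_spectral_measure T X rho ->
  moment T rho 0 = 1%E ->
  0 < delta -> (moment T rho delta < +oo)%E ->
  is_ac_component rho rho_ac ->
  rho_ac setT <> 0%E ->
  0 < b -> 0 < gamma ->
  (forall N : R, 0 < N -> (rho `[0%R, (N^-1)%R]%classic <= (b * N `^ (- gamma))%:E)%E) ->
  gamma = 2 * k%:R + s -> 0 <= s < 2 ->
  (exists (E : set R) (nu : R), ac_lower_bound rho_ac E nu) /\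
  (forall (E : set R) (nu : R), ac_lower_bound rho_ac E nu ->
    let m1 := moment T rho (- gamma + eps) in
    let m2 := moment T rho (- (2 * k%:R)) in
    let N_0 := N0 b gamma m1 m2 nu E in
    let C := c b gamma m1 m2 nu * fine (lebesgue_measure E) in
    [/\ 0 < N_0, 0 < C &
        forall N : R, N_0 < N ->
          (lne (persistence T X N) <= (- C * persistence_rate gamma N)%:E)%E]).
Proof.
(* The constants must be functions chosen before the process, so they are selected for all parameter
   tuples at once, with the default 0 where positivity fails. The threshold [M] sees E through its
   measure alone. *)
have /choice[c0 c0P] (q : R * R * R) : exists c,
    0 < q.1.1 -> 0 < q.1.2 -> 0 < q.2 -> 0 < c /\ forall e, 0 < e ->
      exists2 N0, 0 < N0 & forall N, N0 < N ->
        test_bound q.1.1 q.1.2 q.2 e N (c * e * persistence_rate q.1.2 N).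
  case: q => -[b g] n /=.
  have [b0|b0] := ltP 0 b; last by exists 0.
  have [g0|g0] := ltP 0 g; last by exists 0.
  have [n0|n0] := ltP 0 n; last by exists 0.
  by have [c c0 h] := test_bound_rate b0 g0 n0; exists c.
have /choice[M MP] (q : R * R * R * R) : exists M,
    0 < q.1.1.1 -> 0 < q.1.1.2 -> 0 < q.1.2 -> 0 < q.2 ->
    0 < M /\ forall N, M < N -> test_bound q.1.1.1 q.1.1.2 q.1.2 q.2 N
      (c0 q.1 * q.2 * persistence_rate q.1.1.2 N).
  case: q => -[[b g] n] e /=.
  have [b0|b0] := ltP 0 b; last by exists 0.
  have [g0|g0] := ltP 0 g; last by exists 0.
  have [n0|n0] := ltP 0 n; last by exists 0.
  have [e0|e0] := ltP 0 e; last by exists 0.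
  by have [_ /(_ e e0)[N0 ? ?]] := c0P (b, g, n) b0 g0 n0; exists N0.
exists (fun b g _ _ n => c0 (b, g, n)),
  (fun b g _ _ n E => M (b, g, n, fine (lebesgue_measure E))).
move=> T d Omega P X rho rho_ac delta b gamma k s gsp spec mass1 _ _ ac nz b0 g0 small _ _.
split; first exact: ac_lower_bound_exists ac nz.
move=> E nu acE m1 m2 N_0 C.
have [mE _ E0 nu0 _] := acE.
have e0 : 0 < fine (lebesgue_measure E).
  by apply: fine_gt0; rewrite E0 (spectral_set_lty acE).
have [N00 NP] := MP (b, gamma, nu, fine (lebesgue_measure E)) b0 g0 nu0 e0.
have [c00 _] := c0P (b, gamma, nu) b0 g0 nu0.
split => //; first exact: mulr_gt0.
move=> N /NP/=[p [m [lv [beta [t [a0 [cs [[[p0 gp] pN] [m0 mN]]]]]]]]].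
move=> [[lv0 t0] [beta0 cs0] ge0 ge1 avg] le.
have := persistence_le gsp spec mass1 b0 g0 small ac acE p0 gp pN m0 mN lv0 t0 beta0 cs0 ge0 ge1 avg.
move=> /le_trans/(_ _); rewrite -lee_fin in le => /(_ _ le) h.
apply: (@le_trans _ _ (lne (expR (- (c0 (b, gamma, nu) * fine (lebesgue_measure E) * persistence_rate gamma N)))%:E)).
  rewrite lee_lne// in_itv/= ?leey ?andbT ?lee_fin ?expR_ge0//.
  exact: mu_ext_ge0.
by rewrite lne_EFin ?expR_gt0// expRK mulNr.
Qed.
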